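(* Let $(M,\phi,\xi,\eta,g)$ be an almost contact metric manifold with $\xi$ non-Killing. Then $(M,\phi,\xi,\eta,g)$ is a contact metric $(\kappa,\mu)$-space (for some $\kappa,\mu\in\mathbb{R}$) if and only if it admits two orthogonal conjugate Legendrian distributions $L$ and $Q$ and a linear connection $\tilde\nabla$ satisfying the following properties: (i) $\tilde\nabla L\subset L$, $\tilde\nabla Q\subset Q$; (ii) $\tilde\nabla\eta=0$, $\tilde\nabla d\eta=0$, $\tilde\nabla g=0$, $\tilde\nabla h=0$; (iii) $\tilde T(Z,Z')=2\Phi(Z,Z')\xi$ for all $Z,Z'\in\Gamma(\mathcal{D})$, and $\tilde T(V,\xi)=[\xi,V_L]_Q+[\xi,V_Q]_L$ for all $V\in\Gamma(TM)$, where $\tilde T$ denotes the torsion tensor field of $\tilde\nabla$. Furthermore, $\tilde\nabla$ is uniquely determined, and $L$ and $Q$ are integrable and coincide with the eigenspaces of the operator $h$ (i.e. with the eigendistributions $\mathcal{D}_\lambda$, $\mathcal{D}_{-\lambda}$ of $h$, $\lambda=\sqrt{1-\kappa}$).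
   Context: Conventions: $d\eta(V,W)=\frac12\big(V(\eta(W))-W(\eta(V))-\eta([V,W])\big)$; $R_{VW}=[\nabla_V,\nabla_W]-\nabla_{[V,W]}$ with $\nabla$ the Levi-Civita connection. An almost contact metric manifold is a $(2n+1)$-dimensional Riemannian manifold $(M,g)$ with a $(1,1)$-tensor field $\phi$, a $1$-form $\eta$ and a vector field $\xi$ (the Reeb vector field) such that $\eta(\xi)=1$, $\phi^2V=-V+\eta(V)\xi$, $g(\phi V,\phi W)=g(V,W)-\eta(V)\eta(W)$. Put $\Phi(V,W)=g(V,\phi W)$. It is a contact metric manifold if $d\eta=\Phi$. Put $\mathcal{D}=\ker\eta$ and $h=\frac12\mathcal{L}_\xi\phi$ (Lie derivative), also in the almost contact metric case. A contact metric $(\kappa,\mu)$-space is a contact metric manifold such that for some real numbers $\kappa,\mu$ and all vector fields $V,W$, $$R_{VW}\xi=\kappa(\eta(W)V-\eta(V)W)+\mu(\eta(W)hV-\eta(V)hW).$$ It is known that $\kappa\le1$, that $\kappa=1$ implies $h=0$ (Sasakian), and that for $\kappa<1$ the eigenvalues of $h$ are $0,\pm\lambda$ with $\lambda=\sqrt{1-\kappa}$, with mutually orthogonal integrable eigendistributions $\mathbb{R}\xi$, $\mathcal{D}_\lambda$, $\mathcal{D}_{-\lambda}$. By a Legendrian distribution on an almost contact manifold is meant here an $n$-dimensional subbundle $L$ of $\mathcal{D}$ with $d\eta(X,X')=0$ for all $X,X'\in\Gamma(L)$. Two Legendrian distributions $L,Q$ are conjugate if $Q=\phi L$, and orthogonal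 if they are $g$-orthogonal; then $TM=L\oplus Q\oplus\mathbb{R}\xi$, and $V_L$, $V_Q$ denote the projections of $V$ onto $L$ and $Q$.
   Formalization: M is assumed connected; otherwise the claim fails: on a disjoint union of two non-Sasakian (κ,μ)-spaces with different κ, the distributions L, Q and the connection exist, but no single κ, μ do. *)

(* Defs.v *)
From HB Require Import structures.
From mathcomp Require Import all_boot all_order all_algebra.
From mathcomp Require Import all_classical all_reals all_analysis.

Set Implicit Arguments.
Unset Strict Implicit.
Unset Printing Implicit Defensive.

Import Order.TTheory GRing.Theory Num.Theory.
Import numFieldNormedType.Exports.
Local Open Scope classical_set_scope.
Local Open Scope ring_scope.

(* [Ck k U f]: all iterated partial derivatives of f of order at most k exist
   and are continuous on the set U, which is open in all the uses below. *)
Fixpoint Ck (R : realType) (m : nat) (k : nat) (U : set 'rV[R]_m)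
    (f : 'rV[R]_m -> R) : Prop :=
  (forall x, U x -> {for x, continuous f}) /\
  match k with
  | 0 => True
  | k'.+1 => forall i : 'I_m,
      (forall x, U x -> derivable f x (delta_mx 0 i)) /\
      Ck k' U (fun x => 'D_(delta_mx 0 i) f x)
  end.

Definition smooth_on (R : realType) (m : nat) (U : set 'rV[R]_m)
  (f : 'rV[R]_m -> R) : Prop := forall k, Ck k U f.

Section smooth_on_theory.
Variables (R : realType) (m : nat) (U : set 'rV[R]_m).
Hypothesis oU : open U.
Implicit Types f g : 'rV[R]_m -> R.

Lemma CkW k f : Ck k.+1 U f -> Ck k U f.
Proof.
elim: k f => [|k IH] f [cf df]; split=> // i; have [d1 d2] := df i.
by split=> //; exact: IH.
Qed.

Lemma near_eqU f g : (forall x, U x -> f x = g x) ->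
  forall x, U x -> \near x, f x = g x.
Proof.
by move=> fg x Ux; have := open_nbhs_nbhs (conj oU Ux); exact: filterS fg.
Qed.

Lemma eq_contU f g : (forall x, U x -> f x = g x) ->
  forall x, U x -> {for x, continuous f} -> {for x, continuous g}.
Proof.
move=> fg x Ux cf; rewrite /prop_for /continuous_at -(fg x Ux).
apply: cvg_trans cf; apply: (@near_eq_cvg _ _ (nbhs x)).
exact: (near_eqU fg Ux).
Qed.

Lemma eq_Ck k f g : (forall x, U x -> f x = g x) -> Ck k U f -> Ck k U g.
Proof.
elim: k f g => [|k IH] f g fg [cf df].
  by split=> // x Ux; exact: eq_contU fg _ Ux (cf x Ux).
split=> [x Ux|i]; first exact: eq_contU fg _ Ux (cf x Ux).
have [d1 d2] := df i; split=> [x Ux|].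
  by apply: near_eq_derivable (d1 x Ux); exact: (near_eqU fg Ux).
by apply: IH d2 => x Ux; apply: near_eq_derive; exact: (near_eqU fg Ux).
Qed.

Lemma Ck_cst k (c : R) : Ck k U (cst c).
Proof.
elim: k c => [|k IH] c; split=> //.
- by move=> x _; exact: cst_continuous.
- by move=> x _; exact: cst_continuous.
move=> i; split=> [x _|]; first exact: derivable_cst.
by apply: (eq_Ck _ (IH 0)) => x _; rewrite derive_cst.
Qed.

Lemma CkD k f g : Ck k U f -> Ck k U g -> Ck k U (f + g).
Proof.
elim: k f g => [|k IH] f g [cf df] [cg dg]; split=> //.
- by move=> x Ux; exact: continuousD (cf x Ux) (cg x Ux).
- by move=> x Ux; exact: continuousD (cf x Ux) (cg x Ux).
move=> i; have [df1 df2] := df i; have [dg1 dg2] := dg i.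
split=> [x Ux|]; first by apply: derivableD; [exact: df1|exact: dg1].
apply: eq_Ck (IH _ _ df2 dg2) => x Ux.
by rewrite deriveD //; [exact: df1|exact: dg1].
Qed.

Lemma CkM k f g : Ck k U f -> Ck k U g -> Ck k U (f * g).
Proof.
elim: k f g => [|k IH] f g Cf Cg.
  case: Cf Cg => cf _ [cg _]; split=> // x Ux.
  exact: continuousM (cf x Ux) (cg x Ux).
have [Cf' Cg'] := (CkW Cf, CkW Cg); case: Cf Cg => cf df [cg dg].
split=> [x Ux|i]; first exact: continuousM (cf x Ux) (cg x Ux).
have [df1 df2] := df i; have [dg1 dg2] := dg i.
split=> [x Ux|]; first by apply: derivableM; [exact: df1|exact: dg1].
apply: eq_Ck (CkD (IH _ _ Cf' dg2) (IH _ _ Cg' df2)) => x Ux.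
by rewrite deriveM //; [exact: df1|exact: dg1].
Qed.

End smooth_on_theory.

Section manifolds.
Variables (R : realType) (m : nat).

(* The values of [chart_map] outside [chart_dom], and of [chart_inv] outside
   the image of [chart_dom], are irrelevant. *)
Record chart (M : topologicalType) := Chart {
  chart_dom : set M;
  chart_map : M -> 'rV[R]_m;
  chart_inv : 'rV[R]_m -> M;
  chart_dom_open : open chart_dom;
  chart_img_open : open (chart_map @` chart_dom);
  chart_mapK : forall p, chart_dom p -> chart_inv (chart_map p) = p;
  chart_map_cont : forall p, chart_dom p -> {for p, continuous chart_map};
  chart_inv_cont : forall x, (chart_map @` chart_dom) x ->
    {for x, continuous chart_inv} }.

Record manifold := Manifold {
  mfd_space :> topologicalType;
  mfd_hausdorff : hausdorff_space mfd_space;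
  mfd_second_countable : @second_countable mfd_space;
  atlas : set (chart mfd_space);
  atlas_cover : forall p, exists2 c, atlas c & chart_dom c p;
  atlas_smooth : forall c c', atlas c -> atlas c' -> forall i : 'I_m,
    smooth_on (chart_map c @` (chart_dom c `&` chart_dom c'))
              (fun x => chart_map c' (chart_inv c x) 0 i) }.

End manifolds.

Arguments chart_dom_open {R m M} c : rename.
Arguments chart_img_open {R m M} c : rename.

Section smooth_functions.
Variables (R : realType) (m : nat) (M : manifold R m).

Definition smooth (f : M -> R) : Prop := forall c, atlas c ->
  smooth_on (chart_map c @` chart_dom c) (f \o chart_inv c).

Definition smooth_pred : {pred M -> R} := fun f => `[< smooth f >].

Fact smooth_subring : subring_closed smooth_pred.
Proof.
split.
- apply/asboolP => c ac k; have oc := chart_img_open c.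
  by apply: (eq_Ck oc _ (Ck_cst oc k 1)) => x _.
- move=> f g /asboolP sf /asboolP sg; apply/asboolP => c ac k.
  have oc := chart_img_open c.
  apply: (eq_Ck oc _ (CkD oc (sf c ac k)
     (CkM oc (Ck_cst oc k (-1)) (sg c ac k)))) => x _.
  by rewrite !fctE /= mulN1r.
- move=> f g /asboolP sf /asboolP sg; apply/asboolP => c ac k.
  exact: (CkM (chart_img_open c) (sf c ac k) (sg c ac k)).
Qed.

Fact smooth_scale : scaler_closed smooth_pred.
Proof.
move=> a f /asboolP sf; apply/asboolP => c ac k.
have oc := chart_img_open c.
exact: (CkM oc (Ck_cst oc k a) (sf c ac k)).
Qed.

HB.instance Definition _ :=
  GRing.isSubringClosed.Build (M -> R) smooth_pred smooth_subring.
HB.instance Definition _ :=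
  GRing.isScaleClosed.Build R (M -> R) smooth_pred smooth_scale.

Record Cinf := MkCinf {
  Cinf_fun :> M -> R;
  CinfP : Cinf_fun \in smooth_pred }.

HB.instance Definition _ := [isSub for Cinf_fun].
HB.instance Definition _ := [Choice of Cinf by <:].
HB.instance Definition _ :=
  GRing.SubChoice_isSubComPzRing.Build (M -> R) smooth_pred Cinf smooth_subring.
HB.instance Definition _ := [SubZmodule_isSubLmodule of Cinf by <:].

End smooth_functions.

Section vector_fields.
Variables (R : realType) (m : nat) (M : manifold R m).

(* A smooth vector field is a smooth choice of a tangent vector at each point,
   tangent vectors at p being the derivations of C^oo(M) at p. *)
Record vfield := VField {
  vfield_fun :> Cinf M -> Cinf M;
  vfield_lin : forall (a : R) (f g : Cinf M),
    vfield_fun (a *: f + g) = a *: vfield_fun f + vfield_fun g;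
  vfield_leibniz : forall f g : Cinf M,
    vfield_fun (f * g) = f * vfield_fun g + g * vfield_fun f }.

(* The tangent vector of V at p *)
Definition tangent (V : vfield) (p : M) : Cinf M -> R := fun f => V f p.

HB.instance Definition _ := gen_eqMixin vfield.
HB.instance Definition _ := gen_choiceMixin vfield.

Lemma vfieldP (V W : vfield) : (forall f, V f = W f) -> V = W.
Proof.
case: V W => [v v1 v2] [w w1 w2] /= /funext vw; case: _ / vw w1 w2 => w1 w2.
by congr VField; exact: Prop_irrelevance.
Qed.

Lemma Cinf_scalerAr (a : R) (f g : Cinf M) : a *: (f * g) = f * (a *: g).
Proof. by apply: val_inj; apply/funext => p; exact: mulrCA. Qed.

Lemma vfieldD (V : vfield) : {morph V : f g / f + g}.
Proof. by move=> f g; rewrite -[f in LHS]scale1r vfield_lin scale1r. Qed.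

Lemma vfieldN (V : vfield) : {morph V : f / - f}.
Proof.
move=> f; have V0 : V 0 = 0.
  by apply: (addrI (V 0)); rewrite -vfieldD !addr0.
by apply: (addrI (V f)); rewrite -vfieldD !addrN.
Qed.

Local Obligation Tactic := idtac.

Program Definition vf_zero : vfield := @VField (fun=> 0) _ _.
Next Obligation. by move=> * /=; rewrite scaler0 addr0. Qed.
Next Obligation. by move=> * /=; rewrite !mulr0 addr0. Qed.

Program Definition vf_opp (V : vfield) : vfield := @VField (fun f => - V f) _ _.
Next Obligation. by move=> * /=; rewrite vfield_lin opprD scalerN. Qed.
Next Obligation. by move=> * /=; rewrite vfield_leibniz opprD !mulrN. Qed.

Program Definition vf_add (V W : vfield) : vfield :=
  @VField (fun f => V f + W f) _ _.
Next Obligation. by move=> * /=; rewrite !vfield_lin scalerDr addrACA. Qed.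
Next Obligation. by move=> * /=; rewrite !vfield_leibniz !mulrDr addrACA. Qed.

Program Definition vf_scale (h : Cinf M) (V : vfield) : vfield :=
  @VField (fun f => h * V f) _ _.
Next Obligation. by move=> * /=; rewrite vfield_lin mulrDr Cinf_scalerAr. Qed.
Next Obligation.
by move=> * /=; rewrite vfield_leibniz mulrDr; congr (_ + _); rewrite mulrCA.
Qed.

Program Definition bracket (V W : vfield) : vfield :=
  @VField (fun f => V (W f) - W (V f)) _ _.
Next Obligation. by move=> * /=; rewrite !vfield_lin scalerBr opprD addrACA. Qed.
Next Obligation.
move=> V W f g /=.
rewrite !vfield_leibniz !vfieldD !vfield_leibniz !mulrBr.
rewrite addrACA [X in _ - X]addrACA [V g * _ + _]addrC.
rewrite [W g * _]mulrC [W f * _]mulrC.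
by rewrite opprD [LHS]addrACA addrN addr0 opprD [LHS]addrACA.
Qed.

Fact vf_addA : associative vf_add.
Proof. by move=> U V W; apply: vfieldP => f /=; rewrite addrA. Qed.

Fact vf_addC : commutative vf_add.
Proof. by move=> U V; apply: vfieldP => f /=; rewrite addrC. Qed.

Fact vf_add0 : left_id vf_zero vf_add.
Proof. by move=> U; apply: vfieldP => f /=; rewrite add0r. Qed.

Fact vf_addN : left_inverse vf_zero vf_opp vf_add.
Proof. by move=> U; apply: vfieldP => f /=; rewrite addNr. Qed.

HB.instance Definition _ :=
  GRing.isZmodule.Build vfield vf_addA vf_addC vf_add0 vf_addN.

Fact vf_scaleA a b V : vf_scale a (vf_scale b V) = vf_scale (a * b) V.
Proof. by apply: vfieldP => f /=; rewrite mulrA. Qed.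

Fact vf_scale1 : left_id 1 vf_scale.
Proof. by move=> V; apply: vfieldP => f /=; rewrite mul1r. Qed.

Fact vf_scaleDr : right_distributive vf_scale +%R.
Proof. by move=> a V W; apply: vfieldP => f /=; rewrite mulrDr. Qed.

Fact vf_scaleDl V : {morph vf_scale^~ V : a b / a + b}.
Proof. by move=> a b; apply: vfieldP => f /=; rewrite mulrDl. Qed.

HB.instance Definition _ := GRing.Zmodule_isLmodule.Build (Cinf M) vfield
  vf_scaleA vf_scale1 vf_scaleDr vf_scaleDl.

End vector_fields.

Section riemannian_geometry.
Variables (R : realType) (m : nat) (M : manifold R m).
Local Notation X := (vfield M).
Local Notation C := (Cinf M).

(* Tensor fields are C^oo(M)-multilinear maps on vector fields. *)
Record metric := Metric {
  metric_fun :> X -> X -> C;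
  metric_lin : forall (f : C) (U V W : X),
    metric_fun (f *: U + V) W = f * metric_fun U W + metric_fun V W;
  metric_sym : forall V W, metric_fun V W = metric_fun W V;
  metric_pos : forall V p,
    tangent V p <> (fun=> 0) -> 0 < metric_fun V V p }.

Record connection := Connection {
  cov :> X -> X -> X;
  cov_lin : forall (f : C) (U V W : X),
    cov (f *: U + V) W = f *: cov U W + cov V W;
  cov_add : forall U V W : X, cov U (V + W) = cov U V + cov U W;
  cov_leibniz : forall (f : C) (V W : X),
    cov V (f *: W) = V f *: W + f *: cov V W }.

Definition torsion (D : connection) (V W : X) : X :=
  D V W - D W V - bracket V W.

Definition curvature (D : connection) (V W Z : X) : X :=
  D V (D W Z) - D W (D V Z) - D (bracket V W) Z.

Definition parallel1 (D : connection) (w : X -> C) : Prop :=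
  forall V W : X, V (w W) - w (D V W) = 0.

Definition parallel2 (D : connection) (b : X -> X -> C) : Prop :=
  forall V W Z : X, V (b W Z) - b (D V W) Z - b W (D V Z) = 0.

Definition parallel_endo (D : connection) (a : X -> X) : Prop :=
  forall V W : X, D V (a W) - a (D V W) = 0.

Definition levi_civita (g : metric) (D : connection) : Prop :=
  (forall V W, torsion D V W = 0) /\ parallel2 D g.

Definition killing (g : metric) (Z : X) : Prop :=
  forall V W : X, Z (g V W) - g (bracket Z V) W - g V (bracket Z W) = 0.

Definition ext_d (w : X -> C) (V W : X) : C :=
  2^-1 *: (V (w W) - W (w V) - w (bracket V W)).

Definition lie_endo (Z : X) (a : X -> X) (V : X) : X :=
  bracket Z (a V) - a (bracket Z V).

(* A distribution assigns to p a set of tangent vectors at p, which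
   [is_subbundle] requires to be a linear subspace. *)
Definition tangent_distribution := M -> set (C -> R).

Definition sections (L : tangent_distribution) : set X :=
  [set V | forall p, L p (tangent V p)].

(* L has rank r and a smooth local frame around each point; the elements of
   the frame may be taken to be restrictions of global vector fields. *)
Definition is_subbundle (r : nat) (L : tangent_distribution) : Prop :=
  forall p : M, exists E : 'I_r -> X, \forall q \near p,
    (forall a : 'I_r -> R,
       (forall f, \sum_(i < r) a i * tangent (E i) q f = 0) ->
       forall i, a i = 0) /\
    L q = [set v | exists a : 'I_r -> R,
                   v = fun f => \sum_(i < r) a i * tangent (E i) q f].

(* Integrability is closure under the Lie bracket; by Frobenius this amounts to
   the existence of integral submanifolds. *)
Definition integrable_dist (L : tangent_distribution) : Prop :=
  forall V W, sections L V -> sections L W -> sections L (bracket V W).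

Definition preserves (D : connection) (L : tangent_distribution) : Prop :=
  forall V W, sections L W -> sections L (D V W).

Definition image_dist (a : X -> X) (L : tangent_distribution) :
    tangent_distribution :=
  fun p => [set tangent (a V) p | V in [set V | L p (tangent V p)]].

Definition eigendist (a : X -> X) (l : R) : tangent_distribution :=
  fun p => [set tangent V p | V in
    [set V | tangent (a V) p = fun f => l * tangent V p f]].

Definition orthogonal_dist (g : metric) (L Q : tangent_distribution) : Prop :=
  forall V W, sections L V -> sections Q W -> g V W = 0.

End riemannian_geometry.

Section contact_geometry.
Variables (R : realType) (m : nat) (M : manifold R m).
Local Notation X := (vfield M).
Local Notation C := (Cinf M).

Record almost_contact_metric := AlmostContactMetric {
  acm_phi : {linear X -> X};
  acm_xi : X;
  acm_eta : {scalar X};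
  acm_g : metric M;
  acm_eta_xi : acm_eta acm_xi = 1;
  acm_phi2 : forall V, acm_phi (acm_phi V) = - V + acm_eta V *: acm_xi;
  acm_compat : forall V W,
    acm_g (acm_phi V) (acm_phi W) = acm_g V W - acm_eta V * acm_eta W }.

Variable S : almost_contact_metric.
Local Notation phi := (acm_phi S).
Local Notation xi := (acm_xi S).
Local Notation eta := (acm_eta S).
Local Notation g := (acm_g S).

Definition fundamental_form (V W : X) : C := g V (phi W).

Definition contact_metric : Prop :=
  forall V W, ext_d eta V W = fundamental_form V W.

Definition acm_h (V : X) : X := (2^-1 *: (1 : C)) *: lie_endo xi phi V.

Definition contact_metric_space (kappa mu : R) : Prop :=
  contact_metric /\
  exists2 D : connection M, levi_civita g D & forall V W,
    curvature D V W xi =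
      (kappa *: (1 : C)) *: (eta W *: V - eta V *: W) +
      (mu *: (1 : C)) *: (eta W *: acm_h V - eta V *: acm_h W).

Definition legendrian (n : nat) (L : tangent_distribution M) : Prop :=
  [/\ is_subbundle n L,
      forall V, sections L V -> eta V = 0 &
      forall V W, sections L V -> sections L W -> ext_d eta V W = 0].

Definition conjugate_dist (L Q : tangent_distribution M) : Prop :=
  Q = image_dist phi L.

(* The component V_L of V in the decomposition TM = L (+) Q (+) R xi *)
Definition proj (L Q : tangent_distribution M) (V : X) : X :=
  xget 0 [set VL | sections L VL /\
    exists2 VQ, sections Q VQ & exists f : C, V = VL + VQ + f *: xi].

(* L and Q are orthogonal conjugate Legendrian distributions, and D is a
   linear connection with the properties (i), (ii), (iii). *)
Definition adapted (n : nat) (L Q : tangent_distribution M)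
    (D : connection M) : Prop :=
  [/\ [/\ legendrian n L, legendrian n Q, conjugate_dist L Q &
          orthogonal_dist g L Q],
      preserves D L /\ preserves D Q,
      [/\ parallel1 D eta, parallel2 D (ext_d eta), parallel2 D g &
          parallel_endo D acm_h] &
      (forall Z Z', eta Z = 0 -> eta Z' = 0 ->
         torsion D Z Z' = (2 * fundamental_form Z Z') *: xi) /\
      (forall V, torsion D V xi =
         proj Q L (bracket xi (proj L Q V)) +
         proj L Q (bracket xi (proj Q L V)))].

End contact_geometry.

(* Main.v *)
From HB Require Import structures.
Require Import Defs.
From mathcomp Require Import all_boot all_order all_algebra.
From mathcomp Require Import all_classical all_reals all_analysis.
From mathcomp Require Import ring lra zify.
Import Order.TTheory GRing.Theory Num.Theory.
Import numFieldNormedType.Exports.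
Set Implicit Arguments.
Unset Strict Implicit.
Unset Printing Implicit Defensive.
Local Open Scope classical_set_scope.
Local Open Scope ring_scope.

(** The proof is algebra over the ring of smooth functions, once a few analytic
    facts are known. Plateau functions and Hadamard's lemma show that derivations
    are local and that the coordinate fields form local frames ([local_frame]);
    hence function-linear maps act pointwise ([tensorial]), fields can be glued
    ([glue_vfield]), a field splits along L, Q and xi ([decomposition]), and the
    image of a projection of constant rank is a subbundle ([image_subbundle]). A
    function killed by all fields is constant, as M is connected.

    From a (kappa, mu)-space to the connection. Let N be the Levi-Civita connection.
    On a contact metric manifold N_V xi = - phi V - phi h V, and the curvature
    condition, read at xi, becomes h ^ 2 = 1 - kappa on the contact distribution
    ([h_square]). As xi is not Killing, h does not vanish, so kappa < 1, and h has
    there the two eigenvalues l and - l with l ^ 2 = 1 - kappa; phi exchanges the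
    eigendistributions. The vanishing of R(V, W) xi for V and W in the contact
    distribution shows that N_V W, for V and W in one eigendistribution, is
    orthogonal to the other one ([cov_eigen_orth]): a trilinear form that is
    symmetric in two arguments and skew in two others is zero. The same trick,
    applied to the closed form Phi, controls the covariant derivative of phi
    ([cov_phi_eigen]). Therefore N, projected to the eigendistributions and with
    xi made parallel, is an adapted connection ([adapted_eigen]).

    From the connection to the (kappa, mu)-space. Let D be adapted to L and Q. The
    torsion gives d eta = Phi and, because D preserves Phi and g, also phi is
    parallel. What remains of the torsion is the operator tau V = T(V, xi), which
    exchanges L and Q, and 2 h = tau phi - phi tau. For V, W in L and Y in Q, the
    first Bianchi identity expresses the component of R(V, W) Y along Q through tau;
    as this component is skew, the form g (tau V) (phi W) on L is a multiple of g
    ([tau_umbilic]). So tau is a multiple b phi of phi on L, and by symmetry a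
    multiple c phi on Q. The Bianchi identity with xi as one of the arguments gives
    V b = 0 for V in Q and V c = 0 for V in L; since h, of eigenvalue (b - c) / 2
    on L, is parallel, and since brackets of L and Q yield xi, both b and c are
    constant ([tau_constants]). With l = (b - c) / 2 and s = (b + c) / 2, one has
    tau = phi h + s phi, the Levi-Civita connection is an explicit algebraic
    modification of D ([lc_conn]), and its curvature satisfies the condition with
    kappa = 1 - l ^ 2 and mu = 2 (1 - s) ([lc_conn_curvature]). The number l is not
    zero because xi is not Killing, and L and Q are the eigendistributions of h
    for l and - l.

    Uniqueness. Two adapted connections D and D', with numbers s and s', satisfy
    D'_xi V - D_xi V = (s - s') phi V. On L the left-hand side belongs to the same
    eigendistribution of h as V, the right-hand side to the other, so s = s'. Then
    the torsions agree, and a metric connection is determined by its torsion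
    ([adapted_unique]). *)

(** * Partial derivatives and the chain rule *)

Lemma cvg_sumr (R : realType) T (F : set_system T) {FF : Filter F} m
    (f : 'I_m -> T -> R) (l : 'I_m -> R) :
  (forall i, f i t @[t --> F] --> l i) ->
  (\sum_i f i t) @[t --> F] --> \sum_i l i.
Proof.
move=> fl; elim: m f l fl => [|m IH] f l fl.
  by under eq_fun do rewrite big_ord0; rewrite big_ord0; exact: cvg_cst.
under eq_fun do rewrite big_ord_recr; rewrite big_ord_recr /=.
by apply: cvgD => //; apply: (IH (fun i => f (widen_ord (leqnSn m) i))) => i.
Qed.

Section calculus.
Variables (R : realType) (m : nat).
Implicit Types (f : 'rV[R]_m -> R) (U W : set 'rV[R]_m).

Lemma Ck_sub k f U W : W `<=` U -> Ck k U f -> Ck k W f.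
Proof.
elim: k f => [|k IH] f WU [cf df]; split; try by move=> x /WU /cf.
  by [].
by move=> i; have [d1 d2] := df i; split=> [x /WU /d1//|]; exact: IH.
Qed.

Lemma Ck_local k f U :
  (forall x, U x -> exists2 W, W x & Ck k W f) -> Ck k U f.
Proof.
elim: k f => [|k IH] f H; split=> //.
- by move=> x /H[W Wx [cf _]]; exact: cf.
- by move=> x /H[W Wx [cf _]]; exact: cf.
move=> i; split=> [x /H[W Wx [_ /(_ i)[df _]]]|]; first exact: df.
by apply: IH => x /H[W Wx [_ /(_ i)[_ df]]]; exists W.
Qed.

Lemma row_mx_norm_le (h : 'rV[R]_m) e : 0 <= e ->
  (forall j, `|h 0 j| <= e) -> `|h| <= e.
Proof.
move=> e0 he; rewrite /Num.Def.normr/= mx_normrE.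
by apply: bigmax_le => // -[i j] _; rewrite (ord1 i).
Qed.

Lemma coord_norm_le (h : 'rV[R]_m) j : `|h 0 j| <= `|h|.
Proof.
rewrite [leRHS]/Num.Def.normr/= mx_normrE.
exact: (le_bigmax _ (fun i : 'I_1 * 'I_m => `|h i.1 i.2|) (0, j)).
Qed.

(** The vertices of the broken line that joins x to y by changing one coordinate
    at a time. *)
Definition mix (x y : 'rV[R]_m) (k : nat) : 'rV[R]_m :=
  \row_j (if (j < k)%N then y 0 j else x 0 j).

Lemma is_derive_line f x v t :
  derivable f (x + t *: v) v ->
  is_derive t (1 : R) (fun s : R => f (x + s *: v)) ('D_v f (x + t *: v)).
Proof.
move=> df.
have E : (fun h : R => h^-1 *: (((fun s : R => f (x + s *: v)) \o shift t)
            (h *: 1) - f (x + t *: v))) =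
         (fun h : R => h^-1 *: ((f \o shift (x + t *: v)) (h *: v) - f (x + t *: v))).
  apply/funext => h /=; congr (_ *: (f _ - _)).
  by rewrite [h *: 1]mulr1 scalerDl addrCA addrC.
by split; rewrite /derivable /derive E.
Qed.

(** The mean value theorem on one edge of the broken line from x to y; the
    intermediate point z is no further from x than y is. *)
Lemma slope_partial f x (y : 'rV[R]_m) (j : 'I_m) (r : R) :
  (forall z, `|z - x| < r -> derivable f z (delta_mx 0 j)) ->
  `|y - x| < r ->
  exists2 z, `|z - x| <= `|y - x| &
    f (mix x y j.+1) - f (mix x y j) =
      'D_(delta_mx 0 j) f z * (y 0 j - x 0 j).
Proof.
move=> df yr; set v := delta_mx 0 j; set d := y 0 j - x 0 j.
(* the edge is parametrized by the deviation s of the j-th coordinate from x *)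
have mixE (s : R) k : (mix x y j + s *: v) 0 k - x 0 k =
   (if (k < j)%N then y 0 k - x 0 k else if k == j then s else 0).
  rewrite !mxE eqxx /=; case: (ltngtP k j) => kj.
  - by rewrite -val_eqE (ltn_eqF kj) mulr0 addr0.
  - by rewrite -val_eqE (gtn_eqF kj) mulr0 addr0 subrr.
  by rewrite (val_inj kj) eqxx mulr1 addrC addKr.
have mix_le (s : R) : `|s| <= `|d| -> `|mix x y j + s *: v - x| <= `|y - x|.
  move=> sd; apply: row_mx_norm_le => // k; rewrite mxE [X in _ + X]mxE mixE.
  have dle i : `|y 0 i - x 0 i| <= `|y - x|.
    by have := coord_norm_le (y - x) i; rewrite !mxE.
  case: ifP => _; first exact: dle.
  case: eqP => _; last by rewrite normr0.
  exact: le_trans sd (dle j).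
have E0 : mix x y j.+1 = mix x y j + d *: v.
  apply/rowP => k; apply: (addIr (- x 0 k)); rewrite mixE mxE.
  case: (ltngtP k j) => kj; first by rewrite ltnS ltnW.
    by rewrite ltnS leqNgt kj /= -val_eqE (gtn_eqF kj) subrr.
  by rewrite ltnS kj leqnn (val_inj kj) eqxx.
pose F s := f (mix x y j + s *: v).
have dF s : `|s| <= `|d| ->
    is_derive s (1 : R) F ('D_v f (mix x y j + s *: v)).
  move=> sd; apply: is_derive_line; apply: df.
  exact: le_lt_trans (mix_le _ sd) yr.
have cF s : `|s| <= `|d| -> {for s, continuous F}.
  by move=> /dF[sd _]; apply/differentiable_continuous/derivable1_diffP.
suff [s sd E1] : exists2 s, `|s| <= `|d| &
    F d - F 0 = 'D_v f (mix x y j + s *: v) * d.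
  exists (mix x y j + s *: v); first exact: mix_le.
  by rewrite E0 -E1 /F scale0r addr0.
have [d0|d0] := leP 0 d.
  have [s|s|s sI E1] := @MVT_segment R F (fun s => 'D_v f (mix x y j + s *: v)) 0 d d0.
  - rewrite in_itv /= => /andP[s0 s1]; apply: dF.
    by rewrite (ger0_norm d0) (ger0_norm (ltW s0)) ltW.
  - by apply: continuous_in_subspaceT => {}s; rewrite inE /= in_itv /=
      => /andP[s0 s1]; apply: cF; rewrite (ger0_norm d0) (ger0_norm s0).
  exists s; last by rewrite E1 subr0.
  by move: sI; rewrite in_itv /= => /andP[s0 s1]; rewrite (ger0_norm d0) (ger0_norm s0).
have [s|s|s sI E1] := @MVT_segment R F (fun s => 'D_v f (mix x y j + s *: v)) d 0 (ltW d0).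
- rewrite in_itv /= => /andP[s0 s1]; apply: dF.
  by rewrite (ler0_norm (ltW d0)) (ler0_norm (ltW s1)) lerN2 ltW.
- by apply: continuous_in_subspaceT => {}s; rewrite inE /= in_itv /=
    => /andP[s0 s1]; apply: cF; rewrite (ler0_norm (ltW d0)) (ler0_norm s1) lerN2.
exists s; last by apply: oppr_inj; rewrite opprB E1 sub0r mulrN.
by move: sI; rewrite in_itv /= => /andP[s0 s1]; rewrite (ler0_norm (ltW d0)) (ler0_norm s1) lerN2.
Qed.

(** Differentiability in Caratheodory's form: the increment of f is a sum over
    the edges of the broken line, and the slope on each edge tends to the
    partial derivative because the latter is continuous. *)
Lemma caratheodory U f x : open U -> Ck 1 U f -> U x ->
  exists c : 'I_m -> 'rV[R]_m -> R,
    (forall j, c j y @[y --> x] --> 'D_(delta_mx 0 j) f x) /\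
    (\forall y \near x, f y - f x = \sum_j c j y * (y 0 j - x 0 j)).
Proof.
move=> oU [_ df] Ux.
pose c (j : 'I_m) (y : 'rV[R]_m) := if y 0 j == x 0 j then 'D_(delta_mx 0 j) f x else
  (f (mix x y j.+1) - f (mix x y j)) / (y 0 j - x 0 j).
exists c; split=> [j|]; last first.
  near=> y.
  transitivity (\sum_(j < m) (f (mix x y j.+1) - f (mix x y j))).
    have -> : f y = f (mix x y m).
      by congr f; apply/rowP => k; rewrite mxE ltn_ord.
    have -> : f x = f (mix x y 0) by congr f; apply/rowP => k; rewrite mxE.
    by rewrite -(big_mkord xpredT (fun j => f (mix x y j.+1) - f (mix x y j)))
      telescope_sumr.
  apply: eq_bigr => j _; rewrite /c; case: eqP => [yx|/eqP yx].
    have -> : mix x y j.+1 = mix x y j.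
      apply/rowP => k; rewrite !mxE ltnS leq_eqVlt.
      by case: eqP => //= kj; rewrite kj ltnn (val_inj kj) yx.
    by rewrite !subrr yx subrr mulr0.
  by rewrite divfK// subr_eq0.
have [d1 [d2 _]] := df j.
apply/(cvgrPdist_le (FF := nbhs_filter x)) => e e0.
have /cvgrPdist_le/(_ _ e0)/nbhs_ballP[r1 /= r10 H1] := d2 x Ux.
have /nbhs_ballP[r2 /= r20 H2] := open_nbhs_nbhs (conj oU Ux).
pose r := Num.min r1 r2; have r0 : 0 < r by rewrite lt_min r10.
have Hn : nbhs x [set y | `|y - x| < r].
  by apply/nbhs_ballP; exists r => //= y; rewrite -ball_normE /= distrC.
apply: (@filterS _ (nbhs x) _ _ _ _ Hn) => y /= yr.
rewrite /c; case: eqP => [_|/eqP yx]; first by rewrite subrr normr0 ltW.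
have [z|z zy ->] := @slope_partial f x y j r _ yr.
  by rewrite lt_min => /andP[_ zr]; apply/d1/H2; rewrite -ball_normE /= distrC.
rewrite mulfK ?subr_eq0//; apply: H1; rewrite -ball_normE /= distrC.
by apply: (le_lt_trans zy); apply: (lt_le_trans yr); rewrite ge_min lexx.
Unshelve. all: by end_near. Qed.

(** The chain rule in a form that asks of the inner map nothing but derivatives
    along one direction; it suffices for derivatives along lines. *)
Lemma is_derive_comp_rV (V : normedModType R) U f (phi : V -> 'rV[R]_m) x v :
  open U -> Ck 1 U f -> U (phi x) ->
  (forall j, derivable (fun y => phi y 0 j) x v) ->
  is_derive x v (f \o phi)
    (\sum_j 'D_(delta_mx 0 j) f (phi x) * 'D_v (fun y => phi y 0 j) x).
Proof.
move=> oU Cf Ux dphi.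
have [c [cc fE]] := caratheodory oU Cf Ux.
have qphi j := dphi j : cvg _.
have dp : derivable phi x v by apply/derivable_mxP => i j; rewrite (ord1 i).
have cphi : phi (h *: v + x) @[h --> (0:R)^'] --> phi x.
  have [l ql] := (cvg_ex _).1 dp.
  have H : phi x + h *: (h^-1 *: (phi (h *: v + x) - phi x))
      @[h --> (0:R)^'] --> phi x + 0 *: l.
    by apply: cvgD; [exact: cvg_cst|apply: cvgZ ql; exact: nbhs_dnbhs].
  rewrite scale0r addr0 in H; apply: cvg_trans H; apply: near_eq_cvg.
  near=> h; rewrite scalerA divff ?scale1r 1?addrC ?subrK//.
  by near: h; exact: nbhs_dnbhs_neq.
have lim1 : (\sum_j c j (phi (h *: v + x)) * (h^-1 *: (phi (h *: v + x) 0 j - phi x 0 j)))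
    @[h --> (0:R)^'] -->
   \sum_j 'D_(delta_mx 0 j) f (phi x) * 'D_v (fun y => phi y 0 j) x.
  apply: cvg_sumr => j; apply: cvgM; last exact: dphi.
  by apply: cvg_comp cphi _; exact: cc.
have lim2 : h^-1 *: (((f \o phi) \o shift x) (h *: v) - (f \o phi) x)
    @[h --> (0:R)^'] -->
   \sum_j 'D_(delta_mx 0 j) f (phi x) * 'D_v (fun y => phi y 0 j) x.
  apply: cvg_trans lim1; apply: near_eq_cvg.
  have nE : \forall h \near (0:R)^', f (phi (h *: v + x)) - f (phi x) =
      \sum_j c j (phi (h *: v + x)) * (phi (h *: v + x) 0 j - phi x 0 j).
    exact: cphi _ fE.
  near=> h; rewrite /= (near nE h)//.
  by rewrite scaler_sumr; apply: eq_bigr => j _; rewrite scalerAr.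
split; first by apply/cvg_ex; eexists; exact: lim2.
by apply/cvg_lim => //; exact: lim2.
Unshelve. all: by end_near. Qed.

End calculus.

(** * Functions of class C^k and plateau functions *)

Section smooth_calculus.
Variables (R : realType).

Lemma rV_continuous (T : topologicalType) m (phi : T -> 'rV[R]_m) x :
  (forall j, {for x, continuous (fun y => phi y 0 j)}) ->
  {for x, continuous phi}.
Proof.
move=> cphi; apply/(cvgrPdist_le (FF := nbhs_filter x)) => e e0.
have H : \forall y \near x, forall j, `|phi x 0 j - phi y 0 j| <= e.
  apply: filter_forall => j.
  by have /(cvgrPdist_le (FF := nbhs_filter x)) /(_ _ e0) := cphi j.
apply: filterS H => y H; apply: row_mx_norm_le; first exact: ltW.
by move=> j; rewrite !mxE; exact: H.
Qed.

Lemma Ck_cont m k (U : set 'rV[R]_m) f x : Ck k U f -> U x -> {for x, continuous f}.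
Proof. by case: k => [|k] [cf _] /cf. Qed.

Lemma CkB m k (U : set 'rV[R]_m) f g : open U -> Ck k U f -> Ck k U g -> Ck k U (f - g).
Proof.
move=> oU Cf Cg; have := CkD oU Cf (CkM oU (Ck_cst oU k (-1)) Cg).
by apply: eq_Ck => // x _; rewrite !fctE /= mulN1r.
Qed.

Lemma Ck_sum m k (U : set 'rV[R]_m) p (f : 'I_p -> 'rV[R]_m -> R) : open U ->
  (forall j, Ck k U (f j)) -> Ck k U (fun x => \sum_j f j x).
Proof.
move=> oU; elim: p f => [|p IH] f Cf.
  by apply: eq_Ck (Ck_cst oU k 0) => // x _; rewrite big_ord0.
apply: eq_Ck (CkD oU (IH _ (fun j => Cf (widen_ord (leqnSn p) j))) (Cf ord_max)) => //.
by move=> x _; rewrite big_ord_recr.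
Qed.

Lemma is_derive_coord m (j : 'I_m) (x v : 'rV[R]_m) :
  is_derive x v (fun y : 'rV[R]_m => y 0 j) (v 0 j).
Proof.
have H : h^-1 *: ((h *: v + x) 0 j - x 0 j) @[h --> (0:R)^'] --> v 0 j.
  apply: (@cvg_trans _ (cst (v 0 j) @ (0:R)^')); last exact: cvg_cst.
  apply: near_eq_cvg; near=> h.
  rewrite !mxE addrK /GRing.scale /= mulKf//.
  by near: h; exact: nbhs_dnbhs_neq.
split; first by apply/cvg_ex; eexists; exact: H.
by apply/cvg_lim => //; exact: H.
Unshelve. all: by end_near. Qed.

Lemma Ck_coord m k (U : set 'rV[R]_m) j : open U -> Ck k U (fun x => x 0 j).
Proof.
move=> oU; case: k => [|k]; split=> //; try by move=> x _; exact: coord_continuous.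
move=> i; split=> [x _|]; first by case: (is_derive_coord j x (delta_mx 0 i)).
apply: eq_Ck (Ck_cst oU k (delta_mx 0 i 0 j)) => // x _.
by have [_ ->] := is_derive_coord j x (delta_mx 0 i).
Qed.

Lemma CkV m k (U : set 'rV[R]_m) f : open U -> (forall x, U x -> f x != 0) ->
  Ck k U f -> Ck k U (fun x => (f x)^-1).
Proof.
move=> oU f0; elim: k f f0 => [|k IH] f f0 Cf.
  by split=> // x Ux; apply: continuousV; [exact: f0|exact: Ck_cont Cf Ux].
have Cf' := CkW Cf; split=> [x Ux|i].
  by apply: continuousV; [exact: f0|exact: Ck_cont Cf Ux].
case: Cf => _ /(_ i)[d1 d2]; split=> [x Ux|].
  by apply: derivableV; [exact: f0|exact: d1].
apply: eq_Ck (CkM oU (Ck_cst oU k (-1)) (CkM oU d2 (CkM oU (IH _ f0 Cf') (IH _ f0 Cf')))) => //.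
move=> x Ux; rewrite deriveV; [|exact: f0|exact: d1].
by rewrite !fctE /= expr2 invfM scaleNr mulN1r [_ * _ *: _]mulrC.
Qed.

Lemma Ck_comp m p k (U : set 'rV[R]_m) (W : set 'rV[R]_p) f (phi : 'rV[R]_m -> 'rV[R]_p) :
  open U -> open W -> Ck k W f -> (forall j, Ck k U (fun x => phi x 0 j)) ->
  (forall x, U x -> W (phi x)) -> Ck k U (f \o phi).
Proof.
move=> oU oW; elim: k f => [|k IH] f Cf Cphi UW.
  split=> // x Ux; apply: continuous_comp; last exact: Ck_cont Cf (UW _ Ux).
  by apply: rV_continuous => j; exact: Ck_cont (Cphi j) Ux.
split=> [x Ux|i].
  apply: continuous_comp; last exact: Ck_cont Cf (UW _ Ux).
  by apply: rV_continuous => j; exact: Ck_cont (Cphi j) Ux.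
have C1 : Ck 1 W f.
  by case: Cf => cf df; split=> // j; have [d1 d2] := df j; split=> //; split=> //;
    move=> x Wx; exact: Ck_cont d2 Wx.
have D x : U x -> is_derive x (delta_mx 0 i) (f \o phi)
    (\sum_j 'D_(delta_mx 0 j) f (phi x) * 'D_(delta_mx 0 i) (fun y => phi y 0 j) x).
  move=> Ux; apply: is_derive_comp_rV C1 _ _ => //; first exact: UW.
  by move=> j; have [_ /(_ i)[dj _]] := Cphi j; exact: dj.
split=> [x /D[]//|].
suff : Ck k U (fun x => \sum_j ('D_(delta_mx 0 j) f \o phi) x *
    'D_(delta_mx 0 i) (fun y => phi y 0 j) x).
  by apply: eq_Ck => // x /D[_ ->].
apply: Ck_sum => // j; apply: CkM => //.
  apply: IH => //; last by move=> l; exact: CkW.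
  by case: Cf => _ /(_ j)[].
by have [_ /(_ i)[]] := Cphi j.
Qed.

(** The chain rule for an outer function of one real variable: restrict to the
    line through x of direction v. *)
Lemma is_derive_comp1 (V : normedModType R) (g : R -> R) (u : V -> R) x v dg :
  derivable u x v -> is_derive (u x) (1 : R) g dg ->
  is_derive x v (g \o u) (dg * 'D_v u x).
Proof.
move=> du [dg1 dg2].
have E (w : V -> R) : (fun h : R => h^-1 *: ((w \o shift x) (h *: v) - w x)) =
    (fun h : R => h^-1 *: (((fun k : R => w (k *: v + x)) \o shift 0) (h *: 1)
       - w (0 *: v + x))).
  by apply/funext => h /=; rewrite addr0 scale0r add0r [_%:A]mulr1.
have dE (w : V -> R) : 'D_v w x = 'D_1 (fun h : R => w (h *: v + x)) 0.
  by rewrite /derive E.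
have lE (w : V -> R) : derivable w x v = derivable (fun h : R => w (h *: v + x)) 0 1.
  by rewrite /derivable E.
have du1 : derivable (fun h : R => u (h *: v + x)) 0 1 by rewrite -lE.
have dg1' : derivable g (u (0 *: v + x)) 1 by rewrite scale0r add0r.
split.
  rewrite lE; apply/derivable1_diffP.
  apply: (@differentiable_comp _ _ _ _ (fun h : R => u (h *: v + x)) g).
    exact/derivable1_diffP.
  exact/derivable1_diffP.
rewrite !dE -!derive1E (derive1_comp (g := g) du1 dg1').
by rewrite scale0r add0r -dg2 derive1E.
Qed.

(** The functions P(1/t) exp(-1/t), extended by 0 to t <= 0: with all the
    polynomials P at once, the family is stable under derivation, so that all
    its members are smooth by a single induction. *)
Definition flat (p : {poly R}) (t : R) : R :=
  if 0 < t then p.[t^-1] * expR (- t^-1) else 0.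

(** From exp(s) >= (s / (n + 1)) ^ (n + 1) at s = 1/t. *)
Lemma flatXn_le n t : 0 < t -> flat 'X^n t <= n.+1%:R ^+ n.+1 * t.
Proof.
move=> t0; rewrite /flat t0 hornerXn expRN ler_pdivrMr ?expR_gt0//.
have s0 : 0 < t^-1 by rewrite invr_gt0.
have n0 : 0 < n.+1%:R :> R by rewrite ltr0n.
rewrite -[X in expR X](divfK (lt0r_neq0 n0)) expRM_natr.
have H : t^-1 / n.+1%:R <= expR (t^-1 / n.+1%:R).
  by apply: le_trans (expR_ge1Dx _); rewrite lerDr.
have H2 : (t^-1 / n.+1%:R) ^+ n.+1 <= expR (t^-1 / n.+1%:R) ^+ n.+1.
  by apply: lerXn2r H; rewrite nnegrE ?expR_ge0// divr_ge0 ?ltW.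
have c0 : 0 <= n.+1%:R ^+ n.+1 * t by rewrite mulr_ge0 ?exprn_ge0 ?ltW.
apply: le_trans (ler_wpM2l c0 H2).
have -> : (t^-1 / n.+1%:R) ^+ n.+1 = t^-1 * t^-1 ^+ n * (n.+1%:R ^+ n.+1)^-1.
  by rewrite exprMn exprS -exprVn.
rewrite [leRHS](_ : _ = (t * t^-1) * (n.+1%:R ^+ n.+1 / n.+1%:R ^+ n.+1) * t^-1 ^+ n).
  by rewrite !mulfV ?mul1r ?expf_neq0 ?gt_eqF.
ring.
Qed.

Lemma flat_pos (p : {poly R}) t : 0 < t -> flat p t = p.[t^-1] * expR (- t^-1).
Proof. by rewrite /flat => ->. Qed.

Lemma flat_neg (p : {poly R}) t : t <= 0 -> flat p t = 0.
Proof. by rewrite /flat ltNge => ->. Qed.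

Lemma flat_cvg0 (p : {poly R}) : flat p h @[h --> (0:R)^'] --> (0:R).
Proof.
have E h : flat p h = \sum_(i < size p) p`_i * flat 'X^i h.
  rewrite /flat; case: ifP => _; last by rewrite big1 // => i _; rewrite mulr0.
  rewrite horner_coef mulr_suml; apply: eq_bigr => i _.
  by rewrite hornerXn mulrA.
have Xn i : flat 'X^i h @[h --> (0:R)^'] --> (0:R).
  apply: (@squeeze_cvgr _ _ _ _ (cst 0) (fun h => i.+1%:R ^+ i.+1 * `|h|)).
  - near=> h; have [h0|h0] := leP h 0.
      by rewrite flat_neg// lexx /= mulr_ge0 ?exprn_ge0.
    rewrite gtr0_norm// flatXn_le// andbT flat_pos// hornerXn.
    by rewrite mulr_ge0 ?expR_ge0 ?exprn_ge0 ?invr_ge0 ?ltW.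
  - exact: cvg_cst.
  have H : i.+1%:R ^+ i.+1 * `|h| @[h --> (0:R)^'] --> i.+1%:R ^+ i.+1 * `|0 : R|.
    apply: cvgM; first exact: cvg_cst.
    by apply: cvg_norm; exact: nbhs_dnbhs.
  by rewrite normr0 mulr0 in H.
have H : (\sum_(i < size p) p`_i * flat 'X^i h) @[h --> (0:R)^'] -->
    \sum_(i < size p) p`_i * 0.
  by apply: cvg_sumr => i; apply: cvgM; [exact: cvg_cst|exact: Xn].
rewrite big1 in H => [|i _]; last by rewrite mulr0.
by under eq_fun do rewrite E.
Unshelve. all: by end_near. Qed.

(** At t > 0 this is the product rule; at 0 the difference quotient is again a
    flat function, with polynomial X P, hence tends to 0. *)
Lemma flat_derive (p : {poly R}) t :
  is_derive t (1 : R) (flat p) (flat ('X^2 * (p - p^`())) t).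
Proof.
case: (ltgtP t 0) => t0.
- set q := _ * _; have -> : flat q t = 0 by rewrite flat_neg ?ltW.
  have n0 : \forall s \near t, cst 0 s = flat p s.
    by near=> s; rewrite flat_neg// ltW//; near: s; exact: lt_nbhsl.
  by apply: near_eq_is_derive n0 _; exact: is_derive_cst.
- have n1 : \forall s \near t, (fun s => p.[s^-1] * expR (- s^-1)) s = flat p s.
    by near=> s; rewrite flat_pos//; near: s; exact: lt_nbhsr.
  apply: (near_eq_is_derive n1).
  have tn0 : t != 0 by rewrite gt_eqF.
  have [di1 di2] : is_derive t (1:R) (fun s : R => s^-1) (- t ^- 2).
    split; first by apply: derivableV => //; exact: derivable_id.
    by rewrite deriveV// derive_id [_ *: _]mulr1.
  have de := is_derive_comp1 (u := fun s : R => - s^-1) (derivableN di1)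
    (is_derive_expR (- t^-1)).
  have dp := is_derive_comp1 (u := fun s : R => s^-1) di1 (is_derive_poly p t^-1).
  have [dM1 dM2] := is_deriveM dp de.
  split; first exact: dM1.
  rewrite [LHS]dM2 deriveN// di2 flat_pos// !hornerE.
  by rewrite /GRing.scale /= -exprVn; ring.
rewrite t0 flat_neg//.
have H : h^-1 *: ((flat p \o shift 0) (h *: 1) - flat p 0) @[h --> (0:R)^'] --> (0:R).
  apply: cvg_trans (flat_cvg0 ('X * p)); apply: near_eq_cvg; near=> h.
  rewrite /= [h *: 1]mulr1 addr0 (flat_neg p (lexx 0)) subr0.
  have [h0|h0] := leP h 0; first by rewrite !flat_neg// scaler0.
  by rewrite !flat_pos// hornerM hornerX -mulrA.
split; first by apply/cvg_ex; eexists; exact: H.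
by apply/cvg_lim => //; exact: H.
Unshelve. all: by end_near. Qed.

Lemma Ck_flat m k (U : set 'rV[R]_m) p u : open U -> Ck k U u -> Ck k U (flat p \o u).
Proof.
move=> oU; have cflat q t : {for t, continuous (flat q : R -> R)}.
  by have [d _] := flat_derive q t; apply/differentiable_continuous/derivable1_diffP.
elim: k p u => [|k IH] p u Cu.
  by split=> // x Ux; apply: continuous_comp; [exact: Ck_cont Cu Ux|exact: cflat].
split=> [x Ux|i].
  by apply: continuous_comp; [exact: Ck_cont Cu Ux|exact: cflat].
have Cu' := CkW Cu; case: Cu => _ /(_ i)[d1 d2].
have D x (Ux : U x) := is_derive_comp1 (d1 x Ux) (flat_derive p (u x)).
split=> [x /D[]//|].
by apply: eq_Ck (CkM oU (IH ('X^2 * (p - p^`())) _ Cu') d2) => // x /D[_ ->].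
Qed.

(** A plateau function: the quotient A / (A + B), where A is supported in the
    Euclidean ball of radius r and B vanishes exactly on the ball of radius
    r / 2. The Euclidean ball, whose equation is smooth, lies inside the ball of
    the maximum norm. *)
Lemma rV_bump m (a : 'rV[R]_m) (r : R) : 0 < r ->
  exists rho : 'rV[R]_m -> R, [/\ smooth_on setT rho,
    \forall x \near a, rho x = 1 & forall x, rho x != 0 -> `|x - a| < r].
Proof.
move=> r0; pose S (x : 'rV[R]_m) := \sum_j (x 0 j - a 0 j) ^+ 2.
have CS k : Ck k setT S.
  apply: Ck_sum => [|j]; first exact: openT.
  have C1 : Ck k setT (fun x : 'rV[R]_m => x 0 j - a 0 j).
    exact: (CkB openT (Ck_coord _ j openT) (Ck_cst openT k (a 0 j))).
  by apply: eq_Ck (CkM openT C1 C1) => [|x _]; [exact: openT|rewrite expr2].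
pose A x := flat 1 (r ^+ 2 - S x); pose B x := flat 1 (S x - (r / 2) ^+ 2).
have CA k : Ck k setT A.
  apply: (@Ck_flat _ _ _ 1 (fun x => r ^+ 2 - S x)); first exact: openT.
  exact: (CkB openT (Ck_cst openT k (r ^+ 2)) (CS k)).
have CB k : Ck k setT B.
  apply: (@Ck_flat _ _ _ 1 (fun x => S x - (r / 2) ^+ 2)); first exact: openT.
  exact: (CkB openT (CS k) (Ck_cst openT k ((r / 2) ^+ 2))).
have flat1_ge0 t : 0 <= flat 1 t.
  by rewrite /flat; case: ifP => // _; rewrite hornerC mul1r expR_ge0.
have flat1_gt0 t : 0 < t -> 0 < flat 1 t.
  by rewrite /flat => ->; rewrite hornerC mul1r expR_gt0.
have r2 : (r / 2) ^+ 2 < r ^+ 2.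
  by rewrite ltr_pXn2r ?nnegrE ?divr_ge0 ?ltW// gtr_pMr// invf_lt1// ltr1n.
have AB0 x : A x + B x != 0.
  rewrite gt_eqF//; have [S1|S1] := ltP (S x) (r ^+ 2).
    by apply: ltr_wpDr; [exact: flat1_ge0|apply: flat1_gt0; rewrite subr_gt0].
  apply: ltr_wpDl; [exact: flat1_ge0|apply: flat1_gt0; rewrite subr_gt0].
  exact: lt_le_trans S1.
exists (fun x => A x / (A x + B x)); split=> [k||x].
- have CAB := CkD openT (CA k) (CB k).
  exact: (CkM openT (CA k) (CkV openT (fun x _ => AB0 x) CAB)).
- have : \forall x \near a, S x < (r / 2) ^+ 2.
    have cS : S x @[x --> a] --> S a by exact: (Ck_cont (CS 0%N) (I : setT a)).
    apply: (cvgr_lt _ cS).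
    by rewrite /S big1 ?exprn_gt0 ?divr_gt0// => j _; rewrite subrr expr0n.
  apply: filterS => x Sx; have -> : B x = 0 by rewrite /B flat_neg// subr_le0 ltW.
  rewrite addr0 divff// gt_eqF// flat1_gt0// subr_gt0.
  exact: lt_trans r2.
rewrite mulf_eq0 negb_or => /andP[A0 _].
have SA : S x < r ^+ 2.
  by rewrite -subr_gt0 ltNge; apply: contra A0 => ?; rewrite /A flat_neg.
have rj (j : 'I_m) : `|x 0 j - a 0 j| < r.
  rewrite -(ltr_pXn2r (n := 2)) ?nnegrE// ?ltW// real_normK ?num_real//.
  apply: le_lt_trans SA; rewrite /S (bigD1 j)//= lerDl.
  by apply: sumr_ge0 => i _; exact: sqr_ge0.
rewrite /Num.Def.normr/= mx_normrE; apply: bigmax_lt => // -[i j] _.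
by rewrite (ord1 i) !mxE; exact: rj.
Qed.

End smooth_calculus.

(** * The lemma of Hadamard *)

Lemma open_dist (R : realType) m (a : 'rV[R]_m) (r : R) : open [set y | `|y - a| < r].
Proof.
have -> : [set y : 'rV[R]_m | `|y - a| < r] = ball a r.
  by apply/seteqP; split=> y /=; rewrite -ball_normE /= distrC.
exact: ball_open.
Qed.

Lemma closed_dist (R : realType) m (a : 'rV[R]_m) (r : R) :
  closed [set y | `|y - a| <= r].
Proof.
apply: (closed_comp (f := fun y : 'rV[R]_m => `|y - a|) (D := [set x | x <= r])).
  move=> y _; apply: (@continuous_comp _ _ _ (fun y : 'rV[R]_m => y - a)).
    by apply: (@continuousB _ _ _ id (cst a)); [exact: id|exact: cst_continuous].
  exact: norm_continuous.
exact: closed_le.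
Qed.

Lemma compact_dist (R : realType) m (a : 'rV[R]_m) (r : R) :
  compact [set y | `|y - a| <= r].
Proof.
apply: bounded_closed_compact; last exact: closed_dist.
exists (`|a| + r); split; first exact: num_real.
move=> M aM y /= ya; rewrite -(subrK a y).
apply: le_trans (ler_normD _ _) _; apply: le_trans (ltW aM).
by rewrite addrC lerD2l.
Qed.

Section hadamard.
Variables (R : realType) (m : nat) (a : 'rV[R]_m) (r : R).
Local Notation U := [set y : 'rV[R]_m | `|y - a| < r].
Local Notation mu := (@lebesgue_measure R).
Implicit Types (F : 'rV[R]_m -> R) (x : 'rV[R]_m).

Let oU : open U := @open_dist R m a r.

Lemma bounded_in_ball r' F : 0 <= r' -> r' < r -> Ck 0 U F ->
  exists C, 0 <= C /\ forall y, `|y - a| <= r' -> `|F y| <= C.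
Proof.
move=> r'0 r'r CF; pose K := [set y : 'rV[R]_m | `|y - a| <= r'].
have [|||c _ Hc] := @EVT_max_rV R m (fun y => `|F y|) K.
- by exists a; rewrite /K /= subrr normr0.
- exact: compact_dist.
- apply: continuous_in_subspaceT => y; rewrite inE /K /= => yK.
  apply: continuous_comp; last exact: norm_continuous.
  by apply: (Ck_cont CF); exact: le_lt_trans r'r.
by exists `|F c|; split=> // y yK; apply: Hc; rewrite inE.
Qed.

Let gam x (t : R) := a + t *: (x - a).

Lemma gam_in x t r' : 0 <= t -> t <= 1 -> `|x - a| <= r' -> `|gam x t - a| <= r'.
Proof.
move=> t0 t1 xr; rewrite /gam addrC addKr normrZ ger0_norm//.
by apply: le_trans xr; rewrite ler_piMl.
Qed.

Lemma gam_continuous x t : {for t, continuous (gam x)}.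
Proof.
apply: cvgD; first exact: cvg_cst.
by apply: cvgZr_tmp; exact: cvg_id.
Qed.

Lemma gam_F_continuous i F x : Ck 0 U F -> U x ->
  {within `[0, 1], continuous (fun t : R => t ^+ i * F (gam x t))}.
Proof.
move=> CF Ux; apply: continuous_in_subspaceT => t.
rewrite inE /= in_itv /= => /andP[t0 t1].
apply: cvgM; first exact: exprn_continuous.
apply: continuous_comp; first exact: gam_continuous.
by apply: (Ck_cont CF); apply: le_lt_trans Ux; apply: gam_in.
Qed.

Lemma gam_F_integrable i F x : Ck 0 U F -> U x ->
  mu.-integrable `[0, 1] (EFin \o (fun t : R => t ^+ i * F (gam x t))).
Proof.
move=> CF Ux; apply: continuous_compact_integrable; first exact: segment_compact.
exact: gam_F_continuous.
Qed.

Definition radial i F x : R := \int[mu]_(t in `[0, 1]) (t ^+ i * F (gam x t)).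

Lemma integrable_cst01 (C : R) : mu.-integrable `[0, 1] (EFin \o cst C).
Proof.
apply: continuous_compact_integrable; first exact: segment_compact.
by move=> x; exact: cst_continuous.
Qed.

Lemma Rintegral_cst01 (C : R) : \int[mu]_(t in `[0, 1]) C = C.
Proof. rewrite Rintegral_cst//= lebesgue_measure_itv /= lte_fin ltr01 /=.
by rewrite subr0 mulr1. Qed.

(** Derivation under the integral sign: each derivative of F (a + t (x - a)) with
    respect to x brings out one factor t, which is why the weights t ^ i are
    carried along. *)
Lemma radial_is_derive i F x j : Ck 1 U F -> U x ->
  is_derive x (delta_mx 0 j) (radial i F) (radial i.+1 ('D_(delta_mx 0 j) F) x).
Proof.
move=> CF Ux; set v := delta_mx 0 j.
have CF0 := CkW CF; have [_ /(_ j)[dF CdF]] := CF.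
pose d := (r - `|x - a|) / 2.
have d0 : 0 < d by rewrite divr_gt0// subr_gt0.
pose r' := `|x - a| + d.
have r'r : r' < r by rewrite /r' /d; move: Ux => /=; lra.
have r'0 : 0 <= r' by rewrite addr_ge0// ltW.
have vle : `|v| <= 1.
  apply: row_mx_norm_le => // k; rewrite mxE eqxx /=.
  by case: eqP; rewrite ?normr1 ?normr0.
have xs s : `|s| <= d -> `|x + s *: v - a| <= r'.
  move=> sd; rewrite addrAC; apply: le_trans (ler_normD _ _) _.
  rewrite lerD2l normrZ; apply: le_trans sd.
  by rewrite ler_piMr.
have [C [C0 HC]] := bounded_in_ball r'0 r'r CdF.
pose f s t := t ^+ i * F (gam (x + s *: v) t).
have gamE s t : gam (x + s *: v) t = gam x t + (s * t) *: v.
  by rewrite /gam addrAC scalerDr addrA scalerA mulrC.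
have df s t : `|s| <= d -> 0 <= t -> t <= 1 ->
    is_derive s (1:R) (f ^~ t) (t ^+ i.+1 * 'D_v F (gam (x + s *: v) t)).
  move=> sd t0 t1.
  have dFs : derivable F (gam x t + (s * t) *: v) v.
    by apply: dF; rewrite -gamE /=; apply: le_lt_trans r'r; apply: gam_in => //; exact: xs.
  have dmul : is_derive s (1:R) (fun s : R => s * t) t.
    apply: is_derive_eq; rewrite /GRing.scale /=; ring.
  have [dm1 dm2] := dmul.
  have H := is_derive_comp1 (u := fun s : R => s * t) dm1 (is_derive_line dFs).
  have -> : f ^~ t = (t ^+ i) \*o ((fun u => F (gam x t + u *: v)) \o (fun s => s * t)).
    by apply/funext => u; rewrite /f gamE.
  have H2 := is_deriveZ (t ^+ i) H.
  apply: is_derive_eq; rewrite gamE dm2 exprS /GRing.scale /=; ring.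
have I0 : `]-d, d[%classic 0 by rewrite /= in_itv /= oppr_lt0 d0.
have Is s : `]-d, d[%classic s -> `|s| <= d.
  by rewrite /= in_itv /= ler_norml => /andP[/ltW -> /ltW ->].
have mB : measurable (`[0, 1]%classic : set (measurableTypeR R)) by [].
have A1 s : `]-d, d[%classic s -> mu.-integrable `[0, 1] (EFin \o f s).
  by move=> /Is sd; apply: gam_F_integrable => //=; apply: le_lt_trans r'r; exact: xs.
have A2 s t : `]-d, d[%classic s -> `[0, 1]%classic t -> derivable (f ^~ t) s 1.
  by move=> /Is sd; rewrite /= in_itv /= => /andP[t0 t1]; case: (df s t sd t0 t1).
have A3 s t : `]-d, d[%classic s -> `[0, 1]%classic t ->
    `|partial1of2 f s t| <= cst C t.
  move=> /Is sd; rewrite /= in_itv /= => /andP[t0 t1].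
  rewrite partial1of2E; have [_ ->] := df s t sd t0 t1.
  rewrite normrM -[leRHS]mul1r ler_pM//.
    by rewrite ger0_norm ?exprn_ge0// exprn_ile1.
  by apply: HC; apply: gam_in => //; exact: xs.
have D1 := derivable_under_integral mB I0 A1 A2 (fun=> C0) (integrable_cst01 C) A3.
have D2 := differentiation_under_integral mB I0 A1 A2 (fun=> C0) (integrable_cst01 C) A3.
have E1 : (fun s => \int[mu]_(t in `[0, 1]) f s t) = (fun s => radial i F (s *: v + x)).
  by apply/funext => s; rewrite /radial /f addrC.
have E2 : \int[mu]_(t in `[0, 1]) partial1of2 f 0 t = radial i.+1 ('D_v F) x.
  apply: eq_Rintegral => t; rewrite inE /= in_itv /= => /andP[t0 t1].
  have z0 : `|0 : R| <= d by rewrite normr0 ltW.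
  rewrite partial1of2E; have [_ ->] := df 0 t z0 t0 t1.
  by rewrite scale0r addr0.
rewrite E2 E1 derive1E in D2; rewrite E1 in D1.
have E (w : 'rV[R]_m -> R) : (fun h : R => h^-1 *: ((w \o shift x) (h *: v) - w x)) =
    (fun h : R => h^-1 *: (((fun k : R => w (k *: v + x)) \o shift 0) (h *: 1)
       - w (0 *: v + x))).
  by apply/funext => h /=; rewrite addr0 scale0r add0r [_%:A]mulr1.
by split; [rewrite /derivable E|rewrite /derive E].
Qed.

Lemma lipschitz_in_ball r' d F : 0 <= r' -> 0 < d -> r' + d < r -> Ck 1 U F ->
  exists L, 0 <= L /\ forall x y, `|x - a| <= r' -> `|y - x| < d ->
    `|F y - F x| <= L * `|y - x|.
Proof.
move=> r'0 d0 r'r [_ dF].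
have rd0 : 0 <= r' + d by rewrite addr_ge0// ltW.
have [C HC] := choice (fun j => bounded_in_ball rd0 r'r (dF j).2).
exists (\sum_j C j); split; first by apply: sumr_ge0 => j _; case: (HC j).
move=> x y xr yd.
have -> : F y - F x = \sum_(j < m) (F (mix x y j.+1) - F (mix x y j)).
  have -> : F y = F (mix x y m).
    by congr F; apply/rowP => k; rewrite mxE ltn_ord.
  have -> : F x = F (mix x y 0) by congr F; apply/rowP => k; rewrite mxE.
  by rewrite -(big_mkord xpredT (fun j => F (mix x y j.+1) - F (mix x y j)))
    telescope_sumr.
rewrite mulr_suml; apply: le_trans (ler_norm_sum _ _ _) _; apply: ler_sum => j _.
have zd z : `|z - x| < d -> `|z - a| <= r' + d.
  move=> zd; rewrite -(subrKA x); apply: le_trans (ler_normD _ _) _.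
  by rewrite addrC lerD// ltW.
have [z|z zy ->] := @slope_partial _ _ F x y j d _ yd.
  by move=> zxd; apply: (dF j).1; apply: le_lt_trans (zd _ zxd) r'r.
rewrite normrM; apply: ler_pM => //.
  by apply: (HC j).2; apply: zd; exact: le_lt_trans yd.
by have := coord_norm_le (y - x) j; rewrite !mxE.
Qed.

Lemma radial_continuous i F x : Ck 1 U F -> U x -> {for x, continuous (radial i F)}.
Proof.
move=> CF Ux; pose d := (r - `|x - a|) / 3.
have d0 : 0 < d by rewrite divr_gt0// subr_gt0.
have r'r : `|x - a| + d < r by rewrite /d; move: Ux => /=; lra.
have [L [L0 HL]] := lipschitz_in_ball (normr_ge0 _) d0 r'r CF.
have Hy y : `|y - x| < d -> `|radial i F y - radial i F x| <= L * `|y - x|.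
  move=> yd.
  have Uy : U y.
    rewrite /= -(subrKA x); apply: le_lt_trans (ler_normD _ _) _.
    by rewrite addrC; apply: lt_trans r'r; rewrite ltrD2l.
  have CF0 := CkW CF.
  have [Iy Ix] := (gam_F_integrable i CF0 Uy, gam_F_integrable i CF0 Ux).
  rewrite /radial -RintegralB//.
  have IB : mu.-integrable `[0, 1]
      (EFin \o (fun t => t ^+ i * F (gam y t) - t ^+ i * F (gam x t))).
    by have := integrableB _ Iy Ix; exact.
  apply: le_trans (le_normr_Rintegral _ IB) _ => //.
  rewrite -[leRHS]Rintegral_cst01; apply: le_Rintegral => //.
  - by have := integrable_norm IB; exact.
  - exact: integrable_cst01.
  move=> t; rewrite /= in_itv /= => /andP[t0 t1].
  have gxy : gam y t - gam x t = t *: (y - x).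
    by rewrite /gam opprD addrACA subrr add0r -scalerBr opprB addrA subrK.
  have gle : `|gam y t - gam x t| <= `|y - x|.
    by rewrite gxy normrZ ger0_norm// ler_piMl.
  rewrite -mulrBr normrM -[leRHS]mul1r ler_pM//.
    by rewrite ger0_norm ?exprn_ge0// exprn_ile1.
  apply: le_trans (HL _ _ (gam_in t0 t1 (lexx _)) _) _; first exact: le_lt_trans yd.
  exact: ler_wpM2l.
apply/(cvgrPdist_le (FF := nbhs_filter x)) => e e0.
pose dd := Num.min d (e / (L + 1)).
have dd0 : 0 < dd by rewrite lt_min d0 divr_gt0// ltr_wpDl.
have Hn : nbhs x [set y | `|y - x| < dd].
  by apply/nbhs_ballP; exists dd => //= y; rewrite -ball_normE /= distrC.
apply: (@filterS _ (nbhs x) _ _ _ _ Hn) => y /=.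
rewrite lt_min => /andP[yd ye]; rewrite distrC.
apply: le_trans (Hy _ yd) _; move: ye; rewrite ltr_pdivlMr ?ltr_wpDl// => ye.
apply: le_trans (ltW ye); rewrite mulrC ler_wpM2l//.
by rewrite lerDl.
Qed.

Lemma Ck_radial k i F : Ck k.+1 U F -> Ck k U (radial i F).
Proof.
elim: k i F => [|k IH] i F CF.
  by split=> // x Ux; exact: radial_continuous.
have C1 : Ck 1 U F.
  by clear IH; elim: k CF => [|k IH] CF; [exact: CkW|exact/IH/CkW].
split=> [x Ux|j]; first exact: radial_continuous.
split=> [x Ux|]; first by case: (radial_is_derive i j C1 Ux).
have := IH i.+1 _ (CF.2 j).2; apply: eq_Ck => // x Ux.
by case: (radial_is_derive i j C1 Ux).
Qed.

Lemma Rintegral_lin p (c : 'I_p -> R) (G : 'I_p -> R -> R) :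
  (forall j, mu.-integrable `[0, 1] (EFin \o G j)) ->
  mu.-integrable `[0, 1] (EFin \o (fun t => \sum_j c j * G j t)) /\
  \int[mu]_(t in `[0, 1]) (\sum_j c j * G j t) =
  \sum_j c j * \int[mu]_(t in `[0, 1]) (G j t).
Proof.
elim: p c G => [|p IH] c G iG.
  have -> : (fun t : R => \sum_(j < 0) c j * G j t) = cst 0.
    by apply/funext => t; rewrite big_ord0.
  by rewrite big_ord0; split; [exact: integrable_cst01|exact: Rintegral_cst01].
have [i1 e1] := IH (fun j => c (widen_ord (leqnSn p) j))
  (fun j => G (widen_ord (leqnSn p) j)) (fun j => iG _).
have i2 : mu.-integrable `[0, 1] (EFin \o (fun t => c ord_max * G ord_max t)).
  have mI : measurable (`[0, 1]%classic : set (measurableTypeR R)) by [].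
  by have := integrableZl mI (c ord_max) (iG ord_max); exact.
have -> : (fun t => \sum_j c j * G j t) =
  (fun t => \sum_(j < p) c (widen_ord (leqnSn p) j) * G (widen_ord (leqnSn p) j) t
     + c ord_max * G ord_max t).
  by apply/funext => t; rewrite big_ord_recr.
split; first by have := integrableD _ i1 i2; exact.
by rewrite RintegralD// e1 RintegralZl// big_ord_recr.
Qed.

(** Hadamard's lemma: the cofactors are the averages of the partial derivatives
    along the segments issued from the centre. *)
Lemma hadamard f : smooth_on U f ->
  exists g : 'I_m -> 'rV[R]_m -> R, [/\ forall j, smooth_on U (g j),
    forall x, U x -> f x = f a + \sum_j (x 0 j - a 0 j) * g j x &
    forall j, g j a = 'D_(delta_mx 0 j) f a].
Proof.
move=> sf; have Df j k : Ck k U ('D_(delta_mx 0 j) f) by case: (sf k.+1) => _ /(_ j)[].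
exists (fun j => radial 0 ('D_(delta_mx 0 j) f)); split=> [j k|x Ux|j].
- by apply: Ck_radial; exact: Df.
- pose phi t := f (gam x t).
  pose dphi t := \sum_j (x 0 j - a 0 j) * (t ^+ 0 * 'D_(delta_mx 0 j) f (gam x t)).
  have Ug t : 0 <= t -> t <= 1 -> U (gam x t).
    by move=> t0 t1; apply: le_lt_trans Ux; exact: gam_in.
  have dg j (t : R) : is_derive t (1:R) (fun t => gam x t 0 j) (x 0 j - a 0 j).
    have -> : (fun t => gam x t 0 j) = (fun t => a 0 j + t * (x 0 j - a 0 j)).
      by apply/funext => s; rewrite !mxE.
    by apply: is_derive_eq; rewrite /GRing.scale /=; ring.
  have dp (t : R) : 0 <= t -> t <= 1 -> is_derive t (1:R) phi (dphi t).
    move=> t0 t1.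
    have [d1 d2] := is_derive_comp_rV (phi := gam x) (v := 1) oU (sf 1%N) (Ug t t0 t1)
      (fun j => @ex_derive _ _ _ _ _ _ _ (dg j t)).
    split=> //; rewrite [LHS]d2; apply: eq_bigr => j _.
    by rewrite mul1r mulrC (@derive_val _ _ _ _ _ _ _ (dg j t)).
  have cp (t : R) : 0 <= t -> t <= 1 -> {for t, continuous phi}.
    by move=> t0 t1; have [d _] := dp t t0 t1; apply/differentiable_continuous/derivable1_diffP.
  have [_ E] := Rintegral_lin (fun j => x 0 j - a 0 j)
    (fun j => gam_F_integrable 0 (Df j 0%N) Ux).
  have cdphi : {within `[0, 1], continuous dphi}.
    apply: continuous_in_subspaceT => t; rewrite inE /= in_itv /= => /andP[t0 t1].
    rewrite /prop_for /continuous_at /dphi; apply: cvg_sumr => j; apply: cvgM; first exact: cvg_cst.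
    apply: cvgM; first exact: exprn_continuous.
    apply: (@continuous_comp _ _ _ (gam x) ('D_(delta_mx 0 j) f)).
      exact: gam_continuous.
    exact: Ck_cont (Df j 0%N) (Ug t t0 t1).
  have dO : derivable_oo_LRcontinuous phi 0 1.
    split=> [t||].
    + rewrite in_itv /= => /andP[t0 t1].
      by case: (dp t (ltW t0) (ltW t1)).
    + by apply: cvg_at_right_filter; exact: cp.
    + by apply: cvg_at_left_filter; exact: cp.
  have dE : {in `]0, 1[, phi^`()%classic =1 dphi}.
    move=> t; rewrite in_itv /= => /andP[t0 t1].
    by rewrite derive1E; case: (dp t (ltW t0) (ltW t1)).
  have E2 := continuous_FTC2 ltr01 cdphi dO dE.
  have phi1 : phi 1 = f x by rewrite /phi /gam scale1r addrC subrK.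
  have phi0 : phi 0 = f a by rewrite /phi /gam scale0r addr0.
  rewrite -phi1 -phi0 -[LHS](subrK (phi 0)) addrC; congr (_ + _).
  by rewrite /radial -E /Rintegral E2.
rewrite /radial -[RHS]Rintegral_cst01; apply: eq_Rintegral => t _.
by rewrite /gam subrr scaler0 addr0 expr0 mul1r.
Qed.

End hadamard.

(** * Smooth functions on a manifold *)

Section chart_theory.
Variables (R : realType) (m : nat) (M : manifold R m).
Local Notation C := (Cinf M).
Implicit Types (c : chart R m M).
Local Notation img c := (chart_map c @` chart_dom c).

Lemma Cinf_smooth (f : C) c k : atlas c -> Ck k (img c) (f \o chart_inv c).
Proof. by have /asboolP sf := CinfP f; move=> ac; exact: sf. Qed.

Lemma chart_img c p : chart_dom c p -> (img c) (chart_map c p).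
Proof. by exists p. Qed.

Lemma chart_invK c x : (img c) x -> chart_map c (chart_inv c x) = x.
Proof. by case=> p pc <-; rewrite chart_mapK. Qed.

Lemma chart_inv_dom c x : (img c) x -> chart_dom c (chart_inv c x).
Proof. by case=> p pc <-; rewrite chart_mapK. Qed.

Lemma open_img_inv c (A : set M) : open A -> open (img c `&` chart_inv c @^-1` A).
Proof.
move=> oA; rewrite openE => x [xc Ax]; apply: filterI.
  exact: open_nbhs_nbhs (conj (chart_img_open c) xc).
by apply: (chart_inv_cont xc); exact: open_nbhs_nbhs.
Qed.

Lemma open_dom_map c (A : set 'rV[R]_m) : open A -> open (chart_dom c `&` chart_map c @^-1` A).
Proof.
move=> oA; rewrite openE => x [xc Ax]; apply: filterI.
  exact: open_nbhs_nbhs (conj (chart_dom_open c) xc).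
by apply: (chart_map_cont xc); exact: open_nbhs_nbhs.
Qed.

Lemma img_overlap c c' :
  chart_map c @` (chart_dom c `&` chart_dom c') =
  img c `&` chart_inv c @^-1` chart_dom c'.
Proof.
apply/seteqP; split=> [_ [p [pc pc'] <-]|_ [[p pc <-] /=]].
  by split; [exact: chart_img|rewrite /= chart_mapK].
by rewrite chart_mapK// => pc'; exists p.
Qed.

Lemma smooth_local (F : M -> R) :
  (forall p : M, exists f : C, \forall q \near p, F q = f q) -> smooth F.
Proof.
move=> H c ac k; apply: Ck_local => x xc.
have [f fF] := H (chart_inv c x).
have : nbhs (chart_inv c x) [set q | F q = f q] by [].
rewrite nbhsE => -[A [oA Ax] FA].
exists (img c `&` chart_inv c @^-1` A); first by [].
have oW := open_img_inv (c := c) oA.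
have sW : Ck k (img c `&` chart_inv c @^-1` A) (f \o chart_inv c).
  by apply: (@Ck_sub _ _ _ _ (img c)); [move=> y []|exact: Cinf_smooth].
by apply: (eq_Ck oW _ sW) => y [yc Ay] /=; rewrite FA.
Qed.

Definition mkCinf (F : M -> R) (sF : smooth F) : C :=
  @MkCinf _ _ _ F (introT (@asboolP (smooth F)) sF).

Section cut.
Variables (c : chart R m M) (ac : atlas c) (a : 'rV[R]_m) (r : R).
Variables (O1 : set 'rV[R]_m).
Hypothesis oO1 : open O1.
Hypothesis O1c : O1 `<=` img c.
Hypothesis ball_O1 : forall y, `|y - a| <= r -> O1 y.
Variable rho : 'rV[R]_m -> R.
Hypothesis srho : smooth_on setT rho.
Hypothesis rho0 : forall x, rho x != 0 -> `|x - a| < r.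

Definition cut (w : 'rV[R]_m -> R) (p : M) : R :=
  if pselect (chart_dom c p) then rho (chart_map c p) * w (chart_map c p) else 0.

Lemma cut_dom w p : chart_dom c p -> cut w p = rho (chart_map c p) * w (chart_map c p).
Proof. by rewrite /cut; case: pselect. Qed.

Lemma cut_ndom w p : ~ chart_dom c p -> cut w p = 0.
Proof. by rewrite /cut; case: pselect. Qed.

(** In another chart, a point of the domain of c is dealt with by the change of
    charts. Near any other point the function vanishes, because the inverse image
    of the closed ball is compact, hence closed in the Hausdorff space M. *)
Lemma smooth_cut w : smooth_on O1 w -> smooth (cut w).
Proof.
move=> sw c' ac' k; apply: Ck_local => x' xc'.
have su : Ck k (img c) (fun y => rho y * w y).
  apply: Ck_local => y yc; have [yr|yr] := leP `|y - a| r.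
    exists O1; first exact: ball_O1.
    by apply: CkM (sw k) => //; apply: Ck_sub (srho k).
  exists (~` [set y | `|y - a| <= r]); first by apply/negP; rewrite -ltNge.
  have oN : open (~` [set y : 'rV[R]_m | `|y - a| <= r]).
    by apply: closed_openC; exact: closed_dist.
  apply: (eq_Ck oN _ (Ck_cst oN k 0)) => z /= /negP; rewrite -ltNge => zr.
  have -> : rho z = 0 by apply/eqP; apply: contraLR zr => /rho0 zr; rewrite -leNgt ltW.
  by rewrite mul0r.
have [pc|pc] := pselect (chart_dom c (chart_inv c' x')).
  have W1 : (chart_map c' @` (chart_dom c' `&` chart_dom c)) x' by rewrite img_overlap.
  exists (chart_map c' @` (chart_dom c' `&` chart_dom c)) => //.
  have oW : open (chart_map c' @` (chart_dom c' `&` chart_dom c)).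
    by rewrite img_overlap; apply: open_img_inv; exact: chart_dom_open.
  have H : Ck k (chart_map c' @` (chart_dom c' `&` chart_dom c))
    ((fun y => rho y * w y) \o (chart_map c \o chart_inv c')).
    apply: Ck_comp su _ _ => //; first exact: chart_img_open.
      by move=> j; exact: (atlas_smooth ac' ac j k).
    by rewrite img_overlap => y [yc' yc]; exact: chart_img.
  apply: (eq_Ck oW _ H) => y; rewrite img_overlap => -[yc' yc] /=.
  by rewrite cut_dom.
pose K := chart_inv c @` [set y | `|y - a| <= r].
have cK : closed K.
  apply: compact_closed; first exact: mfd_hausdorff.
  apply: continuous_compact; last exact: compact_dist.
  apply: continuous_in_subspaceT => y; rewrite inE /= => yr.
  by apply: chart_inv_cont; exact/O1c/ball_O1.
have oK : open (~` K) by exact: closed_openC.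
exists (img c' `&` chart_inv c' @^-1` (~` K)).
  split=> //= -[y yr yx]; apply: pc; rewrite -yx; apply: chart_inv_dom.
  exact/O1c/ball_O1.
have oW := open_img_inv (c := c') oK.
apply: (eq_Ck oW _ (Ck_cst oW k 0)) => y [yc' yK] /=.
have [qc|qc] := pselect (chart_dom c (chart_inv c' y)); last by rewrite cut_ndom.
rewrite cut_dom//.
have -> : rho (chart_map c (chart_inv c' y)) = 0; last by rewrite mul0r.
apply/eqP; apply: contra_notT yK => /rho0 yr.
by exists (chart_map c (chart_inv c' y)); [exact: ltW|rewrite chart_mapK].
Qed.

End cut.

Lemma cut_data c (O1 : set 'rV[R]_m) a : open O1 -> O1 a ->
  exists r (rho : 'rV[R]_m -> R), [/\ 0 < r, forall y, `|y - a| <= r -> O1 y,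
    smooth_on setT rho, \forall y \near a, rho y = 1 &
    forall x, rho x != 0 -> `|x - a| < r].
Proof.
move=> oO1 O1a.
have /nbhs_ballP[e /= e0 eO1] := open_nbhs_nbhs (conj oO1 O1a).
have e20 : 0 < e / 2 by rewrite divr_gt0.
have [rho [s1 s2 s3]] := rV_bump a e20.
exists (e / 2), rho; split=> // y ya; apply: eO1; rewrite -ball_normE /= distrC.
by apply: le_lt_trans ya _; lra.
Qed.

Lemma smooth_extension c (p : M) (A : set M) (O1 : set 'rV[R]_m) w :
  atlas c -> chart_dom c p ->
  open A -> A p -> open O1 -> O1 (chart_map c p) -> smooth_on O1 w ->
  exists F : C, [/\ \forall q \near p, F q = w (chart_map c q) &
    forall q, F q != 0 -> A q].
Proof.
move=> ac pc oA Ap oO1 O1p sw.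
pose O2 := O1 `&` (img c `&` chart_inv c @^-1` A).
have oO2 : open O2 by apply: openI => //; exact: open_img_inv.
have O2p : O2 (chart_map c p).
  by split=> //; split; [exact: chart_img|rewrite /= chart_mapK].
have [r [rho [r0 rO srho rho1 rho0]]] := cut_data c oO2 O2p.
have O2c : O2 `<=` img c by move=> y [_ []].
have sw2 : smooth_on O2 w by move=> k; apply: Ck_sub (sw k) => y [].
exists (mkCinf (smooth_cut ac oO2 O2c rO srho rho0 sw2)); split=> [|q] /=.
  have H1 : \forall q \near p, rho (chart_map c q) = 1 := chart_map_cont pc rho1.
  have H2 : \forall q \near p, chart_dom c q.
    exact: open_nbhs_nbhs (conj (chart_dom_open c) pc).
  by near=> q; rewrite cut_dom ?(near H1 q)// ?mul1r//; exact: (near H2 q).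
have [qc|qc] := pselect (chart_dom c q); last by rewrite cut_ndom// eqxx.
rewrite cut_dom// mulf_eq0 negb_or => /andP[/rho0 qr _].
by have [_ [_]] := rO _ (ltW qr); rewrite /= chart_mapK.
Unshelve. all: by end_near. Qed.

Lemma Cinf_continuous (f : C) (p : M) : {for p, continuous f}.
Proof.
have [c ac pc] := atlas_cover p.
have H : {for p, continuous ((f \o chart_inv c) \o chart_map c)}.
  apply: continuous_comp; first exact: chart_map_cont.
  by apply: Ck_cont (Cinf_smooth f 0 ac) _; exact: chart_img.
rewrite /prop_for /continuous_at /= chart_mapK// in H.
apply: cvg_trans H; apply: near_eq_cvg.
have H2 : \forall q \near p, chart_dom c q.
  exact: open_nbhs_nbhs (conj (chart_dom_open c) pc).
by apply: filterS H2 => q qc /=; rewrite chart_mapK.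
Qed.

Lemma bump_function (p : M) (A : set M) : nbhs p A ->
  exists rho : C, (\forall q \near p, rho q = 1) /\ forall q, rho q != 0 -> A q.
Proof.
rewrite nbhsE => -[A' [oA Ap] AA]; have [c ac pc] := atlas_cover p.
have [F [F1 F2]] := smooth_extension ac pc oA Ap (@openT _) (I : setT _)
  (fun k => Ck_cst (@openT _) k 1).
by exists F; split=> // q /F2/AA.
Qed.

Lemma local_inverse (d : C) (p : M) : d p != 0 ->
  exists e : C, \forall q \near p, e q * d q = 1.
Proof.
move=> d0; have [c ac pc] := atlas_cover p.
pose O1 := img c `&` (d \o chart_inv c) @^-1` [set x | x != 0].
have oO1 : open O1.
  rewrite openE => x [xc dx]; apply: filterI.
    exact: open_nbhs_nbhs (conj (chart_img_open c) xc).
  exact: (Ck_cont (Cinf_smooth d 0 ac) xc) (open_nbhs_nbhs (conj (@open_neq R 0) dx)).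
have O1p : O1 (chart_map c p) by split; [exact: chart_img|rewrite /= chart_mapK].
have sw : smooth_on O1 (fun y => ((d \o chart_inv c) y)^-1).
  move=> k; apply: CkV => //; first by move=> x [].
  by apply: Ck_sub (Cinf_smooth d k ac) => x [].
have [F [F1 _]] := smooth_extension ac pc (@openT _) (I : setT p) oO1 O1p sw.
have H2 : \forall q \near p, chart_dom c q.
  exact: open_nbhs_nbhs (conj (chart_dom_open c) pc).
have H3 : \forall q \near p, d q != 0.
  exact: (@Cinf_continuous d p) (open_nbhs_nbhs (conj (@open_neq R 0) d0)).
exists F; near=> q; rewrite (near F1 q)//= chart_mapK; last exact: (near H2 q).
by rewrite mulVf//; exact: (near H3 q).
Unshelve. all: by end_near. Qed.

End chart_theory.

(** * Local frames of vector fields *)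

Section derivations.
Variables (R : realType) (m : nat) (M : manifold R m).
Local Notation C := (Cinf M).
Local Notation X := (vfield M).
Implicit Types (V W : X) (f h : C) (p q : M).
Local Notation img c := (chart_map c @` chart_dom c).

Lemma CinfE f h : (forall q, f q = h q) -> f = h.
Proof. by move=> fh; apply: val_inj; apply/funext. Qed.

Lemma CinfD f h q : (f + h) q = f q + h q. Proof. by []. Qed.
Lemma CinfB f h q : (f - h) q = f q - h q. Proof. by []. Qed.
Lemma CinfN f q : (- f) q = - f q. Proof. by []. Qed.
Lemma CinfM f h q : (f * h) q = f q * h q. Proof. by []. Qed.
Lemma CinfZ (a : R) f q : (a *: f) q = a * f q. Proof. by []. Qed.
Lemma Cinf0 q : (0 : C) q = 0. Proof. by []. Qed.
Lemma Cinf1 q : (1 : C) q = 1. Proof. by []. Qed.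
Lemma Cinf_sum I (r : seq I) (F : I -> C) q : (\sum_(i <- r) F i) q = \sum_(i <- r) F i q.
Proof.
by elim: r => [|i r IH]; rewrite ?big_nil// !big_cons CinfD IH.
Qed.

Lemma vfield0 V : V 0 = 0.
Proof. by apply: (addrI (V 0)); rewrite -vfieldD !addr0. Qed.

Lemma vfieldB V : {morph V : f h / f - h}.
Proof. by move=> f h; rewrite vfieldD vfieldN. Qed.

Lemma vfieldZ V a f : V (a *: f) = a *: V f.
Proof. by rewrite -[a *: f]addr0 vfield_lin vfield0 addr0. Qed.

Lemma vfield1 V : V 1 = 0.
Proof.
have := vfield_leibniz V 1 1; rewrite !mul1r => E.
by apply: (addrI (V 1)); rewrite -E addr0.
Qed.

Lemma vfield_cst V (a : R) : V (a *: (1 : C)) = 0.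
Proof. by rewrite vfieldZ vfield1 scaler0. Qed.

Lemma vfield_sum V I (r : seq I) (F : I -> C) :
  V (\sum_(i <- r) F i) = \sum_(i <- r) V (F i).
Proof.
by elim: r => [|i r IH]; rewrite ?big_nil ?vfield0// !big_cons vfieldD IH.
Qed.

Lemma vfD V W f : (V + W) f = V f + W f. Proof. by []. Qed.
Lemma vfB V W f : (V - W) f = V f - W f. Proof. by []. Qed.
Lemma vfN V f : (- V) f = - V f. Proof. by []. Qed.
Lemma vfZ h V f : (h *: V) f = h * V f. Proof. by []. Qed.
Lemma vf0 f : (0 : X) f = 0. Proof. by []. Qed.
Lemma vf_sum I (r : seq I) (F : I -> X) f : (\sum_(i <- r) F i) f = \sum_(i <- r) F i f.
Proof.
by elim: r => [|i r IH]; rewrite ?big_nil// !big_cons vfD IH.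
Qed.

(** Multiply the difference of f and h by a bump function: the product vanishes,
    and its image by V at p is the difference of V f and V h. *)
Lemma vfield_local V f h p : (\forall q \near p, f q = h q) -> V f p = V h p.
Proof.
move=> fh; have [rho [rho1 rhoA]] := bump_function fh.
have E : rho * (f - h) = 0.
  apply: CinfE => q; rewrite CinfM CinfB Cinf0.
  have [->|/rhoA -> ] := eqVneq (rho q) 0; first by rewrite mul0r.
  by rewrite subrr mulr0.
have : V (rho * (f - h)) p = (0 : C) p by rewrite E vfield0.
rewrite vfield_leibniz vfieldB CinfD !CinfM !CinfB Cinf0.
rewrite (nbhs_singleton rho1) (nbhs_singleton fh) subrr mul0r addr0 mul1r.
by move/eqP; rewrite subr_eq0 => /eqP.
Qed.

(** The fields and functions below are those of a chart, multiplied by a plateau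
    function to be defined on all of M; they have their usual meaning near p. *)
Section coordinate_fields.
Variables (c : chart R m M) (ac : atlas c) (p : M) (pc : chart_dom c p).
Local Notation a := (chart_map c p).
Variables (r : R) (rho : 'rV[R]_m -> R).
Hypothesis ball_img : forall y, `|y - a| <= r -> img c y.
Hypothesis srho : smooth_on setT rho.
Hypothesis rho1 : \forall y \near a, rho y = 1.
Hypothesis rho0 : forall x, rho x != 0 -> `|x - a| < r.

Definition cutC w (sw : smooth_on (img c) w) : C :=
  mkCinf (smooth_cut ac (chart_img_open c) (fun y => id) ball_img srho rho0 sw).

Lemma smooth_partial f j : smooth_on (img c) ('D_(delta_mx 0 j) (f \o chart_inv c)).
Proof. by move=> k; case: (Cinf_smooth f k.+1 ac) => _ /(_ j)[]. Qed.

Lemma smooth_coord j : smooth_on (img c) (fun y : 'rV[R]_m => y 0 j).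
Proof. by move=> k; apply: Ck_coord; exact: chart_img_open. Qed.

Definition partial_fun j f : C := cutC (smooth_partial f j).

Lemma derivable_chart f j q : chart_dom c q ->
  derivable (f \o chart_inv c) (chart_map c q) (delta_mx 0 j).
Proof.
by move=> qc; case: (Cinf_smooth f 1 ac) => _ /(_ j)[d _]; apply/d/chart_img.
Qed.

Lemma partial_fun_dom j f q : chart_dom c q -> partial_fun j f q =
  rho (chart_map c q) * 'D_(delta_mx 0 j) (f \o chart_inv c) (chart_map c q).
Proof. exact: cut_dom. Qed.

Lemma partial_fun_ndom j f q : ~ chart_dom c q -> partial_fun j f q = 0.
Proof. exact: cut_ndom. Qed.

Fact partial_lin j (b : R) (f h : C) :
  partial_fun j (b *: f + h) = b *: partial_fun j f + partial_fun j h.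
Proof.
apply: CinfE => q; rewrite CinfD CinfZ.
have [qc|qc] := pselect (chart_dom c q); last by rewrite !partial_fun_ndom// mulr0 addr0.
rewrite !partial_fun_dom//.
have df := @derivable_chart f j q qc; have dh := @derivable_chart h j q qc.
have -> : (b *: f + h : C) \o chart_inv c = b *: (f \o chart_inv c) + (h \o chart_inv c).
  by [].
rewrite deriveD//; last exact: derivableZ.
by rewrite deriveZ// mulrDr /GRing.scale /= mulrCA.
Qed.

Fact partial_leibniz j (f h : C) :
  partial_fun j (f * h) = f * partial_fun j h + h * partial_fun j f.
Proof.
apply: CinfE => q; rewrite CinfD !CinfM.
have [qc|qc] := pselect (chart_dom c q); last by rewrite !partial_fun_ndom// !mulr0 addr0.
rewrite !partial_fun_dom//.
have df := @derivable_chart f j q qc; have dh := @derivable_chart h j q qc.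
have -> : (f * h : C) \o chart_inv c = (f \o chart_inv c) * (h \o chart_inv c) by [].
by rewrite deriveM//= chart_mapK// /GRing.scale /=; ring.
Qed.

Definition partial_field j : X := VField (partial_lin j) (partial_leibniz j).
Definition coord_fun j : C := cutC (smooth_coord j).

(** By Hadamard's lemma f is, near q, a constant plus a sum of products
    (x_j - x_j(q)) g_j; the derivation V kills the constant and acts on the
    products by the Leibniz rule, and g_j(q) is the j-th partial derivative. *)
Lemma coord_frame : \forall q \near p,
  (forall j k, partial_field j (coord_fun k) q = (j == k)%:R) /\
  (forall V f, V f q = \sum_j V (coord_fun j) q * partial_field j f q).
Proof.
have : nbhs a [set y | rho y = 1] by [].
rewrite nbhsE => -[N [oN Na] N1].
have H : \forall q \near p, (chart_dom c `&` chart_map c @^-1` N) q.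
  by apply: open_nbhs_nbhs; split=> //; exact: open_dom_map.
apply: filterS H => q [qc qN].
pose b := chart_map c q.
have Nb : N b by [].
have nearq : \forall q' \near q, chart_dom c q' /\ N (chart_map c q').
  by apply: open_nbhs_nbhs; split=> //; exact: open_dom_map.
have Bq j f : partial_field j f q = 'D_(delta_mx 0 j) (f \o chart_inv c) b.
  by rewrite [LHS](partial_fun_dom j f qc) N1// mul1r.
have xq k : \forall q' \near q, coord_fun k q' = chart_map c q' 0 k.
  by apply: filterS nearq => q' [q'c q'N] /=; rewrite cut_dom// N1// mul1r.
split=> [j k|V f].
  rewrite Bq.
  have -> : 'D_(delta_mx 0 j) (coord_fun k \o chart_inv c) b =
            'D_(delta_mx 0 j) (fun y : 'rV[R]_m => y 0 k) b.
    apply: near_eq_derive.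
    have H : \forall y \near b, (img c `&` N) y.
      apply: open_nbhs_nbhs; split; first exact: openI (chart_img_open c) oN.
      by split=> //; exact: chart_img.
    apply: filterS H => y [yc yN] /=.
    by rewrite cut_dom ?chart_invK ?N1 ?mul1r//; exact: chart_inv_dom.
  have [_ ->] := is_derive_coord k b (delta_mx 0 j).
  by rewrite mxE eqxx /= eq_sym.
transitivity (\sum_j V (coord_fun j) q * 'D_(delta_mx 0 j) (f \o chart_inv c) b);
  last by apply: eq_bigr => j _; rewrite Bq.
pose O1 := img c `&` N.
have oO1 : open O1 by exact: openI (chart_img_open c) oN.
have O1b : O1 b by split=> //; exact: chart_img.
have /nbhs_ballP[s /= s0 sO] := open_nbhs_nbhs (conj oO1 O1b).
have sU : [set y | `|y - b| < s] `<=` O1.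
  by move=> y /= yb; apply: sO; rewrite -ball_normE /= distrC.
have sf : smooth_on [set y | `|y - b| < s] (f \o chart_inv c).
  by move=> k; apply: Ck_sub (Cinf_smooth f k ac) => y /sU[].
have [g [sg fE gb]] := hadamard sf.
have Ub : [set y | `|y - b| < s] b by rewrite /= subrr normr0.
have [G GP] := choice (fun j => smooth_extension ac qc (@openT _) (I : setT q)
  (@open_dist R m b s) Ub (sg j)).
have nearU : \forall q' \near q, `|chart_map c q' - b| < s.
  exact: chart_map_cont qc _ (open_nbhs_nbhs (conj (@open_dist R m b s) Ub)).
have near_f : \forall q' \near q, f q' =
   (f q *: (1 : C) + \sum_j (coord_fun j - b 0 j *: (1 : C)) * G j : C) q'.
  have nG : \forall q' \near q, forall j, G j q' = g j (chart_map c q').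
    by apply: filter_forall => j; have [] := GP j.
  have nx : \forall q' \near q, forall j, coord_fun j q' = chart_map c q' 0 j.
    by apply: filter_forall => j; exact: xq.
  near=> q'; have q'c : chart_dom c q' by case: (near nearq q').
  have E := fE _ (near nearU q' _); rewrite /= chart_mapK// in E; rewrite E//.
  rewrite CinfD CinfZ Cinf1 mulr1 {1}/b chart_mapK//; congr (_ + _).
  rewrite Cinf_sum; apply: eq_bigr => j _.
  by rewrite CinfM CinfB CinfZ Cinf1 mulr1 (near nG q')// (near nx q').
rewrite (vfield_local V near_f) vfieldD vfield_cst add0r vfield_sum Cinf_sum.
apply: eq_bigr => j _; rewrite vfield_leibniz vfieldB vfield_cst subr0.
rewrite CinfD !CinfM CinfB CinfZ Cinf1 mulr1 (nbhs_singleton (xq j)) subrr mul0r add0r.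
by rewrite -gb (nbhs_singleton (proj1 (GP j))) mulrC.
Unshelve. all: by end_near. Qed.

(** Join p to q in the chart by a path parallel to the axes; the mean value theorem
    expresses each increment by a value of a coordinate field on f. *)
Lemma locally_constant f : (forall V, V f = 0) -> \forall q \near p, f q = f p.
Proof.
move=> Vf; have : nbhs a [set y | rho y = 1] by [].
rewrite nbhsE => -[N [oN Na] N1].
have oO1 : open (img c `&` N) by exact: openI (chart_img_open c) oN.
have O1a : (img c `&` N) a by split=> //; exact: chart_img.
have /nbhs_ballP[s /= s0 sO] := open_nbhs_nbhs (conj oO1 O1a).
have nearU : \forall q \near p, chart_dom c q /\ `|chart_map c q - a| < s.
  have oB := @open_dom_map R m M c _ (@open_dist R m a s).
  by apply: (open_nbhs_nbhs (conj oB _)); split=> //=; rewrite subrr normr0.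
apply: filterS nearU => q [qc qs].
pose F := f \o chart_inv c; set b := chart_map c q in qs *.
suff : F b - F a = 0 by rewrite /F /= !chart_mapK// => /eqP; rewrite subr_eq0 => /eqP.
have -> : F b - F a = \sum_(j < m) (F (mix a b j.+1) - F (mix a b j)).
  have -> : F b = F (mix a b m).
    by congr F; apply/rowP => k; rewrite mxE ltn_ord.
  have -> : F a = F (mix a b 0) by congr F; apply/rowP => k; rewrite mxE.
  by rewrite -(big_mkord xpredT (fun j => F (mix a b j.+1) - F (mix a b j)))
    telescope_sumr.
apply: big1 => j _.
have inO z : `|z - a| < s -> (img c `&` N) z.
  by move=> za; apply: sO; rewrite -ball_normE /= distrC.
have [z|z zb ->] := @slope_partial _ _ F a b j s _ qs.
  move=> /inO[zc _]; rewrite -(chart_invK zc); apply: derivable_chart.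
  exact: chart_inv_dom.
have [zc zN] := inO z (le_lt_trans zb qs).
have E := partial_fun_dom j f (chart_inv_dom zc).
rewrite chart_invK// N1// mul1r in E; rewrite -E.
by rewrite [partial_fun j f](Vf (partial_field j)) Cinf0 mul0r.
Qed.

End coordinate_fields.

Lemma local_frame p : exists (x : 'I_m -> C) (B : 'I_m -> X), \forall q \near p,
  (forall j k, B j (x k) q = (j == k)%:R) /\
  (forall V f, V f q = \sum_j V (x j) q * B j f q).
Proof.
have [c ac pc] := atlas_cover p.
have [r [rho [r0 rO srho rho1 rho0]]] := cut_data c (chart_img_open c) (chart_img pc).
exists (coord_fun ac rO srho rho0), (partial_field ac rO srho rho0).
exact: coord_frame.
Qed.

Lemma constant_of_vfield f : connected [set: M] -> (forall V, V f = 0) ->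
  forall p q, f p = f q.
Proof.
move=> cM Vf p q.
have loc p' : \forall q' \near p', f q' = f p'.
  have [c ac pc] := atlas_cover p'.
  have [r [rho [r0 rO srho rho1 rho0]]] := cut_data c (chart_img_open c) (chart_img pc).
  exact: (locally_constant ac pc rO srho rho1 rho0).
have oA (P : pred R) : open [set q' | P (f q')].
  rewrite openE => q' Pq; apply: filterS (loc q') => q'' /= ->.
  exact: Pq.
have E : [set q' | f q' == f p] = [set: M].
  apply: cM; first by exists p => /=.
    by exists [set q' | f q' == f p]; [exact: (oA (pred1 (f p)))|rewrite setTI].
  exists [set q' | f q' == f p]; last by rewrite setTI.
  rewrite -[X in closed X]setCK; apply: open_closedC.
  rewrite (_ : ~` _ = [set q' | f q' != f p]); first exact: (oA (predC1 (f p))).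
  by apply/seteqP; split=> y /= /negP.
have : [set q' | f q' == f p] q by rewrite E.
by move=> /eqP.
Qed.

End derivations.

(** * Tensors, metrics and subbundles *)

Section tensors.
Variables (R : realType) (m : nat) (M : manifold R m).
Local Notation C := (Cinf M).
Local Notation X := (vfield M).
Implicit Types (V W : X) (f h : C) (p q : M).

Lemma tangentE V W p f : tangent V p = tangent W p -> V f p = W f p.
Proof. by move=> VW; rewrite -[LHS]/(tangent V p f) VW. Qed.

Lemma vfield_ext V W : (forall p, tangent V p = tangent W p) -> V = W.
Proof.
move=> VW; apply: vfieldP => f; apply: CinfE => p.
exact: tangentE.
Qed.

(** After multiplication by a bump function, V is a combination of a local frame
    whose coefficients at p depend only on the tangent vector of V at p. *)
Lemma tensorial (A : X -> C) p V W :
  (forall f V W, A (f *: V + W) = f * A V + A W) ->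
  tangent V p = tangent W p -> A V p = A W p.
Proof.
move=> Alin VW.
have A0 : A 0 = 0.
  by have := Alin (-1) 0 0; rewrite scaler0 addr0 mulN1r addNr.
have AD U U' : A (U + U') = A U + A U' by rewrite -[U]scale1r Alin mul1r scale1r.
have AZ f U : A (f *: U) = f * A U by rewrite -[f *: U]addr0 Alin A0 addr0.
have AS r (F : 'I_r -> X) : A (\sum_i F i) = \sum_i A (F i).
  elim: r F => [|r IH] F; first by rewrite !big_ord0.
  by rewrite !big_ord_recr /= AD IH.
have AE U : A U p = \sum_j U ((sval (cid (local_frame p))) j) p *
    A ((sval (cid (svalP (cid (local_frame p))))) j) p.
  case: cid => x /= [B0 HB0]; case: cid => B /= HB.
  have [rho [rho1 rhoA]] := bump_function HB.
  have E : rho *: U = \sum_j (rho * U (x j)) *: B j.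
    apply: vfieldP => f; apply: CinfE => q.
    rewrite vfZ vf_sum Cinf_sum CinfM.
    under eq_bigr do rewrite vfZ !CinfM -mulrA.
    rewrite -mulr_sumr.
    have [->|/rhoA [_ HUf]] := eqVneq (rho q) 0; first by rewrite !mul0r.
    by rewrite HUf.
  have E2 : (rho * A U) p = (\sum_j (rho * U (x j)) * A (B j)) p.
    by rewrite -AZ E AS; congr (Cinf_fun _ p); apply: eq_bigr => j _; rewrite AZ.
  rewrite CinfM Cinf_sum (nbhs_singleton rho1) mul1r in E2; rewrite E2.
  by apply: eq_bigr => j _; rewrite !CinfM (nbhs_singleton rho1) mul1r.
rewrite !AE; apply: eq_bigr => j _; congr (_ * _).
exact: tangentE.
Qed.

Lemma tensorial_endo (A : X -> X) p V W :
  (forall f V W, A (f *: V + W) = f *: A V + A W) ->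
  tangent V p = tangent W p -> tangent (A V) p = tangent (A W) p.
Proof.
move=> Alin VW; apply/funext => f.
apply: (@tensorial (fun V => A V f)) => // h U U'.
by rewrite Alin vfD vfZ.
Qed.

(** The image of f is smooth because it agrees near each point p with the image
    of f by the field U p. *)
Lemma glue_vfield (U : M -> X) :
  (forall p, \forall q \near p, tangent (U q) q = tangent (U p) q) ->
  exists W, forall p, tangent W p = tangent (U p) p.
Proof.
move=> HU.
have sm f : smooth (fun p => U p f p).
  apply: smooth_local => p; exists (U p f).
  by apply: filterS (HU p) => q E; exact: tangentE.
have lin (a : R) f h : mkCinf (sm (a *: f + h)) = a *: mkCinf (sm f) + mkCinf (sm h).
  by apply: CinfE => p; rewrite CinfD CinfZ /= vfield_lin.
have lei f h : mkCinf (sm (f * h)) = f * mkCinf (sm h) + h * mkCinf (sm f).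
  by apply: CinfE => p; rewrite CinfD !CinfM /= vfield_leibniz.
by exists (@VField _ _ _ (fun f => mkCinf (sm f)) lin lei).
Qed.

Lemma glue_Cinf (F : M -> R) (f : M -> C) :
  (forall p, \forall q \near p, F q = f p q) -> exists h : C, forall q, h q = F q.
Proof.
move=> Ff; have sF : smooth F by apply: smooth_local => p; exists (f p).
by exists (mkCinf sF).
Qed.

Section metric.
Variable g : metric M.

Lemma metricDl U V W : g (U + V) W = g U W + g V W.
Proof. by rewrite -[U]scale1r metric_lin mul1r scale1r. Qed.
Lemma metric0l W : g 0 W = 0.
Proof. by apply: (addrI (g 0 W)); rewrite -metricDl !addr0. Qed.
Lemma metricZl f U W : g (f *: U) W = f * g U W.
Proof. by rewrite -[f *: U]addr0 metric_lin metric0l addr0. Qed.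
Lemma metricNl U W : g (- U) W = - g U W.
Proof. by rewrite -scaleN1r metricZl mulN1r. Qed.
Lemma metricBl U V W : g (U - V) W = g U W - g V W.
Proof. by rewrite metricDl metricNl. Qed.
Lemma metricDr U V W : g W (U + V) = g W U + g W V.
Proof. by rewrite !(Defs.metric_sym g W) metricDl. Qed.
Lemma metric0r W : g W 0 = 0.
Proof. by rewrite Defs.metric_sym metric0l. Qed.
Lemma metricZr f U W : g W (f *: U) = f * g W U.
Proof. by rewrite !(Defs.metric_sym g W) metricZl. Qed.
Lemma metricNr U W : g W (- U) = - g W U.
Proof. by rewrite !(Defs.metric_sym g W) metricNl. Qed.
Lemma metricBr U V W : g W (U - V) = g W U - g W V.
Proof. by rewrite !(Defs.metric_sym g W) metricBl. Qed.
Lemma metric_suml I (r : seq I) (F : I -> X) W :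
  g (\sum_(i <- r) F i) W = \sum_(i <- r) g (F i) W.
Proof.
by elim: r => [|i r IH]; rewrite ?big_nil ?metric0l// !big_cons metricDl IH.
Qed.

Lemma metric_def p V : g V V p = 0 -> tangent V p = fun=> 0.
Proof.
move=> gV; have [//|/metric_pos-/(_ g)] := pselect (tangent V p = fun=> 0).
by rewrite gV ltxx.
Qed.

Lemma metric_ge0 p V : 0 <= g V V p.
Proof.
have [V0|/metric_pos-/(_ g)/ltW//] := pselect (tangent V p = fun=> 0).
have tE : tangent V p = tangent 0 p by rewrite V0.
have -> : g V V p = g 0 V p.
  by apply: (@tensorial (fun U => g U V)) tE => f U U'; exact: metric_lin.
by rewrite metric0l.
Qed.

Lemma metric_eq0 V : g V V = 0 -> V = 0.
Proof.
move=> gV; apply: vfield_ext => p.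
by rewrite (@metric_def p V) ?gV.
Qed.

Lemma metric_nondeg V W : (forall Z, g V Z = g W Z) -> V = W.
Proof.
move=> VW; apply/eqP; rewrite -subr_eq0; apply/eqP; apply: metric_eq0.
by rewrite metricBl VW subrr.
Qed.

Lemma metric_tangentl p V V' W : tangent V p = tangent V' p -> g V W p = g V' W p.
Proof. by apply: (@tensorial (fun U => g U W)) => f U U'; exact: metric_lin. Qed.

End metric.

Section subbundle.
Variables (r : nat) (L : tangent_distribution M).
Hypothesis LP : is_subbundle r L.

Lemma subbundle_lin p (v w : C -> R) (a : R) :
  L p v -> L p w -> L p (fun f => a * v f + w f).
Proof.
have [E /nbhs_singleton [_ ->]] := LP p.
move=> [b ->] [b' ->]; exists (fun i => a * b i + b' i).
apply/funext => f; rewrite mulr_sumr -big_split /=; apply: eq_bigr => i _.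
by rewrite mulrDl mulrA.
Qed.

Lemma subbundle0 p : L p (fun=> 0).
Proof.
have [E /nbhs_singleton [_ ->]] := LP p; exists (fun=> 0).
by apply/funext => f; rewrite big1// => i _; rewrite mul0r.
Qed.

Lemma sectionsDZ f V W : sections L V -> sections L W -> sections L (f *: V + W).
Proof. by move=> LV LW p; apply: subbundle_lin (LV p) (LW p). Qed.
Lemma sections0 : sections L 0.
Proof. by move=> p; exact: subbundle0. Qed.
Lemma sectionsZ f V : sections L V -> sections L (f *: V).
Proof. by move=> LV; rewrite -[_ *: _]addr0; apply: sectionsDZ => //; exact: sections0. Qed.
Lemma sectionsD V W : sections L V -> sections L W -> sections L (V + W).
Proof. by move=> LV LW; rewrite -[V]scale1r; exact: sectionsDZ. Qed.
Lemma sectionsN V : sections L V -> sections L (- V).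
Proof. by move=> LV; rewrite -scaleN1r; exact: sectionsZ. Qed.
Lemma sectionsB V W : sections L V -> sections L W -> sections L (V - W).
Proof. by move=> LV LW; apply: sectionsD => //; exact: sectionsN. Qed.
Lemma sections_sum k (F : 'I_k -> X) :
  (forall i, sections L (F i)) -> sections L (\sum_i F i).
Proof.
elim: k F => [|k IH] F HF; first by rewrite big_ord0; exact: sections0.
by rewrite big_ord_recr; apply: sectionsD => //; exact: IH.
Qed.

(** The members of a frame need not be sections away from p; multiplied by a bump
    function they are. *)
Lemma subbundle_frame p : exists E : 'I_r -> X, (forall i, sections L (E i)) /\
  \forall q \near p,
    (forall a : 'I_r -> R,
       (forall f, \sum_(i < r) a i * tangent (E i) q f = 0) -> forall i, a i = 0) /\
    L q = [set v | exists a : 'I_r -> R,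
                   v = fun f => \sum_(i < r) a i * tangent (E i) q f].
Proof.
have [E HE] := LP p; have [rho [rho1 rhoA]] := bump_function HE.
exists (fun i => rho *: E i); split=> [i q|].
  have [r0|/rhoA[_ ->]] := eqVneq (rho q) 0.
    have -> : tangent (rho *: E i) q = fun=> 0; last exact: subbundle0.
    by apply/funext => f; rewrite /tangent vfZ CinfM r0 mul0r.
  exists (fun j => if j == i then rho q else 0); apply/funext => f.
  rewrite (bigD1 i)//= eqxx big1 ?addr0 => [|j /negPf ->]; last by rewrite mul0r.
  by rewrite /tangent vfZ CinfM.
near=> q; have rq : rho q = 1 by apply: (near rho1 q).
have tE i : tangent (rho *: E i) q = tangent (E i) q.
  by apply/funext => f; rewrite /tangent vfZ CinfM rq mul1r.
have nHE := near HE q; case: nHE => // H1 H2.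
split=> [a Ha|]; first by apply: H1 => f; rewrite -[RHS](Ha f); apply: eq_bigr => i _; rewrite tE.
rewrite H2.
apply/seteqP; split=> v [a ->]; exists a; apply/funext => f;
  by apply: eq_bigr => i _; rewrite tE.
Unshelve. all: by end_near. Qed.

Lemma subbundle_extend p v : L p v -> exists V, sections L V /\ tangent V p = v.
Proof.
have [E [LE HE]] := subbundle_frame p.
have [_ ->] := nbhs_singleton HE; move=> [a ->].
exists (\sum_i (a i *: (1 : C)) *: E i); split.
  by apply: sections_sum => i; exact: sectionsZ.
apply/funext => f; rewrite /tangent vf_sum Cinf_sum; apply: eq_bigr => i _.
by rewrite vfZ CinfM CinfZ Cinf1 mulr1.
Qed.

End subbundle.

End tensors.

(** * Almost contact metric structures and orthogonal decompositions *)

Section almost_contact.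
Variables (R : realType) (m : nat) (M : manifold R m) (S : almost_contact_metric M).
Local Notation C := (Cinf M).
Local Notation X := (vfield M).
Local Notation phi := (acm_phi S).
Local Notation xi := (acm_xi S).
Local Notation eta := (acm_eta S).
Local Notation g := (acm_g S).
Implicit Types (V W : X) (f h : C) (p q : M).

Lemma etaZ f V : eta (f *: V) = f * eta V. Proof. exact: linearZ. Qed.
Lemma eta_xi : eta xi = 1. Proof. exact: acm_eta_xi. Qed.

Lemma Cinf_sqr_eq0 f : f * f = 0 -> f = 0.
Proof.
move=> ff; apply: CinfE => q; apply/eqP; rewrite -[_ == _]orbb -mulf_eq0.
by rewrite -CinfM ff.
Qed.

(** As phi ^ 2 kills xi it kills phi xi, so phi xi = a xi; applying phi once more
    gives a ^ 2 = 0. *)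
Lemma phi_xi : phi xi = 0.
Proof.
have p2 : phi (phi xi) = 0 by rewrite acm_phi2 acm_eta_xi scale1r addNr.
have p3 : phi xi = eta (phi xi) *: xi.
  have := acm_phi2 S (phi xi); rewrite p2 linear0 => /esym/eqP.
  by rewrite addrC subr_eq0 => /eqP ->.
move: (eta (phi xi)) p3 => a p3.
have : phi (a *: xi) = 0 by rewrite -p3.
rewrite linearZ /= p3 scalerA => /(congr1 eta).
by rewrite etaZ acm_eta_xi mulr1 linear0 => /Cinf_sqr_eq0 ->; rewrite scale0r.
Qed.

Lemma eta_phi V : eta (phi V) = 0.
Proof.
have E : phi (phi (phi V)) = - phi V.
  by rewrite (acm_phi2 S V) linearD linearN linearZ /= phi_xi scaler0 addr0.
move: E; rewrite (acm_phi2 S (phi V)) => /eqP.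
rewrite -subr_eq0 addrAC subrr add0r => /eqP.
by move/(congr1 eta); rewrite etaZ acm_eta_xi mulr1 linear0.
Qed.

Lemma g_xi V : g V xi = eta V.
Proof.
have := acm_compat S V xi; rewrite phi_xi metric0r acm_eta_xi mulr1 => /esym/eqP.
by rewrite subr_eq0 => /eqP.
Qed.

Lemma g_xil V : g xi V = eta V. Proof. by rewrite Defs.metric_sym g_xi. Qed.

Lemma phi_skew V W : g (phi V) W = - g V (phi W).
Proof.
have := acm_compat S V (phi W); rewrite eta_phi mulr0 subr0 acm_phi2.
rewrite metricDr metricZr g_xi eta_phi mulr0 addr0 metricNr => <-.
by rewrite opprK.
Qed.

Lemma phi2_D V : eta V = 0 -> phi (phi V) = - V.
Proof. by move=> V0; rewrite acm_phi2 V0 scale0r addr0. Qed.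

Lemma g_phi V W : g (phi V) (phi W) = g V W - eta V * eta W.
Proof. exact: acm_compat. Qed.

Lemma eta_tensor p V W : tangent V p = tangent W p -> eta V p = eta W p.
Proof.
apply: (@tensorial _ _ _ (fun U => eta U)) => f U U'.
by rewrite linearP.
Qed.

Lemma phi_tensor p V W : tangent V p = tangent W p -> tangent (phi V) p = tangent (phi W) p.
Proof. by apply: tensorial_endo => f U U'; rewrite linearP. Qed.

End almost_contact.

Section evaluation.
Variables (R : realType) (m : nat) (M : manifold R m) (q : M).

(** Evaluation at a point as a ring morphism, to evaluate determinants entrywise. *)
Definition ev (f : Cinf M) : R := f q.

Fact ev_zmod : zmod_morphism ev. Proof. by []. Qed.
Fact ev_monoid : monoid_morphism ev. Proof. by []. Qed.
HB.instance Definition _ := GRing.isZmodMorphism.Build (Cinf M) R ev ev_zmod.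
HB.instance Definition _ := GRing.isMonoidMorphism.Build (Cinf M) R ev ev_monoid.

End evaluation.

Section decomposition.
Variables (R : realType) (n : nat) (M : manifold R (2 * n).+1).
Variable S : almost_contact_metric M.
Local Notation C := (Cinf M).
Local Notation X := (vfield M).
Local Notation phi := (acm_phi S).
Local Notation xi := (acm_xi S).
Local Notation eta := (acm_eta S).
Local Notation g := (acm_g S).
Implicit Types (V W : X) (f h : C) (p q : M).
Variables L Q : tangent_distribution M.
Hypotheses (sL : is_subbundle n L) (sQ : is_subbundle n Q).
Hypotheses (eL : forall V, sections L V -> eta V = 0).
Hypotheses (eQ : forall V, sections Q V -> eta V = 0).
Hypothesis (oLQ : orthogonal_dist g L Q).

Definition lincomb (E : 'I_n -> X) (a : 'I_n -> R) : X :=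
  \sum_i (a i *: (1 : C)) *: E i.

Lemma lincombE E a f q : lincomb E a f q = \sum_i a i * tangent (E i) q f.
Proof.
rewrite vf_sum Cinf_sum; apply: eq_bigr => i _.
by rewrite vfZ CinfM CinfZ Cinf1 mulr1.
Qed.

(** The n given vectors of L, the n of Q and xi are independent, since L, Q and xi
    are mutually orthogonal; being 2n+1 in number they span the tangent space. *)
Lemma pointwise_span (E F : 'I_n -> X) (q : M) (x : 'I_(2 * n).+1 -> C)
    (B : 'I_(2 * n).+1 -> X) V :
  (forall i, sections L (E i)) -> (forall i, sections Q (F i)) ->
  (forall a : 'I_n -> R, (forall f, \sum_(i < n) a i * tangent (E i) q f = 0) ->
     forall i, a i = 0) ->
  (forall a : 'I_n -> R, (forall f, \sum_(i < n) a i * tangent (F i) q f = 0) ->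
     forall i, a i = 0) ->
  (forall W f, W f q = \sum_j W (x j) q * B j f q) ->
  exists a b : 'I_n -> R, exists c : R,
    tangent V q = tangent (lincomb E a + lincomb F b + (c *: (1 : C)) *: xi) q.
Proof.
move=> LE QF iE iF xB.
pose T (W : X) : 'rV[R]_(2 * n).+1 := \row_j W (x j) q.
have T0 W : T W = 0 -> tangent W q = fun=> 0.
  move=> W0; apply/funext => f; rewrite /tangent xB big1// => j _.
  by have /rowP/(_ j) := W0; rewrite !mxE => ->; rewrite mul0r.
pose NE := \matrix_i T (E i); pose NF := \matrix_i T (F i).
pose N := col_mx (col_mx NE NF) (T xi).
have TN (u : 'rV_(n + n + 1)) : u *m N =
   T (lincomb E (fun i => lsubmx (lsubmx u) 0 i) + lincomb F (fun i => rsubmx (lsubmx u) 0 i)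
      + (rsubmx u 0 0 *: (1 : C)) *: xi).
  rewrite -[u in LHS]hsubmxK -[lsubmx u in LHS]hsubmxK !mul_row_col.
  apply/rowP => j; rewrite !mxE vfD vfD !CinfD !lincombE vfZ CinfM CinfZ Cinf1 mulr1.
  by rewrite big_ord1 !mxE; congr (_ + _ + _); apply: eq_bigr => i _; rewrite !mxE.
have gEF a b : g (lincomb E a) (lincomb F b) = 0.
  apply: oLQ; first by apply: sections_sum => // i; exact: sectionsZ.
  by apply: sections_sum => // i; exact: sectionsZ.
have eE a : eta (lincomb E a) = 0.
  by apply: eL; apply: sections_sum => // i; exact: sectionsZ.
have eF a : eta (lincomb F a) = 0.
  by apply: eQ; apply: sections_sum => // i; exact: sectionsZ.
have rN : row_free N.
  rewrite -kermx_eq0; apply/eqP/row_matrixP => i; rewrite row0.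
  set u := row i _; have : u *m N = 0 by rewrite -row_mul mulmx_ker row0.
  rewrite TN => /T0; set a := fun i => _; set b := fun i => _; set c := rsubmx u 0 0.
  set Z := (X in tangent X q) => Z0.
  have Z00 W : g Z W q = 0.
    rewrite (@metric_tangentl _ _ _ g q Z 0) ?metric0l//.
  have a0 : forall i, a i = 0.
    apply: iE => f; rewrite -lincombE.
    rewrite -[LHS]/(tangent (lincomb E a) q f) (@metric_def _ _ _ g)//.
    have := Z00 (lincomb E a); rewrite !metricDl metricZl g_xil eE mulr0 addr0.
    by rewrite [g (lincomb F b) _]Defs.metric_sym gEF addr0.
  have b0 : forall i, b i = 0.
    apply: iF => f; rewrite -lincombE.
    rewrite -[LHS]/(tangent (lincomb F b) q f) (@metric_def _ _ _ g)//.
    have := Z00 (lincomb F b); rewrite !metricDl metricZl g_xil eF mulr0 addr0.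
    by rewrite gEF add0r.
  have c0 : c = 0.
    have := Z00 xi; rewrite !metricDl metricZl !g_xi eE eF !add0r eta_xi mulr1.
    by rewrite CinfZ Cinf1 mulr1.
  rewrite -[u]hsubmxK -[lsubmx u]hsubmxK.
  have -> : lsubmx (lsubmx u) = 0 by apply/rowP => k; rewrite [RHS]mxE; exact: a0.
  have -> : rsubmx (lsubmx u) = 0 by apply/rowP => k; rewrite [RHS]mxE; exact: b0.
  have -> : rsubmx u = 0 by apply/rowP => k; rewrite (ord1 k) [RHS]mxE; exact: c0.
  by rewrite !row_mx0.
have fN : row_full N.
  by move: rN; rewrite /row_free /row_full => /eqP ->; rewrite addn1 mul2n addnn.
have /submxP[u Vu] := submx_full (T V) fN.
exists (fun i => lsubmx (lsubmx u) 0 i), (fun i => rsubmx (lsubmx u) 0 i), (rsubmx u 0 0).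
rewrite TN in Vu; apply/funext => f; rewrite /tangent !xB; apply: eq_bigr => j _.
by have /rowP/(_ j) := Vu; rewrite !mxE => ->.
Qed.

(** The coefficients of the orthogonal projection on a local frame E of a subbundle
    are smooth: they solve the linear system of the Gram matrix of E, whose
    determinant does not vanish near p. *)
Lemma gram_coef (E : 'I_n -> X) p :
  (forall a : 'I_n -> R, (forall f, \sum_(i < n) a i * tangent (E i) p f = 0) ->
     forall i, a i = 0) ->
  exists al : X -> 'I_n -> C, \forall q \near p, forall V a Z,
    tangent V q = tangent (lincomb E a + Z) q -> (forall j, g Z (E j) q = 0) ->
    forall i, al V i q = a i.
Proof.
move=> iE; pose G : 'M[C]_n := \matrix_(i, j) g (E i) (E j).
have lcE a W q : g (lincomb E a) W q = \sum_i a i * g (E i) W q.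
  rewrite metric_suml Cinf_sum; apply: eq_bigr => i _.
  by rewrite metricZl CinfM CinfZ Cinf1 mulr1.
have detp : (\det G) p != 0.
  rewrite -[X in X != 0]/(ev p (\det G)) -det_map_mx -unitfE -[_ \is a _]/(_ \in unitmx).
  rewrite -row_free_unit -kermx_eq0; apply/eqP/row_matrixP => i; rewrite row0.
  set u := row i _; have uG : u *m map_mx (ev p) G = 0 by rewrite -row_mul mulmx_ker row0.
  apply/rowP => k; rewrite [RHS]mxE; move: k; apply: iE => f.
  rewrite -lincombE -[LHS]/(tangent (lincomb E (u 0)) p f) (@metric_def _ _ _ g)//.
  have ZE j : g (lincomb E (u 0)) (E j) p = 0.
    rewrite lcE; have /rowP/(_ j) := uG; rewrite !mxE => E0; rewrite -[RHS]E0.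
    by apply: eq_bigr => l _; rewrite !mxE.
  by rewrite lcE big1// => j _; rewrite (Defs.metric_sym g (E j)) ZE mulr0.
have [e He] := local_inverse detp.
exists (fun V i => e * \sum_k g V (E k) * (\adj G) k i).
apply: filterS He => q eq1 V a Z VZ Z0 i.
have gVE k : g V (E k) q = \sum_l a l * G l k q.
  rewrite (metric_tangentl _ _ VZ) metricDl CinfD Z0 addr0 lcE.
  by apply: eq_bigr => l _; rewrite mxE.
have Gadj l : \sum_k G l k q * (\adj G) k i q = (\det G *+ (l == i)) q.
  rewrite -[RHS]/((\det G *+ (l == i) : C) q).
  have /matrixP/(_ l i) := mul_mx_adj G; rewrite !mxE => <-.
  by rewrite Cinf_sum.
have Sum : \sum_k g V (E k) q * (\adj G) k i q = a i * (\det G) q.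
  under eq_bigr do rewrite gVE mulr_suml.
  rewrite exchange_big /= (bigD1 i)//= [X in _ + X]big1 ?addr0 => [|l li].
    under eq_bigr do rewrite -mulrA.
    by rewrite -mulr_sumr Gadj eqxx mulr1n.
  under eq_bigr do rewrite -mulrA.
  by rewrite -mulr_sumr Gadj (negPf li) mulr0n Cinf0 mulr0.
by rewrite CinfM Cinf_sum Sum mulrCA eq1 mulr1.
Qed.

Lemma tangentD V V' W W' p : tangent V p = tangent V' p -> tangent W p = tangent W' p ->
  tangent (V + W) p = tangent (V' + W') p.
Proof.
by move=> VV WW; apply/funext => f; rewrite /tangent !vfD !CinfD
  (tangentE f VV) (tangentE f WW).
Qed.

(** The difference of two L-components is orthogonal to Q and to xi, and it is
    also a combination of a vector of Q and xi: its norm vanishes. *)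
Lemma pointwise_uniq p V V' W W' c c' :
  L p (tangent V p) -> L p (tangent V' p) -> Q p (tangent W p) -> Q p (tangent W' p) ->
  tangent (V + W + c *: xi) p = tangent (V' + W' + c' *: xi) p ->
  tangent V p = tangent V' p.
Proof.
move=> LV LV' QW QW' E.
have LD : L p (tangent (V - V') p).
  have := subbundle_lin sL (-1) LV' LV; congr (L p _); apply/funext => f.
  by rewrite /tangent vfB CinfB mulN1r addrC.
have QD : Q p (tangent (W' - W) p).
  have := subbundle_lin sQ (-1) QW QW'; congr (Q p _); apply/funext => f.
  by rewrite /tangent vfB CinfB mulN1r addrC.
have [U [LU UE]] := subbundle_extend sL LD.
have [Y [QY YE]] := subbundle_extend sQ QD.
have E2 : tangent U p = tangent (Y + (c' - c) *: xi) p.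
  apply/funext => f; have E3 := tangentE f E.
  rewrite !vfD !vfZ !CinfD !CinfM in E3.
  have YEf : Y f p = W' f p - W f p.
    by rewrite -[LHS]/(tangent Y p f) YE /tangent vfB CinfB.
  rewrite UE /tangent vfB CinfB (vfD Y) CinfD vfZ CinfM CinfB YEf; lra.
have U0 : tangent U p = fun=> 0.
  apply: (@metric_def _ _ _ g).
  rewrite (metric_tangentl _ _ E2) metricDl metricZl g_xil eL// mulr0 addr0.
  by rewrite Defs.metric_sym oLQ.
apply/funext => f; apply/eqP; rewrite -subr_eq0; apply/eqP.
have := congr1 (fun t : C -> R => t f) U0; rewrite UE => <-.
by rewrite /tangent vfB CinfB.
Qed.

Lemma local_decomposition p V : exists VL VQ : X, \forall q \near p,
  [/\ L q (tangent VL q), Q q (tangent VQ q) &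
    tangent V q = tangent (VL + VQ + eta V *: xi) q].
Proof.
have [E [LE HE]] := subbundle_frame sL p.
have [F [QF HF]] := subbundle_frame sQ p.
have [x [B HB]] := local_frame p.
have [al Hal] := gram_coef (proj1 (nbhs_singleton HE)).
have [be Hbe] := gram_coef (proj1 (nbhs_singleton HF)).
exists (\sum_i al V i *: E i), (\sum_i be V i *: F i).
have nI := @filterI M (nbhs p) (nbhs_filter p).
have HH := nI _ _ (nI _ _ HE HF) (nI _ _ HB (nI _ _ Hal Hbe)).
apply: filterS HH => q [[[iE LqE] [iF QqF]] [[_ xB] [Haq Hbq]]].
have [a [b [c E1]]] := pointwise_span V LE QF iE iF xB.
have LE' i : eta (E i) = 0 by exact: eL.
have QF' i : eta (F i) = 0 by exact: eQ.
have eE : eta (lincomb E a) = 0.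
  by apply: eL; apply: sections_sum => // i; exact: sectionsZ.
have eF : eta (lincomb F b) = 0.
  by apply: eQ; apply: sections_sum => // i; exact: sectionsZ.
have lE : sections L (lincomb E a).
  by apply: sections_sum => // i; exact: sectionsZ.
have lF : sections Q (lincomb F b).
  by apply: sections_sum => // i; exact: sectionsZ.
have cE : c = eta V q.
  rewrite (eta_tensor S E1) !linearD /= etaZ eE eF !add0r eta_xi mulr1.
  by rewrite CinfZ Cinf1 mulr1.
have aE i : al V i q = a i.
  apply: (Haq V a (lincomb F b + (c *: (1 : C)) *: xi)).
    by rewrite addrA.
  move=> j; rewrite metricDl metricZl g_xil LE' mulr0 addr0 Defs.metric_sym.
  by rewrite oLQ.
have bE i : be V i q = b i.
  apply: (Hbq V b (lincomb E a + (c *: (1 : C)) *: xi)).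
    by rewrite addrA [lincomb F b + _]addrC.
  by move=> j; rewrite metricDl metricZl g_xil QF' mulr0 addr0 oLQ.
have VLE : tangent (\sum_i al V i *: E i) q = tangent (lincomb E a) q.
  apply/funext => f; rewrite /tangent lincombE vf_sum Cinf_sum; apply: eq_bigr => i _.
  by rewrite vfZ CinfM aE.
have VQE : tangent (\sum_i be V i *: F i) q = tangent (lincomb F b) q.
  apply/funext => f; rewrite /tangent lincombE vf_sum Cinf_sum; apply: eq_bigr => i _.
  by rewrite vfZ CinfM bE.
split; [by rewrite VLE; exact: lE|by rewrite VQE; exact: lF|].
rewrite E1; apply: tangentD; first by apply: tangentD.
by apply/funext => f; rewrite /tangent !vfZ !CinfM CinfZ Cinf1 mulr1 cE.
Qed.

Lemma decomposition V : exists VL VQ : X,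
  [/\ sections L VL, sections Q VQ & V = VL + VQ + eta V *: xi].
Proof.
have [UL HL] := choice (fun p => local_decomposition p V).
have [UQ HQ] := choice HL.
have dec p : \forall q \near (p : M), tangent (UL q) q = tangent (UL p) q /\
    tangent (UQ q) q = tangent (UQ p) q.
  apply: filterS (HQ p) => q' [A1 A2 A3].
  have [B1 B2 B3] := nbhs_singleton (HQ q').
  rewrite A3 in B3; split; first exact: pointwise_uniq B1 A1 B2 A2 (esym B3).
  have UE := pointwise_uniq B1 A1 B2 A2 (esym B3).
  apply/funext => f; have := tangentE f B3; have := tangentE f UE.
  rewrite !vfD !CinfD /tangent => ->; lra.
have [VL VLE] := glue_vfield (fun p => filterS (fun q => @proj1 _ _) (dec p)).
have [VQ VQE] := glue_vfield (fun p => filterS (fun q => @proj2 _ _) (dec p)).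
exists VL, VQ; split=> [p|p|].
- by rewrite VLE; have [] := nbhs_singleton (HQ p).
- by rewrite VQE; have [] := nbhs_singleton (HQ p).
apply: vfield_ext => p; have [_ _ ->] := nbhs_singleton (HQ p).
by apply: tangentD => //; apply: tangentD.
Qed.

End decomposition.

(** * Lie brackets and connections *)

Section calculus_of_fields.
Variables (R : realType) (m : nat) (M : manifold R m).
Local Notation C := (Cinf M).
Local Notation X := (vfield M).
Implicit Types (U V W Z : X) (f h : C) (p q : M).

Definition fun_linear (A : X -> X) := forall f V W, A (f *: V + W) = f *: A V + A W.

Lemma CinfMn f n q : (f *+ n) q = f q *+ n.
Proof. by elim: n => [|n IH]; rewrite ?mulr0n// !mulrS CinfD IH. Qed.

Definition evE := (CinfD, CinfN, CinfM, CinfZ, CinfMn, Cinf0, Cinf1).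

Lemma bracketE V W f : bracket V W f = V (W f) - W (V f). Proof. by []. Qed.

Lemma bracketC V W : bracket V W = - bracket W V.
Proof. by apply: vfieldP => f; rewrite vfN !bracketE opprB. Qed.

Lemma bracketvv V : bracket V V = 0.
Proof. by apply: vfieldP => f; rewrite bracketE subrr. Qed.

Lemma bracketDr V W Z : bracket V (W + Z) = bracket V W + bracket V Z.
Proof.
apply: vfieldP => f; rewrite vfD !bracketE !vfD vfieldD; ring.
Qed.

Lemma bracketZr V f W : bracket V (f *: W) = V f *: W + f *: bracket V W.
Proof.
apply: vfieldP => h; rewrite vfD !vfZ !bracketE !vfZ vfield_leibniz; ring.
Qed.

Lemma bracket0r V : bracket V 0 = 0.
Proof. by apply: (addrI (bracket V 0)); rewrite -bracketDr !addr0. Qed.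

Lemma bracketNr V W : bracket V (- W) = - bracket V W.
Proof. by apply: (addrI (bracket V W)); rewrite -bracketDr !subrr bracket0r. Qed.

Lemma bracketDl V W Z : bracket (V + W) Z = bracket V Z + bracket W Z.
Proof. by rewrite ![bracket _ Z]bracketC bracketDr opprD. Qed.

Lemma bracketZl V f W : bracket (f *: V) W = - (W f) *: V + f *: bracket V W.
Proof.
by rewrite [bracket _ W]bracketC bracketZr opprD scaleNr [bracket V W]bracketC scalerN.
Qed.

Lemma jacobi U V W : bracket U (bracket V W) + bracket V (bracket W U) +
  bracket W (bracket U V) = 0.
Proof.
apply: vfieldP => f; rewrite !vfD !bracketE !vfieldB vf0; ring.
Qed.

Variable D : connection M.
Lemma covDl U V W : D (U + V) W = D U W + D V W.
Proof. by rewrite -[U]scale1r cov_lin !scale1r. Qed.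
Lemma cov0l W : D 0 W = 0.
Proof. by apply: (addrI (D 0 W)); rewrite -covDl !addr0. Qed.
Lemma covZl f U W : D (f *: U) W = f *: D U W.
Proof. by rewrite -[f *: U]addr0 cov_lin cov0l addr0. Qed.
Lemma covNl U W : D (- U) W = - D U W.
Proof. by rewrite -scaleN1r covZl scaleN1r. Qed.
Lemma covDr U V W : D W (U + V) = D W U + D W V.
Proof. exact: cov_add. Qed.
Lemma cov0r W : D W 0 = 0.
Proof. by apply: (addrI (D W 0)); rewrite -covDr !addr0. Qed.
Lemma covNr U W : D W (- U) = - D W U.
Proof. by apply: (addrI (D W U)); rewrite -covDr !subrr cov0r. Qed.
Lemma covZr f U W : D W (f *: U) = W f *: U + f *: D W U.
Proof. exact: cov_leibniz. Qed.
Lemma covZcr (a : R) U W : D W ((a *: (1 : C)) *: U) = (a *: (1 : C)) *: D W U.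
Proof. by rewrite covZr vfield_cst scale0r add0r. Qed.

Lemma mul2C f : 2 * f = 0 -> f = 0.
Proof.
move=> E; apply: CinfE => q; have := congr1 (fun h : C => h q) E.
by rewrite CinfM CinfMn Cinf1 Cinf0 => /eqP; rewrite mulf_eq0 pnatr_eq0 => /eqP.
Qed.

Lemma mulcC (a : R) f : a != 0 -> (a *: (1 : C)) * f = 0 -> f = 0.
Proof.
move=> a0 E; apply: CinfE => q; have := congr1 (fun h : C => h q) E.
by rewrite CinfM CinfZ Cinf1 mulr1 Cinf0 => /eqP; rewrite mulf_eq0 (negPf a0) => /eqP.
Qed.

Lemma half2 (U : X) : (2^-1 *: (1 : C)) *: U + (2^-1 *: (1 : C)) *: U = U.
Proof.
rewrite -scalerDl -scalerDl -[RHS]scale1r; congr (_ *: U).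
by apply: CinfE => q; rewrite CinfZ Cinf1 mulr1; lra.
Qed.

Lemma mul2X (V W : X) : V + V = W + W -> V = W.
Proof. by move=> E; rewrite -[V]half2 -[W]half2 -!scalerDr E. Qed.

End calculus_of_fields.

(** * Contact metric structures *)

Lemma Cinf_at (R : realType) m (M : manifold R m) (f h : Cinf M) p : f = h -> f p = h p.
Proof. by move=> ->. Qed.

Ltac at_point E p := have := @Cinf_at _ _ _ _ _ p E; rewrite ?evE.

(** A locked copy of the operator h, so that rewriting with the linearity of the
    Lie bracket does not unfold it. *)
Definition h_op (R : realType) m (M : manifold R m) (S : almost_contact_metric M) :
  vfield M -> vfield M := locked (acm_h S).

Lemma h_opE (R : realType) m (M : manifold R m) (S : almost_contact_metric M) :
  acm_h S = h_op S.
Proof. by rewrite /h_op -lock. Qed.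

Section contact.
Variables (R : realType) (m : nat) (M : manifold R m) (S : almost_contact_metric M).
Local Notation C := (Cinf M).
Local Notation X := (vfield M).
Local Notation phi := (acm_phi S).
Local Notation xi := (acm_xi S).
Local Notation eta := (acm_eta S).
Local Notation g := (acm_g S).
Local Notation h := (h_op S).
Implicit Types (U V W Z : X) (f : C) (p q : M).

Definition gE := (metricDl g, metricDr g, metricNl g, metricNr g, metricZl g, metricZr g,
  metric0l g, metric0r g).

Lemma gC V W : g V W = g W V. Proof. exact: Defs.metric_sym. Qed.

Lemma two_h V : h V + h V = bracket xi (phi V) - phi (bracket xi V).
Proof. by rewrite -h_opE; exact: half2. Qed.

Lemma phiD V W : phi (V + W) = phi V + phi W. Proof. exact: linearD. Qed.
Lemma phiN V : phi (- V) = - phi V. Proof. exact: linearN. Qed.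
Lemma phiZ f V : phi (f *: V) = f *: phi V. Proof. exact: linearZ. Qed.
Lemma etaD V W : eta (V + W) = eta V + eta W. Proof. exact: linearD. Qed.
Lemma etaN V : eta (- V) = - eta V. Proof. exact: linearN. Qed.

Lemma h_lin f V W : h (f *: V + W) = f *: h V + h W.
Proof.
apply: mul2X; rewrite two_h addrACA two_h -scalerDr two_h.
rewrite !(phiD, phiZ, bracketDr, bracketZr).
by apply: (@metric_nondeg _ _ _ g) => Z; rewrite !gE; ring.
Qed.

Lemma hD V W : h (V + W) = h V + h W.
Proof. by rewrite -[V in LHS]scale1r h_lin scale1r. Qed.
Lemma h0 : h 0 = 0.
Proof. by apply: (addrI (h 0)); rewrite -hD !addr0. Qed.
Lemma hZ f V : h (f *: V) = f *: h V.
Proof. by rewrite -[f *: V]addr0 h_lin h0 addr0. Qed.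
Lemma hN V : h (- V) = - h V.
Proof. by rewrite -scaleN1r hZ scaleN1r. Qed.

Lemma h_xi : h xi = 0.
Proof. by apply: mul2X; rewrite two_h phi_xi bracket0r bracketvv linear0 subrr addr0. Qed.

Lemma h_tensor p V W : tangent V p = tangent W p -> tangent (h V) p = tangent (h W) p.
Proof. by apply: tensorial_endo => f U U'; exact: h_lin. Qed.

Hypothesis K : contact_metric S.

Lemma contactE V W : V (eta W) - W (eta V) - eta (bracket V W) = 2 * g V (phi W).
Proof.
have := K V W; rewrite /ext_d /fundamental_form => <-.
by apply: CinfE => q; rewrite CinfM CinfMn Cinf1 CinfZ mulrA mulfV ?mul1r ?pnatr_eq0.
Qed.

Lemma xi_eta V : xi (eta V) = eta (bracket xi V).
Proof.
have := contactE xi V; rewrite eta_xi vfield1 subr0 g_xil eta_phi mulr0 => /eqP.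
by rewrite subr_eq0 => /eqP.
Qed.

Lemma eta_h V : eta (h V) = 0.
Proof.
apply: mul2C; rewrite mulr_natl mulr2n -etaD two_h etaD etaN eta_phi -xi_eta eta_phi.
by rewrite vfield0 subr0.
Qed.

(** The derivative of the identity phi ^ 2 = - 1 + eta xi along xi. *)
Lemma h_phi V : h (phi V) = - phi (h V).
Proof.
apply: mul2X; rewrite -opprD -phiD !two_h phiD phiN !acm_phi2.
rewrite !(bracketDr, bracketNr, bracketZr, bracketvv) xi_eta scaler0 addr0.
by apply: (@metric_nondeg _ _ _ g) => Z; rewrite !gE; ring.
Qed.

(** Phi = d eta is closed; this is the Jacobi identity read through eta. *)
Lemma phi_closed V W Z : V (g W (phi Z)) + W (g Z (phi V)) + Z (g V (phi W)) -
  g (bracket V W) (phi Z) - g (bracket W Z) (phi V) - g (bracket Z V) (phi W) = 0.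
Proof.
apply: mul2C.
have D2 V' f : V' (2 * f) = 2 * V' f by rewrite mulr_natl mulr2n vfieldD; ring.
have J : eta (bracket V (bracket W Z)) + eta (bracket W (bracket Z V)) +
    eta (bracket Z (bracket V W)) = 0 by rewrite -!etaD jacobi linear0.
transitivity (V (2 * g W (phi Z)) + W (2 * g Z (phi V)) + Z (2 * g V (phi W)) -
  2 * g (bracket V W) (phi Z) - 2 * g (bracket W Z) (phi V) - 2 * g (bracket Z V) (phi W)).
  by rewrite !D2; ring.
rewrite -!contactE !vfieldB !bracketE.
rewrite ![bracket (bracket _ _) _]bracketC !etaN -[RHS]oppr0 -[in RHS]J; ring.
Qed.

Lemma lie_Phi V W : xi (g V (phi W)) = g (bracket xi V) (phi W) + g V (phi (bracket xi W)).
Proof.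
have := phi_closed xi V W; rewrite phi_xi g_xil eta_phi !metric0r !vfield0 => E.
apply: CinfE => p; at_point E p; rewrite [bracket W xi]bracketC metricNl.
rewrite [g _ (phi V)]gC phi_skew ?evE; lra.
Qed.

(** The flow of xi preserves Phi, and on the contact distribution g is, up to
    sign, Phi composed with phi: its derivative along xi comes from that of phi
    alone, which is 2 h. *)
Lemma lie_g V W : xi (g V W) - g (bracket xi V) W - g V (bracket xi W) = 2 * g V (h (phi W)).
Proof.
have E := lie_Phi V (phi W).
have E2 : phi (bracket xi (phi W)) = phi (h W) + phi (h W) + phi (phi (bracket xi W)).
  by rewrite -!phiD two_h subrK.
rewrite E2 !acm_phi2 !gE !g_xi vfieldD vfieldN vfield_leibniz !xi_eta in E.
rewrite h_phi metricNr.
apply: CinfE => p; at_point E p; rewrite ?evE; lra.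
Qed.

Lemma h_sym V W : g (h V) W = g V (h W).
Proof.
have S1 U Y : g U (phi (h Y)) = g Y (phi (h U)).
  apply/eqP; rewrite -subr_eq0; apply/eqP; apply: mul2C.
  have E1 := lie_g U Y; have E2 := lie_g Y U; rewrite h_phi gE in E1; rewrite h_phi gE in E2.
  apply: CinfE => p; at_point E1 p; at_point E2 p; rewrite ?evE.
  rewrite [g U Y]gC [g (bracket xi U) Y]gC [g U (bracket xi Y)]gC; lra.
have := S1 (phi V) W; rewrite h_phi phiN (phi2_D (eta_h V)) opprK g_phi eta_h mulr0 subr0.
by move=> ->; rewrite gC.
Qed.

Lemma killing_h0 : (forall V, h V = 0) -> killing g xi.
Proof. by move=> h00 V W; rewrite lie_g h00 metric0r mulr0. Qed.

Section levi_civita.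
Variable N : connection M.
Hypothesis LC : levi_civita g N.

Lemma lc_torsion V W : bracket V W = N V W - N W V.
Proof.
by have := LC.1 V W; rewrite /torsion => /eqP; rewrite subr_eq0 => /eqP.
Qed.

Lemma lc_metric V W Z : V (g W Z) = g (N V W) Z + g W (N V Z).
Proof.
by have /eqP := LC.2 V W Z; rewrite -addrA -opprD subr_eq0 => /eqP.
Qed.

(** Koszul's formula at xi: the skew part of the covariant derivative of xi is
    d eta = Phi, the symmetric part is half the Lie derivative of g along xi. *)
Lemma cov_xi V : N V xi = - phi V - phi (h V).
Proof.
apply: (@metric_nondeg _ _ _ g) => W.
have E1 := contactE V W; have E2 := lie_g V W.
rewrite -!g_xi !lc_metric !lc_torsion !gE in E1.
rewrite lc_metric !lc_torsion !gE in E2.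
rewrite [g W (N V xi)]gC in E1.
rewrite !gE !phi_skew h_sym.
apply: CinfE => p; at_point E1 p; at_point E2 p; lra.
Qed.

Lemma cov_xi_xi : N xi xi = 0.
Proof. by rewrite cov_xi h_xi phi_xi (linear0 phi) subr0 oppr0. Qed.

(** The covariant derivative of the fundamental form, (N_V Phi)(W, Z). *)
Definition dPhi V W Z : C := g W (N V (phi Z) - phi (N V Z)).

Lemma dPhi_skew V W Z : dPhi V W Z = - dPhi V Z W.
Proof.
rewrite /dPhi; have E : V (g W (phi Z)) = - V (g Z (phi W)).
  by rewrite gC phi_skew vfieldN.
rewrite !lc_metric in E; apply: CinfE => p; at_point E p.
rewrite ?gE ?evE [g W (phi (N V Z))]gC [g Z (phi (N V W))]gC !phi_skew ?evE; lra.
Qed.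

(** The form Phi is closed and N has no torsion. *)
Lemma dPhi_cyclic V W Z : dPhi V W Z + dPhi W Z V + dPhi Z V W = 0.
Proof.
have E := phi_closed V W Z; rewrite !lc_metric !lc_torsion in E.
rewrite /dPhi; apply: CinfE => p; at_point E p; rewrite ?gE ?evE.
rewrite [g W (phi (N V Z))]gC [g Z (phi (N W V))]gC [g V (phi (N Z W))]gC !phi_skew ?evE; lra.
Qed.

(** The cyclic identity on (xi, V, W): the two terms where xi is not the direction
    of derivation are known from the covariant derivative of xi, and cancel. *)
Lemma cov_xi_phi W : N xi (phi W) = phi (N xi W).
Proof.
apply/eqP; rewrite -subr_eq0; apply/eqP.
apply: (@metric_nondeg _ _ _ g) => V; rewrite metric0l gC -/(dPhi xi V W).
have E := dPhi_cyclic xi V W.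
have E1 : dPhi V W xi = eta W * eta V - g W (V + h V).
  rewrite /dPhi phi_xi cov0r sub0r cov_xi !(phiD, phiN) !acm_phi2 eta_h.
  by rewrite !gE g_xi; ring.
rewrite E1 in E.
have E2 : dPhi W xi V = g W (V + h V) - eta W * eta V.
  rewrite -[LHS]opprK -dPhi_skew.
  rewrite /dPhi phi_xi cov0r sub0r cov_xi !(phiD, phiN) !acm_phi2 eta_h.
  by rewrite !gE g_xi [g V W]gC [g V (h W)]gC h_sym; ring.
rewrite E2 in E; apply: CinfE => p; at_point E p; rewrite ?evE; lra.
Qed.

End levi_civita.
End contact.

(** * The operator h under the curvature condition *)

Section kappa_mu.
Variables (R : realType) (m : nat) (M : manifold R m) (S : almost_contact_metric M).
Local Notation C := (Cinf M).
Local Notation X := (vfield M).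
Local Notation phi := (acm_phi S).
Local Notation xi := (acm_xi S).
Local Notation eta := (acm_eta S).
Local Notation g := (acm_g S).
Local Notation h := (h_op S).
Implicit Types (U V W Z : X) (f : C) (p q : M).
Local Notation gE := (gE S).

Hypothesis K : contact_metric S.
Variable N : connection M.
Hypothesis LC : levi_civita g N.
Variables kappa mu : R.
Local Notation kC := (kappa *: (1 : C)).
Local Notation mC := (mu *: (1 : C)).
Hypothesis curv : forall V W, curvature N V W xi =
  kC *: (eta W *: V - eta V *: W) + mC *: (eta W *: h V - eta V *: h W).

Lemma curv_D V W : eta V = 0 -> eta W = 0 -> curvature N V W xi = 0.
Proof. by move=> V0 W0; rewrite curv V0 W0 !scale0r subrr !scaler0 addr0. Qed.

(** The endomorphism V -> R(V, xi) xi computed from the covariant derivative of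
    xi: one part anticommutes with phi, the other one is 1 - h ^ 2. *)
Lemma curv_xi V : eta V = 0 ->
  phi (N xi (h V) - h (N xi V)) + V - h (h V) = kC *: V + mC *: h V.
Proof.
move=> V0; have := curv V xi.
rewrite V0 eta_xi !scale1r !scale0r !subr0 => <-.
rewrite /curvature (cov_xi_xi K LC) cov0r sub0r.
rewrite [bracket V xi](lc_torsion LC) covDl covNl !(cov_xi K LC V).
rewrite !(covDr, covNr) !(cov_xi_phi K LC) !(cov_xi K LC).
rewrite !(phiD, phiN, hD, hN, (h_phi K)) ?(phi2_D V0, phi2_D (eta_h K V)).
rewrite ?(phi2_D (eta_h K _)).
by apply: (@metric_nondeg _ _ _ g) => Z; rewrite !gE; ring.
Qed.

(** Comparing [curv_xi] at V and at phi V separates the two parts. *)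
Lemma h_square V : eta V = 0 -> h (h V) = V - kC *: V.
Proof.
move=> V0; have E1 := curv_xi V0; have E2 := curv_xi (eta_phi S V).
have hphi2 : h (h (phi V)) = phi (h (h V)) by rewrite !(h_phi K) hN (h_phi K) opprK.
have E3 : phi (phi (N xi (h V) - h (N xi V))) + phi V - phi (h (h V)) =
    kC *: phi V + mC *: phi (h V).
  by rewrite -!phiZ -!phiN -!phiD E1.
rewrite hphi2 (h_phi K) covNr !(cov_xi_phi K LC) (h_phi K) !(phiD, phiN) in E2.
rewrite !(phiD, phiN) in E3.
have E4 : phi (V - h (h V) - kC *: V) = 0.
  rewrite !(phiD, phiN, phiZ).
  apply: (@metric_nondeg _ _ _ g) => Z; have F2 := congr1 (fun U => g U Z) E2.
  have F3 := congr1 (fun U => g U Z) E3; move: F2 F3; rewrite /= !gE => F2 F3.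
  by apply: CinfE => p; at_point F2 p; at_point F3 p; rewrite ?evE; lra.
have := congr1 phi E4; rewrite linear0 phi2_D; last first.
  by rewrite !(etaD, etaN) etaZ V0 (eta_h K) mulr0 subrr subr0.
move=> E5; apply: (@metric_nondeg _ _ _ g) => Z; have F := congr1 (fun U => g U Z) E5.
move: F; rewrite /= !gE => F.
by apply: CinfE => p; at_point F p; rewrite ?evE; lra.
Qed.

(** As h is symmetric, 0 <= |h V| ^ 2 = (1 - kappa) |V| ^ 2; if kappa >= 1 then h
    vanishes. *)
Lemma kappa_lt1 : ~ killing g xi -> kappa < 1.
Proof.
move=> nK; rewrite ltNge; apply/negP => k1; apply: nK.
apply: (killing_h0 K) => V.
have -> : V = (V - eta V *: xi) + eta V *: xi by rewrite subrK.
have D0 : eta (V - eta V *: xi) = 0 by rewrite etaD etaN etaZ eta_xi mulr1 subrr.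
rewrite hD hZ (h_xi S) scaler0 addr0; move: (V - _) D0 => {}V V0.
apply: vfield_ext => p; apply: (@metric_def _ _ _ g); apply/eqP.
rewrite eq_le metric_ge0 andbT (h_sym K) h_square// !gE ?evE.
have := metric_ge0 g p V; nra.
Qed.

Section eigen.
Variable l : R.
Hypothesis l0 : l != 0.
Local Notation lC := (l *: (1 : C)).

Definition eigen V := eta V = 0 /\ h V = lC *: V.

Lemma eigen_orth V W : eigen V -> eigen W -> g (phi V) W = 0.
Proof.
move=> [V0 hV] [W0 hW]; have := h_sym K (phi V) W.
rewrite (h_phi K) hV hW phiZ !gE => E; apply: mul2C; apply: (mulcC l0).
apply: CinfE => p; at_point E p; rewrite ?evE; lra.
Qed.

Lemma cov_xi_eigen V : eigen V -> N V xi = - ((1 + lC) *: phi V).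
Proof.
by move=> [V0 hV]; rewrite (cov_xi K LC) hV phiZ scalerDl scale1r opprD.
Qed.

Lemma cov_xi_phi_eigen V : eigen V -> N (phi V) xi = (1 - lC) *: V.
Proof.
move=> [V0 hV]; rewrite (cov_xi K LC) (h_phi K) hV !(phiN, phiZ) phi2_D//.
by apply: (@metric_nondeg _ _ _ g) => Z; rewrite !gE; ring.
Qed.

Lemma cov_lZ (a b : R) V W :
  N V ((a *: (1 : C) + b *: (1 : C)) *: W) = (a *: (1 : C) + b *: (1 : C)) *: N V W.
Proof. by rewrite -scalerDl covZcr. Qed.

Lemma cov_1Dl V W : N V ((1 + lC) *: W) = (1 + lC) *: N V W.
Proof. by have := cov_lZ 1 l V W; rewrite scale1r. Qed.

Lemma cov_1Bl V W : N V ((1 - lC) *: W) = (1 - lC) *: N V W.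
Proof. by have := cov_lZ 1 (- l) V W; rewrite scale1r scaleNr. Qed.

(** The vanishing of R(.,.) xi on the contact distribution says, once xi is
    differentiated, that the combination F below is symmetric in its first two
    arguments (apply R(V, W) xi = 0) and skew in its outer ones (apply
    R(V, phi W) xi = 0). Such a form is zero, and then so is c. *)
Lemma cov_eigen_orth V W Z : eigen V -> eigen W -> eigen Z -> g (N V W) (phi Z) = 0.
Proof.
pose c A B E := g (N A B) (phi E).
pose F A B E := (1 - lC) * c A B E - (1 + lC) * c A E B.
have pair U A : eigen A -> g (N U xi) A = (1 - lC) * g U (phi A).
  move=> [A0 hA]; rewrite (cov_xi K LC) !gE !phi_skew (h_sym K) (h_phi K) hA phiZ !gE.
  ring.
have pairphi U A : eigen A -> g (N U xi) (phi A) = - ((1 + lC) * g U A).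
  move=> [A0 hA]; rewrite (cov_xi K LC) !gE !phi_skew (h_sym K) phi2_D// hN hA !gE.
  ring.
have cphi A B E : eigen B -> eigen E -> g (N A (phi B)) E = - c A E B.
  move=> eB eE; have := lc_metric LC A (phi B) E; rewrite (eigen_orth eB eE) vfield0.
  by rewrite [g (phi B) _]gC => /esym/eqP; rewrite addr_eq0 => /eqP.
have Fsym A B E : eigen A -> eigen B -> eigen E -> F A B E = F B A E.
  move=> eA eB eE.
  have Cu := curv_D (proj1 eA) (proj1 eB).
  have := congr1 (fun U => g U E) Cu; rewrite /curvature (cov_xi_eigen eA) (cov_xi_eigen eB).
  rewrite !(covNr, cov_1Dl) /= !gE (pair _ _ eE) (cphi _ _ _ eB eE) (cphi _ _ _ eA eE) (lc_torsion LC) !gE => H.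
  by rewrite /F /c; apply: CinfE => p; at_point H p; rewrite ?evE; lra.
have Fskew A B E : eigen A -> eigen B -> eigen E -> F A B E = - F E B A.
  have key A' E' : eigen A' -> eigen B -> eigen E' -> F A' B E' =
    (1 + lC) * (g (N (phi B) A') E' - g (N (phi B) (phi A')) (phi E')).
    move=> eA eB eE.
    have Cu := curv_D (proj1 eA) (eta_phi S B).
    have := congr1 (fun U => g U (phi E')) Cu.
    rewrite /curvature (cov_xi_eigen eA) (cov_xi_phi_eigen eB).
    rewrite !(covNr, cov_1Dl, cov_1Bl) /= !gE (pairphi _ _ eE) (lc_torsion LC) !gE (cphi _ _ _ eB eE) => H.
    by rewrite /F /c; apply: CinfE => p; at_point H p; rewrite ?evE; lra.
  move=> eA eB eE; rewrite !key//.
  have H1 := lc_metric LC (phi B) A E.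
  have H2 := lc_metric LC (phi B) (phi A) (phi E).
  rewrite g_phi (proj1 eA) mul0r subr0 H1 in H2.
  apply: CinfE => p; at_point H2 p.
  rewrite [g A _]gC [g (phi A) _]gC ?evE => H2'.
  by rewrite -mulrN; congr (_ * _); lra.
move=> eV eW eZ.
have F0 A B E : eigen A -> eigen B -> eigen E -> F A B E = 0.
  move=> eA eB eE; apply: mul2C.
  have : F A B E = - F A B E.
    rewrite {1}Fsym// Fskew// Fsym// Fskew// opprK Fsym// Fskew//.
  by move=> H; rewrite mulr_natl mulr2n {1}H addNr.
have F1 := F0 V W Z eV eW eZ; have F2 := F0 V Z W eV eZ eW.
apply: (mulcC l0); apply: mul2C; apply: mul2C.
rewrite /F /c in F1 F2.
(* F V W Z = F V Z W = 0 is a linear system in c V W Z and c V Z W of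
   determinant (1 - l) ^ 2 - (1 + l) ^ 2 = - 4 l *)
have : (1 - lC) * ((1 - lC) * c V W Z - (1 + lC) * c V Z W) +
   (1 + lC) * ((1 - lC) * c V Z W - (1 + lC) * c V W Z) = 0.
  by rewrite F1 F2 !mulr0 addr0.
rewrite -/(c V W Z) => H; apply: CinfE => p; at_point H p; rewrite ?evE; lra.
Qed.

End eigen.

End kappa_mu.

(** * Images of projections of constant rank *)

Lemma row_free_cast (F : fieldType) n r k (e : n = r) (A : 'M[F]_(r, k)) :
  row_free A -> row_free (rowsub (cast_ord e) A).
Proof.
case: r / e A => A fA; have -> // : rowsub (cast_ord (erefl n)) A = A.
by apply/matrixP => i j; rewrite mxE cast_ord_id.
Qed.

Section projections.
Variables (R : realType) (n : nat) (M : manifold R (2 * n).+1).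
Variable S : almost_contact_metric M.
Local Notation m := (2 * n).+1.
Local Notation C := (Cinf M).
Local Notation X := (vfield M).
Local Notation phi := (acm_phi S).
Local Notation xi := (acm_xi S).
Local Notation eta := (acm_eta S).
Implicit Types (V W : X) (f : C) (p q : M).

Section at_a_point.
Variables (x : 'I_m -> C) (B : 'I_m -> X) (q : M).
Hypothesis Bx : forall j k, B j (x k) q = (j == k)%:R.
Hypothesis frame : forall V f, V f q = \sum_j V (x j) q * B j f q.

Definition coords V : 'rV[R]_m := \row_j V (x j) q.
Definition tensor_mx (A : X -> X) : 'M[R]_m := \matrix_j coords (A (B j)).

Lemma coords_inj V W : coords V = coords W -> tangent V q = tangent W q.
Proof.
move=> VW; apply/funext => f; rewrite /tangent !frame; apply: eq_bigr => j _.
by have /rowP/(_ j) := VW; rewrite !mxE => ->.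
Qed.

Lemma coords_tangent V W : tangent V q = tangent W q -> coords V = coords W.
Proof. by move=> VW; apply/rowP => j; rewrite !mxE; exact: tangentE. Qed.

Lemma coords_tensor A V : fun_linear A -> coords (A V) = coords V *m tensor_mx A.
Proof.
move=> Al.
have A0 : A 0 = 0 by have := Al (-1) 0 0; rewrite scaler0 addr0 scaleN1r addNr.
have AS r (F : 'I_r -> C) (G : 'I_r -> X) : A (\sum_i F i *: G i) = \sum_i F i *: A (G i).
  elim: r F G => [|r IH] F G; first by rewrite !big_ord0.
  by rewrite !big_ord_recr /= addrC Al IH addrC.
have E : tangent V q = tangent (\sum_j V (x j) *: B j) q.
  apply/funext => f; rewrite /tangent frame vf_sum Cinf_sum.
  by apply: eq_bigr => j _; rewrite vfZ CinfM.
rewrite (coords_tangent (tensorial_endo Al E)) AS.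
apply/rowP => k; rewrite !mxE vf_sum Cinf_sum; apply: eq_bigr => j _.
by rewrite vfZ CinfM !mxE.
Qed.

Lemma tensor_mx_comp A A' : fun_linear A -> tensor_mx (A \o A') = tensor_mx A' *m tensor_mx A.
Proof.
by move=> Al; apply/row_matrixP => j; rewrite row_mul !rowK /= coords_tensor.
Qed.

Lemma tensor_mx_id : tensor_mx id = 1%:M.
Proof. by apply/matrixP => j k; rewrite !mxE Bx. Qed.

Variables PL PQ : X -> X.
Hypotheses (lPL : fun_linear PL) (lPQ : fun_linear PQ).
Hypothesis PQL : forall V, PQ (PL V) = 0.
Hypothesis Psum : forall V, PL V + PQ V + eta V *: xi = V.
Hypothesis PLE : forall V, PL V = - phi (PQ (phi V)).
Hypothesis PQE : forall V, PQ V = - phi (PL (phi V)).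

(** PL and PQ are conjugate by phi, so they have the same rank r; from PQ PL = 0
    and PL + PQ + eta xi = 1 one gets 2 r <= 2 n + 1 <= 2 r + 1. *)
Lemma rank_projection : \rank (tensor_mx PL) = n.
Proof.
have lphi : fun_linear (fun V => - phi V).
  by move=> f V W; rewrite linearP opprD scalerN.
have lphi2 : fun_linear phi by move=> f V W; rewrite linearP.
have rk (A A' : X -> X) : fun_linear A' -> (forall V, A V = - phi (A' (phi V))) ->
    (\rank (tensor_mx A) <= \rank (tensor_mx A'))%N.
  move=> lA' AE.
  have -> : A = (fun V => - phi V) \o (A' \o phi) by apply/funext.
  rewrite tensor_mx_comp// tensor_mx_comp//.
  by apply: leq_trans (mxrankM_maxl _ _) _; exact: mxrankM_maxr.
have r1 := rk _ _ lPQ PLE; have r2 := rk _ _ lPL PQE.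
have r3 : (\rank (tensor_mx PL) + \rank (tensor_mx PQ) <= m)%N.
  apply: mulmx0_rank_max; rewrite -tensor_mx_comp//.
  by apply/matrixP => j k; rewrite !mxE /= PQL vf0.
have r4 : (m <= \rank (tensor_mx PL) + \rank (tensor_mx PQ) + 1)%N.
  have E : 1%:M = tensor_mx PL + tensor_mx PQ + (\col_j eta (B j) q) *m coords xi.
    apply/matrixP => j k; rewrite -tensor_mx_id !mxE big_ord1 !mxE.
    by rewrite -[in LHS](Psum (B j)) !vfD vfZ !CinfD CinfM.
  apply: (@leq_trans (\rank (1%:M : 'M[R]_m))); first by rewrite mxrank1.
  rewrite E.
  apply: leq_trans (mxrank_add _ _) _; rewrite leq_add//.
    exact: mxrank_add.
  apply: leq_trans (mxrankM_maxl _ _) _; exact: rank_leq_col.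
lia.
Qed.

End at_a_point.

Variables PL PQ : X -> X.
Hypotheses (lPL : fun_linear PL) (lPQ : fun_linear PQ).
Hypothesis PQL : forall V, PQ (PL V) = 0.
Hypothesis PLL : forall V, PL (PL V) = PL V.
Hypothesis Psum : forall V, PL V + PQ V + eta V *: xi = V.
Hypothesis PLE : forall V, PL V = - phi (PQ (phi V)).
Hypothesis PQE : forall V, PQ V = - phi (PL (phi V)).

(** The images of n coordinate fields that are independent at p remain independent
    near p, and since the rank is n everywhere they span the image of PL. *)
Lemma image_subbundle (L : tangent_distribution M) :
  (forall q v, L q v <-> exists V, v = tangent (PL V) q) -> is_subbundle n L.
Proof.
move=> LE p; have [x [B HB]] := local_frame p.
have [Bxp framep] := nbhs_singleton HB.
have rp := rank_projection Bxp framep lPL lPQ PQL Psum PLE PQE.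
pose f0 (i : 'I_n) := maxrankfun (tensor_mx x B p PL) (cast_ord (esym rp) i).
pose E i := PL (B (f0 i)).
pose NE q := \matrix_i coords x q (E i).
have NEp : row_free (NE p).
  have -> : NE p = rowsub (cast_ord (esym rp)) (rowsub (maxrankfun (tensor_mx x B p PL))
      (tensor_mx x B p PL)).
    by apply/matrixP => i j; rewrite !mxE.
  exact/row_free_cast/maxrowsub_free.
(* near p the product of the rows with a fixed right inverse at p has a
   nonzero determinant *)
pose K := pinvmx (NE p).
have NK1 : NE p *m K = 1%:M by apply: mulmxVp.
pose DK : 'M[C]_n := \matrix_(i, j) \sum_k K k j *: (E i (x k)).
have DKE q : map_mx (ev q) DK = NE q *m K.
  apply/matrixP => i j; rewrite !mxE /ev Cinf_sum; apply: eq_bigr => k _.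
  by rewrite !mxE CinfZ mulrC.
have detE q : (\det DK) q = \det (NE q *m K).
  by rewrite -[LHS]/(ev q (\det DK)) -det_map_mx DKE.
have nearN : \forall q \near p, row_free (NE q).
  have d1 : (\det DK) p != 0 by rewrite detE NK1 det1 oner_neq0.
  have H : \forall q \near p, (\det DK) q != 0.
    exact: (@Cinf_continuous _ _ _ (\det DK) p) (open_nbhs_nbhs (conj (@open_neq R 0) d1)).
  apply: filterS H => q; rewrite detE -unitfE -[_ \is a _]/(_ \in unitmx).
  rewrite -row_free_unit -!row_leq_rank => H.
  exact: leq_trans H (mxrankM_maxl _ _).
exists E; have nI := @filterI M (nbhs p) (nbhs_filter p).
apply: filterS (nI _ _ nearN HB) => q [fN [Bxq frameq]].
have lcE a : coords x q (lincomb E a) = (\row_i a i) *m NE q.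
  apply/rowP => k; rewrite !mxE lincombE; apply: eq_bigr => i _.
  by rewrite !mxE.
have PLlc a : PL (lincomb E a) = lincomb E a.
  have PL0 : PL 0 = 0 by have := lPL (-1) 0 0; rewrite scaler0 addr0 scaleN1r addNr.
  have PLD U V : PL (U + V) = PL U + PL V by rewrite -[U]scale1r lPL !scale1r.
  have PLZ f V : PL (f *: V) = f *: PL V by rewrite -[f *: V]addr0 lPL PL0 addr0.
  have PLS r (F : 'I_r -> X) : PL (\sum_i F i) = \sum_i PL (F i).
    elim: r F => [|r IH] F; first by rewrite !big_ord0.
    by rewrite !big_ord_recr /= PLD IH.
  rewrite /lincomb PLS; apply: eq_bigr => i _; by rewrite PLZ /E PLL.
split=> [a a0 i|].
  have : (\row_i a i) *m NE q = 0.
    by rewrite -lcE; apply/rowP => k; rewrite !mxE lincombE a0.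
  rewrite -[RHS](mul0mx _ (NE q)) => /(row_free_inj fN)/rowP/(_ i).
  by rewrite !mxE.
apply/seteqP; split=> [v /LE[V ->]|v [a ->]]; last first.
  apply/LE; exists (lincomb E a); rewrite PLlc; apply/funext => f.
  by rewrite /tangent lincombE.
have sub : (coords x q (PL V) <= NE q)%MS.
  have rq := rank_projection Bxq frameq lPL lPQ PQL Psum PLE PQE.
  have NL : (NE q <= tensor_mx x B q PL)%MS.
    apply/row_subP => i; rewrite rowK.
    have -> : coords x q (E i) = row (f0 i) (tensor_mx x B q PL) by rewrite rowK.
    exact: row_sub.
  rewrite (coords_tensor frameq V lPL).
  apply: submx_trans (submxMl _ _) _.
  have : (NE q == tensor_mx x B q PL)%MS.
    by rewrite -(mxrank_leqif_eq NL) rq; move: fN; rewrite /row_free.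
  by case/andP.
have /submxP[u Eu] := sub; exists (fun i => u 0 i).
have -> : tangent (PL V) q = tangent (lincomb E (fun i => u 0 i)) q.
  apply: (coords_inj frameq); rewrite Eu lcE; congr (_ *m _).
  by apply/rowP => i; rewrite mxE.
by apply/funext => f; rewrite /tangent lincombE.
Qed.

End projections.

(** * The eigendistributions of h *)

Section projection_operator.
Variables (R : realType) (n : nat) (M : manifold R (2 * n).+1).
Variable S : almost_contact_metric M.
Local Notation C := (Cinf M).
Local Notation X := (vfield M).
Local Notation xi := (acm_xi S).
Local Notation eta := (acm_eta S).
Local Notation g := (acm_g S).
Variables L Q : tangent_distribution M.
Hypotheses (sL : is_subbundle n L) (sQ : is_subbundle n Q).
Hypotheses (eL : forall V, sections L V -> eta V = 0).
Hypothesis (oLQ : orthogonal_dist g L Q).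

Lemma projE (A B : X) (f : C) : sections L A -> sections Q B ->
  Defs.proj S L Q (A + B + f *: xi) = A.
Proof.
move=> LA QB; apply: xget_unique => [|A' [LA' [B' QB' [f' E]]]].
  by split=> //; exists B => //; exists f.
apply: vfield_ext => p.
have E2 : tangent (A' + B' + f' *: xi) p = tangent (A + B + f *: xi) p by rewrite -E.
exact: (pointwise_uniq sL sQ eL oLQ (LA' p) (LA p) (QB' p) (QB p) E2).
Qed.

Lemma sections_proj V : sections L (Defs.proj S L Q V).
Proof.
rewrite /Defs.proj; case: xgetP => [A _ [LA _]//|_]; exact: sections0.
Qed.

End projection_operator.

Section eigendistribution.
Variables (R : realType) (m : nat) (M : manifold R m) (S : almost_contact_metric M).
Local Notation C := (Cinf M).
Local Notation X := (vfield M).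
Local Notation phi := (acm_phi S).
Local Notation xi := (acm_xi S).
Local Notation eta := (acm_eta S).
Local Notation g := (acm_g S).
Local Notation h := (h_op S).
Implicit Types (U V W Z : X) (f : C) (p q : M).
Local Notation gE := (gE S).
Hypothesis K : contact_metric S.
Variable l : R.
Hypothesis l0 : l != 0.
Local Notation lC := (l *: (1 : C)).

Lemma eigen_sections V : eigen S l V <-> sections (eigendist (acm_h S) l) V.
Proof.
rewrite h_opE; split=> [[_ hV] p|LV].
  by exists V => //=; apply/funext => f; rewrite hV /tangent vfZ CinfM CinfZ Cinf1 mulr1.
have hV : h V = lC *: V.
  apply: vfield_ext => p; have [V' hV' VV'] := LV p.
  rewrite -(h_tensor S VV') hV'; apply/funext => f.
  by rewrite /tangent vfZ CinfM CinfZ Cinf1 mulr1 (tangentE f VV').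
split=> //; apply: (mulcC l0).
by have := eta_h K V; rewrite hV etaZ.
Qed.

Lemma eigenZ f V : eigen S l V -> eigen S l (f *: V).
Proof.
move=> [V0 hV]; split; first by rewrite etaZ V0 mulr0.
by rewrite hZ hV !scalerA mulrC.
Qed.

Lemma eigen_phi V : eigen S l V -> eigen S (- l) (phi V).
Proof.
by move=> [V0 hV]; split; rewrite ?eta_phi// (h_phi K) hV phiZ scaleNr scaleNr.
Qed.

Lemma eigen_orthN V W : eigen S l V -> eigen S (- l) W -> g V W = 0.
Proof.
move=> [V0 hV] [W0 hW]; have := h_sym K V W.
rewrite hV hW !gE => E; apply: mul2C; apply: (mulcC l0).
apply: CinfE => p; at_point E p; rewrite ?evE; lra.
Qed.

(** On the contact distribution h / l is an involution, so half of 1 + h / l is the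
    projection onto one of its eigendistributions along the other. *)
Definition eigen_proj : X -> X := locked (fun V =>
  (2^-1 *: (1 : C)) *: (V - eta V *: xi) + ((2 * l)^-1 *: (1 : C)) *: h V).

Lemma eigen_projE V : eigen_proj V =
  (2^-1 *: (1 : C)) *: (V - eta V *: xi) + ((2 * l)^-1 *: (1 : C)) *: h V.
Proof. by rewrite /eigen_proj -lock. Qed.

Hypothesis h2 : forall V, eta V = 0 -> h (h V) = (l ^+ 2 *: (1 : C)) *: V.

Lemma eigen_proj_lin : fun_linear eigen_proj.
Proof.
move=> f V W; rewrite !eigen_projE h_lin linearP.
by apply: (@metric_nondeg _ _ _ g) => Z; rewrite !gE /=; ring.
Qed.

Lemma eigen_projP V : eigen S l (eigen_proj V).
Proof.
have D0 : eta (V - eta V *: xi) = 0 by rewrite etaD etaN etaZ eta_xi mulr1 subrr.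
have hD0 : h (V - eta V *: xi) = h V by rewrite hD hN hZ (h_xi S) scaler0 subr0.
split; first by rewrite !eigen_projE etaD !etaZ D0 (eta_h K) !mulr0 addr0.
rewrite !eigen_projE hD !hZ hD0 -{2}hD0 h2//; apply: (@metric_nondeg _ _ _ g) => Z.
rewrite !gE; apply: CinfE => p; rewrite ?evE; field.
by rewrite l0.
Qed.

Lemma eigen_proj_id V : eigen S l V -> eigen_proj V = V.
Proof.
move=> [V0 hV]; rewrite !eigen_projE V0 hV scale0r subr0.
apply: (@metric_nondeg _ _ _ g) => Z; rewrite !gE; apply: CinfE => p; rewrite ?evE.
by field; rewrite l0.
Qed.

End eigendistribution.

Section two_eigendistributions.
Variables (R : realType) (m : nat) (M : manifold R m) (S : almost_contact_metric M).
Local Notation C := (Cinf M).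
Local Notation X := (vfield M).
Local Notation phi := (acm_phi S).
Local Notation xi := (acm_xi S).
Local Notation eta := (acm_eta S).
Local Notation g := (acm_g S).
Local Notation h := (h_op S).
Implicit Types (U V W Z : X) (f : C) (p q : M).
Local Notation gE := (gE S).
Hypothesis K : contact_metric S.
Variable l : R.
Hypothesis l0 : l != 0.
Hypothesis h2 : forall V, eta V = 0 -> h (h V) = (l ^+ 2 *: (1 : C)) *: V.

Lemma oppl0 : - l != 0. Proof. by rewrite oppr_eq0. Qed.
Lemma h2N V : eta V = 0 -> h (h V) = ((- l) ^+ 2 *: (1 : C)) *: V.
Proof. by rewrite sqrrN; exact: h2. Qed.

Lemma eigen_proj_sum V : eigen_proj S l V + eigen_proj S (- l) V + eta V *: xi = V.
Proof.
rewrite !eigen_projE; apply: (@metric_nondeg _ _ _ g) => Z.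
rewrite !gE; apply: CinfE => p; rewrite ?evE; field.
by rewrite l0.
Qed.

Lemma eigen_proj0 V : eigen S (- l) V -> eigen_proj S l V = 0.
Proof.
move=> [V0 hV]; rewrite !eigen_projE V0 hV scale0r subr0.
apply: (@metric_nondeg _ _ _ g) => Z; rewrite !gE; apply: CinfE => p; rewrite ?evE.
by field; rewrite l0.
Qed.

Lemma eigen_proj_xi : eigen_proj S l xi = 0.
Proof.
by rewrite !eigen_projE eta_xi scale1r subrr scaler0 add0r (h_xi S) scaler0.
Qed.

Lemma eigen_proj_phi V : eigen_proj S l (phi V) = phi (eigen_proj S (- l) V).
Proof.
rewrite !eigen_projE eta_phi scale0r subr0 phiD !phiZ phiD phiN phiZ phi_xi scaler0 subr0.
rewrite (h_phi K) mulrN invrN; apply: (@metric_nondeg _ _ _ g) => Z; rewrite !gE.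
by apply: CinfE => p; rewrite ?evE; ring.
Qed.

Lemma eigen_proj_sym V W : g (eigen_proj S l V) W = g V (eigen_proj S l W).
Proof.
rewrite !eigen_projE !gE (h_sym K) g_xi g_xil; ring.
Qed.

Lemma eigen_dec V : eta V = 0 -> exists A B, [/\ eigen S l A, eigen S (- l) B & V = A + B].
Proof.
move=> V0; exists (eigen_proj S l V), (eigen_proj S (- l) V); split.
- exact: eigen_projP.
- exact: (eigen_projP K oppl0 h2N).
by rewrite -[LHS]eigen_proj_sum V0 scale0r addr0.
Qed.

End two_eigendistributions.

(** * The Levi-Civita connection on the eigendistributions *)

Section parallel_phi.
Variables (R : realType) (m : nat) (M : manifold R m) (S : almost_contact_metric M).
Local Notation C := (Cinf M).
Local Notation X := (vfield M).
Local Notation phi := (acm_phi S).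
Local Notation xi := (acm_xi S).
Local Notation eta := (acm_eta S).
Local Notation g := (acm_g S).
Local Notation h := (h_op S).
Implicit Types (U V W Z : X) (f : C) (p q : M).
Local Notation gE := (gE S).
Hypothesis K : contact_metric S.
Variable N : connection M.
Hypothesis LC : levi_civita g N.
Variables kappa mu : R.
Local Notation kC := (kappa *: (1 : C)).
Local Notation mC := (mu *: (1 : C)).
Hypothesis curv : forall V W, curvature N V W xi =
  kC *: (eta W *: V - eta V *: W) + mC *: (eta W *: h V - eta V *: h W).
Local Notation dPhi := (dPhi S N).
Local Notation orth := (cov_eigen_orth K LC curv).

Section one_sign.
Variable l : R.
Hypothesis l0 : l != 0.
Local Notation eig := (eigen S l).
Local Notation eigN := (eigen S (- l)).
Let lN0 : - l != 0 := oppl0 l0.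

Lemma phi_phi_eig V : eig V -> phi (phi V) = - V.
Proof. by move=> [V0 _]; exact: phi2_D. Qed.

Lemma dPhi_opposite V W Z : eigN V -> eig W -> eig Z -> dPhi V W Z = 0.
Proof.
move=> eV eW eZ.
have W' : W = - phi (phi W) by rewrite phi_phi_eig ?opprK.
have Z' : Z = - phi (phi Z) by rewrite phi_phi_eig ?opprK.
have eW' := eigen_phi K eW; have eZ' := eigen_phi K eZ.
have E1 : g (N V (phi Z)) W = 0.
  by rewrite W' metricNr (orth lN0 eV eZ' eW') oppr0.
have E2 : g (N V (phi W)) Z = 0.
  by rewrite Z' metricNr (orth lN0 eV eW' eZ') oppr0.
rewrite /dPhi gC !gE E1 phi_skew sub0r opprK.
have := lc_metric LC V (phi W) Z; rewrite (eigen_orth K l0 eW eZ) vfield0 E2 add0r.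
by rewrite gC => <-.
Qed.

(** Closedness of Phi makes the form symmetric in its outer arguments, and the
    compatibility of phi with g makes it skew in the last two: such a form
    vanishes. *)
Lemma dPhi_mixed V W Z : eig V -> eig W -> eig Z -> dPhi V (phi W) Z = 0.
Proof.
have sym A B E : eig A -> eig B -> eig E -> dPhi A (phi B) E = dPhi E (phi B) A.
  move=> eA eB eE; have := dPhi_cyclic K LC A (phi B) E.
  rewrite (dPhi_opposite (eigen_phi K eB) eE eA) addr0 (dPhi_skew LC E) => /eqP.
  by rewrite subr_eq0 => /eqP.
have skew A B E : eig A -> eig B -> eig E -> dPhi A (phi B) E = - dPhi A (phi E) B.
  move=> eA eB eE; rewrite /dPhi !gE !g_phi (proj1 eB) (proj1 eE) !mul0r !subr0.
  have H1 := lc_metric LC A (phi B) (phi E); rewrite g_phi (proj1 eB) mul0r subr0 in H1.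
  rewrite (lc_metric LC) [g (N A (phi B)) _]gC [g (N A B) _]gC in H1.
  by apply: CinfE => p; at_point H1 p; rewrite ?evE; lra.
move=> eV eW eZ; apply: mul2C; rewrite mulr_natl mulr2n.
rewrite {1}(sym _ _ _ eV eW eZ) (skew _ _ _ eZ eW eV) (sym _ _ _ eZ eV eW).
rewrite (skew _ _ _ eW eV eZ) opprK (sym _ _ _ eW eZ eV).
by rewrite (skew _ _ _ eV eZ eW) addNr.
Qed.

End one_sign.

Lemma dPhiDl V V' W Z : dPhi (V + V') W Z = dPhi V W Z + dPhi V' W Z.
Proof. by rewrite /dPhi !covDl phiD !gE; ring. Qed.

Lemma dPhiZl f V W Z : dPhi (f *: V) W Z = f * dPhi V W Z.
Proof. by rewrite /dPhi !covZl phiZ !gE; ring. Qed.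

Section two_signs.
Variable l : R.
Hypothesis l0 : l != 0.
Hypothesis h2 : forall V, eta V = 0 -> h (h V) = (l ^+ 2 *: (1 : C)) *: V.
Local Notation eig := (eigen S l).
Local Notation eigN := (eigen S (- l)).
Let lN0 : - l != 0 := oppl0 l0.

(** Split V along the two eigendistributions and xi; the component along the other
    eigendistribution is [dPhi_mixed] for - l, with phi Z and phi W in the place of
    W and Z. *)
Lemma cov_phi_eigen V W Z : eig W -> eig Z -> dPhi V (phi W) Z = 0.
Proof.
move=> eW eZ.
have D0 : eta (V - eta V *: xi) = 0 by rewrite etaD etaN etaZ eta_xi mulr1 subrr.
have [A [B [eA eB VE]]] := eigen_dec K l0 h2 D0.
have -> : V = A + B + eta V *: xi by rewrite -VE subrK.
have xi0 : dPhi xi (phi W) Z = 0.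
  by rewrite /dPhi (cov_xi_phi K LC) subrr metric0r.
rewrite !dPhiDl dPhiZl xi0 mulr0 addr0 (dPhi_mixed l0 eA eW eZ) add0r.
have -> : Z = - phi (phi Z) by rewrite (phi2_D (proj1 eZ)) opprK.
have eW' := eigen_phi K eW; have eZ' := eigen_phi K eZ.
rewrite /dPhi phiN !covNr phiN -opprD metricNr; apply/eqP; rewrite oppr_eq0; apply/eqP.
rewrite -/(dPhi B (phi W) (phi (phi Z))) (dPhi_skew LC).
by rewrite (dPhi_mixed lN0 eB eZ' eW') oppr0.
Qed.

(** Along the eigendistribution of W this is [cov_eigen_orth]; along the other one, W
    and Z exchange their roles because they are orthogonal. *)
Lemma cov_orth A W Z : eta A = 0 -> eig W -> eigN Z -> g (N A W) Z = 0.
Proof.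
move=> A0 eW eZ; have [A1 [A2 [eA1 eA2 ->]]] := eigen_dec K l0 h2 A0.
rewrite covDl metricDl.
have ZE : Z = - phi (phi Z) by rewrite (phi2_D (proj1 eZ)) opprK.
have eZ' : eig (phi Z) by have := eigen_phi K eZ; rewrite opprK.
have -> : g (N A1 W) Z = 0.
  by rewrite ZE metricNr (orth l0 eA1 eW eZ') oppr0.
have WE : W = - phi (phi W) by rewrite (phi2_D (proj1 eW)) opprK.
have eW' := eigen_phi K eW.
have := lc_metric LC A2 W Z; rewrite (eigen_orthN K l0 eW eZ) vfield0.
have -> : g W (N A2 Z) = 0.
  by rewrite gC WE metricNr (orth lN0 eA2 eZ eW') oppr0.
by rewrite addr0 add0r => <-.
Qed.

End two_signs.
End parallel_phi.

(** * The adapted connection of a (kappa, mu)-space *)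

Section adapted_connection.
Variables (R : realType) (n : nat) (M : manifold R (2 * n).+1).
Variable S : almost_contact_metric M.
Local Notation C := (Cinf M).
Local Notation X := (vfield M).
Local Notation phi := (acm_phi S).
Local Notation xi := (acm_xi S).
Local Notation eta := (acm_eta S).
Local Notation g := (acm_g S).
Local Notation h := (h_op S).
Implicit Types (U V W Z : X) (f : C) (p q : M).
Local Notation gE := (gE S).
Hypothesis K : contact_metric S.
Variable N : connection M.
Hypothesis LC : levi_civita g N.
Variables kappa mu : R.
Local Notation kC := (kappa *: (1 : C)).
Local Notation mC := (mu *: (1 : C)).
Hypothesis curv : forall V W, curvature N V W xi =
  kC *: (eta W *: V - eta V *: W) + mC *: (eta W *: h V - eta V *: h W).
Variable l : R.
Hypothesis l0 : l != 0.
Hypothesis h2 : forall V, eta V = 0 -> h (h V) = (l ^+ 2 *: (1 : C)) *: V.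
Let lN0 : - l != 0 := oppl0 l0.
Let h2' := h2N h2.
Local Notation PL := (eigen_proj S l).
Local Notation PQ := (eigen_proj S (- l)).
Local Notation L := (eigendist (acm_h S) l).
Local Notation Q := (eigendist (acm_h S) (- l)).

Lemma eigendistP k (k0 : k != 0) (hk : forall V, eta V = 0 -> h (h V) = (k ^+ 2 *: (1 : C)) *: V)
    p v : eigendist (acm_h S) k p v <-> exists V, v = tangent (eigen_proj S k V) p.
Proof.
rewrite h_opE; split=> [[V hV <-]|[V ->]]; last first.
  have [_ hV] := eigen_projP K k0 hk V.
  exists (eigen_proj S k V) => //=; apply/funext => f.
  by rewrite hV /tangent vfZ CinfM CinfZ Cinf1 mulr1.
exists V; apply/funext => f; rewrite /tangent.
have eV : eta V p = 0.
  have E : tangent (h V) p = tangent ((k *: (1 : C)) *: V) p.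
    by rewrite hV; apply/funext => f'; rewrite /tangent vfZ CinfM CinfZ Cinf1 mulr1.
  have := eta_tensor S E; rewrite (eta_h K) etaZ CinfM CinfZ Cinf1 mulr1 => /esym/eqP.
  by rewrite mulf_eq0 (negPf k0) => /eqP.
rewrite eigen_projE vfD !vfZ vfB vfZ CinfD !CinfM CinfB CinfM eV !CinfZ !Cinf1 !mulr1.
rewrite -[h V f p]/(tangent (h V) p f) hV /tangent; field.
by rewrite k0.
Qed.

Lemma proj_phi V : PQ (phi V) = phi (PL V).
Proof. by rewrite (eigen_proj_phi K) opprK. Qed.

Lemma subbundle_eigen k : k = l \/ k = - l -> is_subbundle n (eigendist (acm_h S) k).
Proof.
move=> kE.
have k0 : k != 0 by case: kE => ->.
have hk : forall V, eta V = 0 -> h (h V) = (k ^+ 2 *: (1 : C)) *: V.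
  by case: kE => ->.
have kN0 : - k != 0 by rewrite oppr_eq0.
have hkN := h2N hk.
have P2 (j : R) : (j != 0) -> (forall V, eta V = 0 -> h (h V) = (j ^+ 2 *: (1 : C)) *: V) ->
   forall V, eigen_proj S j V = - phi (eigen_proj S (- j) (phi V)).
  move=> j0 hj V; rewrite (eigen_proj_phi K) opprK phi2_D ?opprK//.
  by case: (eigen_projP K j0 hj V).
apply: (@image_subbundle _ _ _ S (eigen_proj S k) (eigen_proj S (- k))).
- exact: eigen_proj_lin.
- exact: eigen_proj_lin.
- by move=> V; apply: eigen_proj0 => //; rewrite opprK; exact: eigen_projP.
- by move=> V; apply: eigen_proj_id => //; exact: eigen_projP.
- by move=> V; exact: eigen_proj_sum.
- exact: P2.
- by move=> V; rewrite (P2 _ kN0 hkN) opprK.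
by move=> q v; exact: eigendistP.
Qed.

(** The Levi-Civita connection projected to the two eigendistributions, with xi
    made parallel. *)
Definition adapted_cov V W := PL (N V (PL W)) + PQ (N V (PQ W)) + V (eta W) *: xi.

Lemma eigen_projD k V W : eigen_proj S k (V + W) = eigen_proj S k V + eigen_proj S k W.
Proof. by rewrite -[V]scale1r eigen_proj_lin !scale1r. Qed.

Lemma eigen_projZ k f V : eigen_proj S k (f *: V) = f *: eigen_proj S k V.
Proof.
have P0 : eigen_proj S k 0 = 0.
  by have := eigen_proj_lin S k (-1) 0 0; rewrite scaler0 addr0 scaleN1r addNr.
by rewrite -[f *: V]addr0 eigen_proj_lin P0 addr0.
Qed.

Fact adapted_cov_lin f U V W :
  adapted_cov (f *: U + V) W = f *: adapted_cov U W + adapted_cov V W.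
Proof.
rewrite /adapted_cov !cov_lin !eigen_proj_lin vfD vfZ.
by apply: (@metric_nondeg _ _ _ g) => Z; rewrite !gE; ring.
Qed.

Fact adapted_cov_add U V W : adapted_cov U (V + W) = adapted_cov U V + adapted_cov U W.
Proof.
rewrite /adapted_cov !eigen_projD !covDr !eigen_projD etaD vfieldD.
by apply: (@metric_nondeg _ _ _ g) => Z; rewrite !gE; ring.
Qed.

Fact adapted_cov_leibniz f V W :
  adapted_cov V (f *: W) = V f *: W + f *: adapted_cov V W.
Proof.
rewrite /adapted_cov !eigen_projZ !covZr !eigen_projD !eigen_projZ etaZ vfield_leibniz.
have e1 k V' : (k != 0) -> (forall V, eta V = 0 -> h (h V) = (k ^+ 2 *: (1 : C)) *: V) ->
    eigen_proj S k (eigen_proj S k V') = eigen_proj S k V'.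
  by move=> k0 hk; apply: eigen_proj_id => //; exact: eigen_projP.
rewrite !e1// -[X in _ = _ *: X + _](eigen_proj_sum S l0 W).
apply: (@metric_nondeg _ _ _ g) => Z; rewrite !gE; ring.
Qed.

Definition adapted_conn : connection M :=
  Connection adapted_cov_lin adapted_cov_add adapted_cov_leibniz.
Local Notation D := adapted_conn.

Lemma DE V W : D V W = PL (N V (PL W)) + PQ (N V (PQ W)) + V (eta W) *: xi.
Proof. by []. Qed.

Lemma PL_eig V : eigen S l (PL V). Proof. exact: eigen_projP. Qed.
Lemma PQ_eig V : eigen S (- l) (PQ V). Proof. exact: eigen_projP. Qed.
Lemma PL_id V : eigen S l V -> PL V = V. Proof. exact: eigen_proj_id. Qed.
Lemma PQ_id V : eigen S (- l) V -> PQ V = V. Proof. exact: eigen_proj_id. Qed.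
Lemma PL_0 V : eigen S (- l) V -> PL V = 0. Proof. exact: eigen_proj0. Qed.
Lemma PQ_0 V : eigen S l V -> PQ V = 0.
Proof. by move=> eV; apply: (eigen_proj0 lN0); rewrite opprK. Qed.
Lemma h_dec V : h V = (l *: (1 : C)) *: PL V - (l *: (1 : C)) *: PQ V.
Proof.
rewrite -[V in LHS](eigen_proj_sum S l0) !hD hZ (h_xi S) scaler0 addr0.
by rewrite (PL_eig V).2 (PQ_eig V).2 !scaleNr.
Qed.

Lemma PLD V W : PL (V + W) = PL V + PL W. Proof. exact: eigen_projD. Qed.
Lemma PQD V W : PQ (V + W) = PQ V + PQ W. Proof. exact: eigen_projD. Qed.
Lemma PLZ f W : PL (f *: W) = f *: PL W. Proof. exact: eigen_projZ. Qed.
Lemma PQZ f W : PQ (f *: W) = f *: PQ W. Proof. exact: eigen_projZ. Qed.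

Lemma PL_h V : PL (h V) = (l *: (1 : C)) *: PL V.
Proof.
rewrite h_dec -scaleNr PLD !PLZ (PL_id (PL_eig V)) (PL_0 (PQ_eig V)).
by rewrite scaler0 addr0.
Qed.

Lemma PQ_h V : PQ (h V) = - ((l *: (1 : C)) *: PQ V).
Proof.
rewrite h_dec -scaleNr PQD !PQZ (PQ_0 (PL_eig V)) (PQ_id (PQ_eig V)).
by rewrite scaler0 add0r scaleNr.
Qed.

Lemma g_PL V W : g (PL V) W = g V (PL W). Proof. exact: eigen_proj_sym. Qed.
Lemma g_PQ V W : g (PQ V) W = g V (PQ W). Proof. exact: eigen_proj_sym. Qed.

Lemma metric_ext3 U V : (forall Z, eigen S l Z -> g U Z = g V Z) ->
  (forall Z, eigen S (- l) Z -> g U Z = g V Z) -> eta U = eta V -> U = V.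
Proof.
move=> H1 H2 H3; apply: (@metric_nondeg _ _ _ g) => Z.
rewrite -(eigen_proj_sum S l0 Z) !metricDr !metricZr !g_xi H3.
by rewrite H1 ?H2//; [exact: PQ_eig|exact: PL_eig].
Qed.

(** The operator phi exchanges the two eigendistributions, and the component of its
    Levi-Civita derivative that does the same vanishes by [cov_phi_eigen]. *)
Lemma D_phi V W : D V (phi W) = phi (D V W).
Proof.
have z : PL (phi W) = phi (PQ W) by rewrite (eigen_proj_phi K).
rewrite !DE z (proj_phi W) eta_phi vfield0 scale0r addr0.
rewrite !phiD phiZ phi_xi scaler0 addr0 -(proj_phi (N V (PL W))) -(eigen_proj_phi K l (N V (PQ W))).
rewrite [RHS]addrC.
have ZP k Z : eigen S k Z -> Z = - phi (phi Z) by move=> [Z0 _]; rewrite phi2_D ?opprK.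
have HQ Z : eigen S l Z -> g (N V (phi (PQ W))) Z = g (phi (N V (PQ W))) Z.
  move=> eZ; have eZ' := eigen_phi K eZ.
  have := cov_phi_eigen K LC curv lN0 h2' V eZ' (PQ_eig W).
  rewrite /dPhi -[phi (phi Z)]opprK -(ZP _ _ eZ) metricNl metricBr => /eqP.
  by rewrite oppr_eq0 subr_eq0 => /eqP; rewrite !(gC S Z).
have HL Z : eigen S (- l) Z -> g (N V (phi (PL W))) Z = g (phi (N V (PL W))) Z.
  move=> eZ; have eZ' : eigen S l (phi Z) by have := eigen_phi K eZ; rewrite opprK.
  have := cov_phi_eigen K LC curv l0 h2 V eZ' (PL_eig W).
  rewrite /dPhi -[phi (phi Z)]opprK -(ZP _ _ eZ) metricNl metricBr => /eqP.
  by rewrite oppr_eq0 subr_eq0 => /eqP; rewrite !(gC S Z).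
have eta_PL U : eta (PL U) = 0 by case: (PL_eig U).
have eta_PQ U : eta (PQ U) = 0 by case: (PQ_eig U).
congr (_ + _); apply: metric_ext3 => [Z eZ|Z eZ|]; rewrite ?eta_PL ?eta_PQ//.
- by rewrite !g_PL (PL_id eZ) HQ.
- by rewrite !g_PL (PL_0 eZ) !metric0r.
- by rewrite !g_PQ (PQ_0 eZ) !metric0r.
by rewrite !g_PQ (PQ_id eZ) HL.
Qed.

Lemma preserves_L : preserves D L.
Proof.
move=> V W /(eigen_sections K l0) eW; apply/(eigen_sections K l0).
rewrite DE (PQ_0 eW) cov0r (proj1 eW) vfield0 scale0r addr0.
have -> : PQ 0 = 0 by apply: PQ_0; split; [exact: linear0|rewrite h0 scaler0].
by rewrite addr0; exact: PL_eig.
Qed.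

Lemma preserves_Q : preserves D Q.
Proof.
move=> V W /(eigen_sections K lN0) eW; apply/(eigen_sections K lN0).
rewrite DE (PL_0 eW) cov0r (proj1 eW) vfield0 scale0r addr0.
have -> : PL 0 = 0 by apply: PL_0; split; [exact: linear0|rewrite h0 scaler0].
by rewrite add0r; exact: PQ_eig.
Qed.

Lemma parallel_eta : parallel1 D eta.
Proof.
move=> V W; rewrite DE !etaD etaZ eta_xi mulr1.
by rewrite (proj1 (PL_eig _)) (proj1 (PQ_eig _)) !add0r subrr.
Qed.

Lemma parallel_g : parallel2 D g.
Proof.
move=> V W Z; rewrite !DE.
have gdec U Y : g U Y = g (PL U) (PL Y) + g (PQ U) (PQ Y) + eta U * eta Y.
  rewrite -[U in LHS](eigen_proj_sum S l0 U) !metricDl metricZl g_xil.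
  by rewrite -g_PL (PL_id (PL_eig U)) -g_PQ (PQ_id (PQ_eig U)).
rewrite (gdec W Z) !vfieldD vfield_leibniz !(lc_metric LC) !gE !g_PL !g_PQ !g_xi !g_xil.
ring.
Qed.

Lemma parallel_h : parallel_endo D (acm_h S).
Proof.
rewrite h_opE => V W; rewrite !DE PL_h PQ_h (eta_h K) vfield0 scale0r addr0.
rewrite covNr !covZcr -scaleNr PLZ PQZ !hD hZ (h_xi S) scaler0 addr0.
rewrite (PL_eig _).2 (PQ_eig _).2 !scaleNr.
by apply: (@metric_nondeg _ _ _ g) => Z; rewrite !gE; ring.
Qed.

Lemma cov_orthL A W Z : eta A = 0 -> eigen S l W -> eigen S (- l) Z -> g (N A W) Z = 0.
Proof. exact: (cov_orth K LC curv l0 h2). Qed.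

Lemma cov_orthQ A W Z : eta A = 0 -> eigen S (- l) W -> eigen S l Z -> g (N A W) Z = 0.
Proof. by move=> A0 eW eZ; apply: (cov_orth K LC curv lN0 h2') => //; rewrite opprK. Qed.

(** By [cov_orth], along the contact distribution the projections remove from the
    Levi-Civita connection nothing but the component along xi. *)
Lemma torsion_D Z Z' : eta Z = 0 -> eta Z' = 0 ->
  torsion D Z Z' = (2 * fundamental_form S Z Z') *: xi.
Proof.
move=> Z0 Z'0; rewrite /torsion /fundamental_form !DE Z0 Z'0 !vfield0 !scale0r !addr0.
have ZE : Z = PL Z + PQ Z by rewrite -[LHS](eigen_proj_sum S l0) Z0 scale0r addr0.
have Z'E : Z' = PL Z' + PQ Z' by rewrite -[LHS](eigen_proj_sum S l0) Z'0 scale0r addr0.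
have TT : bracket Z Z' = N Z (PL Z') + N Z (PQ Z') - (N Z' (PL Z) + N Z' (PQ Z)).
  by rewrite (lc_torsion LC) -!covDr -ZE -Z'E.
apply: metric_ext3 => [U eU|U eU|].
- rewrite !gE !g_PL !g_PQ (PL_id eU) (PQ_0 eU) !metric0r g_xil (proj1 eU) mulr0.
  rewrite TT !gE.
  by rewrite (cov_orthQ Z0 (PQ_eig _) eU) (cov_orthQ Z'0 (PQ_eig _) eU); ring.
- rewrite !gE !g_PL !g_PQ (PQ_id eU) (PL_0 eU) !metric0r g_xil (proj1 eU) mulr0.
  rewrite TT !gE.
  by rewrite (cov_orthL Z0 (PL_eig _) eU) (cov_orthL Z'0 (PL_eig _) eU); ring.
have E := contactE K Z Z'; rewrite Z0 Z'0 !vfield0 in E.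
rewrite !(etaD, etaN, etaZ) eta_xi (proj1 (PL_eig _)) (proj1 (PQ_eig _)).
rewrite (proj1 (PL_eig _)) (proj1 (PQ_eig _)) mulr1 -E; ring.
Qed.

Lemma projLE V : Defs.proj S L Q V = PL V.
Proof.
rewrite -[in LHS](eigen_proj_sum S l0 V).
apply: projE.
- by apply: subbundle_eigen; left.
- by apply: subbundle_eigen; right.
- by move=> U /(eigen_sections K l0)[].
- move=> U W /(eigen_sections K l0) eU /(eigen_sections K lN0) eW.
  exact: (eigen_orthN K l0 eU eW).
- exact/(eigen_sections K l0)/PL_eig.
exact/(eigen_sections K lN0)/PQ_eig.
Qed.

Lemma projQE V : Defs.proj S Q L V = PQ V.
Proof.
rewrite -[in LHS](eigen_proj_sum S l0 V) [PL V + PQ V]addrC.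
apply: projE.
- by apply: subbundle_eigen; right.
- by apply: subbundle_eigen; left.
- by move=> U /(eigen_sections K lN0)[].
- move=> U W /(eigen_sections K lN0) eU /(eigen_sections K l0) eW.
  by rewrite gC (eigen_orthN K l0 eW eU).
- exact/(eigen_sections K lN0)/PQ_eig.
exact/(eigen_sections K l0)/PL_eig.
Qed.

Lemma torsion_D_xi V : torsion D V xi =
  Defs.proj S Q L (bracket xi (Defs.proj S L Q V)) +
  Defs.proj S L Q (bracket xi (Defs.proj S Q L V)).
Proof.
rewrite projLE projQE projQE projLE /torsion !DE.
have P0 U : PL 0 = 0 by rewrite -[0](scale0r U) PLZ !scale0r.
have Q0 U : PQ 0 = 0 by rewrite -[0](scale0r U) PQZ !scale0r.
rewrite (eigen_proj_xi S l) (eigen_proj_xi S (- l)) !cov0r (P0 xi) (Q0 xi) eta_xi vfield1.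
rewrite scale0r !addr0 sub0r [bracket V xi]bracketC opprK.
have br U W : eigen S l W -> g (bracket xi U) W = g (N xi U) W - g (N U xi) W.
  by move=> _; rewrite (lc_torsion LC) metricBl.
have VE := eigen_proj_sum S l0 V.
have bV : bracket xi V = bracket xi (PL V) + bracket xi (PQ V) + xi (eta V) *: xi.
  by rewrite -[in LHS]VE !bracketDr bracketZr bracketvv scaler0 addr0.
apply: metric_ext3 => [U eU|U eU|].
- rewrite bV !gE !g_PL !g_PQ (PL_id eU) (PQ_0 eU) !metric0r !g_xil (proj1 eU).
  rewrite [bracket xi (PL V)](lc_torsion LC) !gE (cov_xi_eigen K LC (PL_eig V)) !gE.
  by rewrite (eigen_orth K l0 (PL_eig V) eU); ring.
- rewrite bV !gE !g_PL !g_PQ (PQ_id eU) (PL_0 eU) !metric0r !g_xil (proj1 eU).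
  rewrite [bracket xi (PQ V)](lc_torsion LC) !gE (cov_xi_eigen K LC (PQ_eig V)) !gE.
  by rewrite (eigen_orth K lN0 (PQ_eig V) eU); ring.
rewrite !(etaD, etaN, etaZ) eta_xi -(xi_eta K).
rewrite !(proj1 (PL_eig _)) !(proj1 (PQ_eig _)); ring.
Qed.

Lemma conjugate_eigen : conjugate_dist S L Q.
Proof.
apply/funext => p; apply/seteqP; split=> v.
  move=> /(eigendistP lN0 h2') [V ->]; exists (- phi (PQ V)).
    have eN : eigen S l (- phi (PQ V)).
      have := eigenZ (-1) (eigen_phi K (PQ_eig V)); rewrite opprK scaleN1r.
      exact.
    by have /(eigen_sections K l0)/(_ p) := eN.
  by rewrite phiN (phi2_D (proj1 (PQ_eig V))) opprK.
move=> [V /(eigendistP l0 h2) [W VW] <-].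
rewrite (phi_tensor S VW).
by have /(eigen_sections K lN0)/(_ p) := eigen_phi K (PL_eig W).
Qed.

Lemma legendrian_eigen k : k = l \/ k = - l -> legendrian S n (eigendist (acm_h S) k).
Proof.
move=> kE; have k0 : k != 0 by case: kE => ->.
split; first exact: subbundle_eigen.
  by move=> V /(eigen_sections K k0)[].
move=> V W /(eigen_sections K k0) eV /(eigen_sections K k0) eW.
rewrite K /fundamental_form; have := eigen_orth K k0 eW eV.
by rewrite gC.
Qed.

Lemma adapted_eigen : adapted S n L Q D.
Proof.
split.
- split; [by apply: legendrian_eigen; left|by apply: legendrian_eigen; right| |].
    exact: conjugate_eigen.
  move=> U W /(eigen_sections K l0) eU /(eigen_sections K lN0) eW.
  exact: (eigen_orthN K l0 eU eW).
- by split; [exact: preserves_L|exact: preserves_Q].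
- split; [exact: parallel_eta| |exact: parallel_g|exact: parallel_h].
  move=> V W Z; rewrite !K /fundamental_form.
  by have := parallel_g V W (phi Z); rewrite D_phi.
by split; [exact: torsion_D|exact: torsion_D_xi].
Qed.

End adapted_connection.

(** * The torsion of an adapted connection *)

Section curvature_with_torsion.
Variables (R : realType) (m : nat) (M : manifold R m).
Local Notation C := (Cinf M).
Local Notation X := (vfield M).
Variables (g : metric M) (D : connection M).
Implicit Types (U V W Z : X) (f : C).
Hypothesis Dg : parallel2 D g.

Lemma parallel_metric V W Z : V (g W Z) = g (D V W) Z + g W (D V Z).
Proof. by have /eqP := Dg V W Z; rewrite -addrA -opprD subr_eq0 => /eqP. Qed.

Lemma torsion_lin f U V W :
  torsion D (f *: U + V) W = f *: torsion D U W + torsion D V W.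
Proof.
rewrite /torsion cov_lin covDr covZr bracketDl bracketZl.
by apply: (@metric_nondeg _ _ _ g) => Z;
  rewrite !(metricDl, metricNl, metricZl); ring.
Qed.

Lemma torsionC U V : torsion D U V = - torsion D V U.
Proof.
rewrite /torsion [bracket U V]bracketC.
by apply: (@metric_nondeg _ _ _ g) => Z;
  rewrite !(metricDl, metricNl, metricZl); ring.
Qed.

(** The terms in second derivatives cancel by the Jacobi identity. *)
Lemma bianchi U V W : curvature D U V W + curvature D V W U + curvature D W U V =
  D U (torsion D V W) + D V (torsion D W U) + D W (torsion D U V) +
  torsion D U (bracket V W) + torsion D V (bracket W U) + torsion D W (bracket U V).
Proof.
rewrite /curvature /torsion !covDr !covNr.
apply: (@metric_nondeg _ _ _ g) => Z; have J := congr1 (fun Y => g Y Z) (jacobi U V W).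
move: J; rewrite /= !(metricDl, metricNl, metricZl) metric0l => J.
apply: CinfE => p; at_point J p; rewrite ?evE; lra.
Qed.

Lemma curvature_skew U V W Z : g (curvature D U V W) Z = - g W (curvature D U V Z).
Proof.
have E : bracket U V (g W Z) = U (V (g W Z)) - V (U (g W Z)) by [].
rewrite !(parallel_metric, vfieldD) in E.
rewrite /curvature !(metricDl, metricNl, metricDr, metricNr).
apply: CinfE => p; at_point E p; rewrite ?evE; lra.
Qed.

Lemma curvature_diag U V W : g (curvature D U V W) W = 0.
Proof.
apply: mul2C; have := curvature_skew U V W W; rewrite (Defs.metric_sym g W) => E.
by apply: CinfE => p; at_point E p; rewrite ?evE; lra.
Qed.

End curvature_with_torsion.

Section adapted_structure.
Variables (R : realType) (n : nat) (M : manifold R (2 * n).+1).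
Variable S : almost_contact_metric M.
Local Notation C := (Cinf M).
Local Notation X := (vfield M).
Local Notation phi := (acm_phi S).
Local Notation xi := (acm_xi S).
Local Notation eta := (acm_eta S).
Local Notation g := (acm_g S).
Local Notation h := (h_op S).
Implicit Types (U V W Z : X) (f : C) (p q : M).
Local Notation gE := (gE S).
Variables L Q : tangent_distribution M.
Variable D : connection M.
Hypothesis AD : adapted S n L Q D.

Let sL : is_subbundle n L. Proof. by have [[[H _ _] _ _ _] _ _ _] := AD. Qed.
Let sQ : is_subbundle n Q. Proof. by have [[_ [H _ _] _ _] _ _ _] := AD. Qed.
Let eL V : sections L V -> eta V = 0.
Proof. by have [[[_ H _] _ _ _] _ _ _] := AD; exact: H. Qed.
Let eQ V : sections Q V -> eta V = 0.
Proof. by have [[_ [_ H _] _ _] _ _ _] := AD; exact: H. Qed.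
Let oLQ : orthogonal_dist g L Q. Proof. by have [[_ _ _ H] _ _ _] := AD. Qed.
Let QphiL : Q = image_dist phi L. Proof. by have [[_ _ H _] _ _ _] := AD. Qed.
Let DL : preserves D L. Proof. by have [_ [H _] _ _] := AD. Qed.
Let Deta : parallel1 D eta. Proof. by have [_ _ [H _ _ _] _] := AD. Qed.
Let Ddeta : parallel2 D (ext_d eta). Proof. by have [_ _ [_ H _ _] _] := AD. Qed.
Let Dg : parallel2 D g. Proof. by have [_ _ [_ _ H _] _] := AD. Qed.
Let Dgm := parallel_metric Dg.

Lemma phi_LQ V : sections L V -> sections Q (phi V).
Proof. by move=> LV p; rewrite QphiL; exists V => //; exact: LV. Qed.

Lemma phi_phi_L V p : L p (tangent V p) -> tangent (phi (phi V)) p = tangent (- V) p.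
Proof.
move=> LV; have [V' [LV' VV']] := subbundle_extend sL LV.
have e0 : eta V p = 0 by rewrite -(eta_tensor S VV') eL.
apply/funext => f; rewrite acm_phi2 /tangent vfD vfN vfZ CinfD CinfN CinfM e0.
by rewrite mul0r addr0.
Qed.

Lemma phi_QL V : sections Q V -> sections L (phi V).
Proof.
move=> QV p; have := QV p; rewrite QphiL => -[W LW WV].
rewrite -(phi_tensor S WV) phi_phi_L//.
have := subbundle_lin sL (-1) LW (subbundle0 sL p); congr (L p _).
by apply/funext => f; rewrite /tangent vfN CinfN mulN1r addr0.
Qed.

Lemma dec_LQ V : exists VL VQ, [/\ sections L VL, sections Q VQ & V = VL + VQ + eta V *: xi].
Proof. exact: (decomposition sL sQ eL eQ oLQ). Qed.

Lemma D_eta V W : eta (D V W) = V (eta W).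
Proof. by have /eqP := Deta V W; rewrite subr_eq0 => /eqP. Qed.

Lemma D_xi V : D V xi = 0.
Proof.
apply: (@metric_nondeg _ _ _ g) => W; rewrite metric0l.
have E := Dgm V xi W; rewrite !g_xil D_eta in E.
by apply: CinfE => p; at_point E p; lra.
Qed.

Definition tau : X -> X := locked (fun V => bracket xi V - D xi V).

Lemma tauE V : tau V = bracket xi V - D xi V.
Proof. by rewrite /tau -lock. Qed.

Lemma torsion_xi V : torsion D V xi = tau V.
Proof. by rewrite tauE /torsion D_xi sub0r [bracket V xi]bracketC opprK addrC. Qed.

Lemma eta_tau V : eta (tau V) = 0.
Proof.
have [_ _ _ [_ HT]] := AD; rewrite -torsion_xi HT etaD.
by rewrite (eQ (sections_proj S L sQ _)) (eL (sections_proj S Q sL _)) addr0.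
Qed.

Lemma adapted_xi_eta V : eta (bracket xi V) = xi (eta V).
Proof.
by have := eta_tau V; rewrite tauE etaD etaN D_eta => /eqP; rewrite subr_eq0 => /eqP.
Qed.

Lemma split_xi V : exists Z f, eta Z = 0 /\ V = Z + f *: xi.
Proof.
exists (V - eta V *: xi), (eta V); rewrite subrK; split=> //.
by rewrite etaD etaN etaZ eta_xi mulr1 subrr.
Qed.

(** Since eta is parallel, d eta is half of the eta-component of the torsion. *)
Lemma adapted_contact : contact_metric S.
Proof.
move=> V W; rewrite /ext_d /fundamental_form.
have [_ _ _ [HT _]] := AD.
have [Z [a [Z0 ->]]] := split_xi V; have [Z' [b [Z'0 ->]]] := split_xi W.
have E := congr1 eta (HT Z Z' Z0 Z'0).
rewrite /torsion !(etaD, etaN) !D_eta Z0 Z'0 !vfield0 etaZ eta_xi mulr1 in E.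
rewrite /fundamental_form in E.
have -> : g (Z + a *: xi) (phi (Z' + b *: xi)) = g Z (phi Z').
  by rewrite phiD phiZ phi_xi scaler0 addr0 metricDl metricZl g_xil eta_phi mulr0 addr0.
rewrite !(bracketDl, bracketDr, bracketZl, bracketZr) bracketvv.
rewrite !(etaD, etaZ) eta_xi !vfD !vfZ [bracket Z xi]bracketC etaN !adapted_xi_eta.
rewrite Z0 Z'0 !vfield0 (linear0 eta) !mulr1 !add0r.
by apply: CinfE => p; at_point E p; lra.
Qed.
Local Notation K := adapted_contact.

Lemma adapted_D_phi V W : D V (phi W) = phi (D V W).
Proof.
apply: (@metric_nondeg _ _ _ g) => Z; rewrite ![g _ Z]gC.
have E1 := Ddeta V Z W; have E2 := Dgm V Z (phi W).
rewrite !K /fundamental_form in E1; rewrite E2 in E1.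
by apply: CinfE => p; at_point E1 p; lra.
Qed.

Lemma tau_lin f V W : tau (f *: V + W) = f *: tau V + tau W.
Proof.
rewrite !tauE bracketDr bracketZr covDr covZr.
by apply: (@metric_nondeg _ _ _ g) => Z; rewrite !gE; ring.
Qed.

Lemma tauD V W : tau (V + W) = tau V + tau W.
Proof. by rewrite -[V]scale1r tau_lin !scale1r. Qed.
Lemma tau0 : tau 0 = 0.
Proof. by apply: (addrI (tau 0)); rewrite -tauD !addr0. Qed.
Lemma tauZ f V : tau (f *: V) = f *: tau V.
Proof. by rewrite -[f *: V]addr0 tau_lin tau0 addr0. Qed.
Lemma tauN V : tau (- V) = - tau V.
Proof. by rewrite -scaleN1r tauZ scaleN1r. Qed.
Lemma tau_xi : tau xi = 0.
Proof. by rewrite !tauE bracketvv D_xi subrr. Qed.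

Lemma torsion_full V W : torsion D V W =
  (2 * g V (phi W)) *: xi + eta W *: tau V - eta V *: tau W.
Proof.
have [_ _ _ [HT _]] := AD.
have [Z [a [Z0 ->]]] := split_xi V; have [Z' [b [Z'0 ->]]] := split_xi W.
have -> : g (Z + a *: xi) (phi (Z' + b *: xi)) = g Z (phi Z').
  by rewrite phiD phiZ phi_xi scaler0 addr0 metricDl metricZl g_xil eta_phi mulr0 addr0.
rewrite !etaD !etaZ Z0 Z'0 eta_xi !mulr1 !add0r.
rewrite [Z + _]addrC [Z' + _]addrC (torsion_lin g) ![torsion D _ (b *: xi + Z')](torsionC g).
rewrite !(torsion_lin g) [torsion D xi xi](torsionC g) !torsion_xi.
rewrite ![torsion D xi _](torsionC g) !torsion_xi (torsionC g D Z' Z) HT// tau_xi.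
rewrite /fundamental_form !tauD !tauZ tau_xi.
by apply: (@metric_nondeg _ _ _ g) => Y; rewrite !gE; ring.
Qed.

Lemma tau_L V : sections L V -> sections Q (tau V).
Proof.
move=> LV; have [_ _ _ [_ HT]] := AD.
have pL : Defs.proj S L Q V = V.
  have := projE sL sQ eL oLQ 0 LV (sections0 sQ).
  by rewrite addr0 scale0r addr0.
have oQL : orthogonal_dist g Q L by move=> Y W QY LW; rewrite gC oLQ.
have pQ W : sections L W -> Defs.proj S Q L W = 0.
  move=> LW; have := projE sQ sL eQ oQL 0 (sections0 sQ) LW.
  by rewrite add0r scale0r addr0.
have p0 : Defs.proj S L Q 0 = 0.
  have := projE sL sQ eL oLQ 0 (sections0 sL) (sections0 sQ).
  by rewrite addr0 scale0r addr0.
rewrite -torsion_xi HT pL (pQ V LV) bracket0r p0 addr0.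
exact: sections_proj.
Qed.

Lemma adapted_two_h V : h V + h V = tau (phi V) - phi (tau V).
Proof.
rewrite two_h !tauE adapted_D_phi !(phiD, phiN).
by apply: (@metric_nondeg _ _ _ g) => Y; rewrite !gE; ring.
Qed.

(** The flow of xi preserves Phi, and D_xi does too. *)
Lemma tau_Phi V W : g (tau V) (phi W) = g (tau W) (phi V).
Proof.
have E1 := lie_Phi K V W; have E2 := Dgm xi V (phi W).
rewrite adapted_D_phi in E2; rewrite E1 in E2.
rewrite !tauE !gE [g (bracket xi W) _]gC [g (D xi W) _]gC !phi_skew.
by apply: CinfE => p; at_point E2 p; rewrite ?evE; lra.
Qed.

Lemma bracket_L V W : sections L V -> sections L W -> bracket V W = D V W - D W V.
Proof.
move=> LV LW; have := torsion_full V W.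
rewrite (eL LV) (eL LW) !scale0r subr0 addr0 (oLQ LV (phi_LQ LW)) mulr0 scale0r.
by rewrite /torsion => /eqP; rewrite subr_eq0 => /eqP.
Qed.

Lemma adapted_integrable : integrable_dist L.
Proof.
move=> V W LV LW; rewrite bracket_L//.
by apply: (sectionsB sL); exact: DL.
Qed.

Lemma curvature_L U V W : sections L W -> sections L (curvature D U V W).
Proof.
move=> LW; rewrite /curvature; apply: (sectionsB sL); last exact: DL.
by apply: (sectionsB sL); apply/DL/DL.
Qed.

Lemma eta_bracket V W : eta V = 0 -> eta W = 0 -> eta (bracket V W) = - (2 * g V (phi W)).
Proof.
by move=> V0 W0; rewrite -(contactE K) V0 W0 !vfield0 subr0 sub0r opprK.
Qed.

(** The two other terms of the cyclic sum lie in L, because the connection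
    preserves L; so the first Bianchi identity gives the Q-component of this one
    from the torsion. *)
Lemma curvature_LLQ V W Y Y' : sections L V -> sections L W -> sections Q Y -> sections Q Y' ->
  g (curvature D V W Y) Y' =
  - (2 * g W (phi Y) * g (tau V) Y') - 2 * g Y (phi V) * g (tau W) Y'.
Proof.
move=> LV LW QY QY'.
have zL U : sections L U -> g U Y' = 0 by move=> LU; exact: oLQ.
have zxi : g xi Y' = 0 by rewrite g_xil eQ.
have -> : g (curvature D V W Y) Y' =
    g (curvature D V W Y + curvature D W Y V + curvature D Y V W) Y'.
  have z1 := zL _ (curvature_L W Y LV); have z2 := zL _ (curvature_L Y V LW).
  by rewrite [RHS]metricDl [X in _ = X + _]metricDl z1 z2 !addr0.
rewrite (bianchi g).
rewrite !torsion_full !(eL LV) !(eL LW) !(eQ QY) !scale0r !subr0 !addr0.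
rewrite !(covZr, D_xi) !scaler0 !addr0 !gE zxi.
rewrite (eta_bracket (eL LW) (eQ QY)) (eta_bracket (eQ QY) (eL LV)).
have -> : eta (bracket V W) = 0 by apply: eL; exact: adapted_integrable.
ring.
Qed.

(** The two distributions play symmetric roles, as phi Q = L. What is proved for L
    holds for Q. *)
Lemma adapted_swap : adapted S n Q L D.
Proof.
have [[lL lQ _ _] [dL dQ] HD [HT HX]] := AD.
split=> //; last by split=> // V; rewrite HX addrC.
split=> //; last by move=> V W QV LW; rewrite gC oLQ.
apply/funext => p; apply/seteqP; split=> v.
  move=> /(subbundle_extend sL)[V [LV <-]]; exists (- phi V).
    by apply: (sectionsN sQ); exact: phi_LQ.
  by rewrite phiN (phi2_D (eL LV)) opprK.
move=> [V QV <-]; have [W [QW WV]] := subbundle_extend sQ QV.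
by rewrite -(phi_tensor S WV); exact: phi_QL.
Qed.

(** The curvature of a metric connection is skew-symmetric; with [curvature_LLQ]
    this becomes a linear condition on the form B(V, W) = g (tau V) (phi W). *)
Lemma tau_quadratic V W Z Z' : sections L V -> sections L W -> sections L Z ->
  sections L Z' ->
  g W Z * g (tau V) (phi Z') - g Z V * g (tau W) (phi Z') +
  g W Z' * g (tau V) (phi Z) - g Z' V * g (tau W) (phi Z) = 0.
Proof.
move=> LV LW LZ LZ'; have QZ := phi_LQ LZ; have QZ' := phi_LQ LZ'.
have E1 := curvature_LLQ LV LW QZ QZ'; have E2 := curvature_LLQ LV LW QZ' QZ.
have E3 := curvature_skew Dg V W (phi Z) (phi Z').
rewrite [RHS]/= [g (phi Z) _]gC in E3; rewrite E1 E2 in E3.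
rewrite !(phi2_D (eL LZ)) !(phi2_D (eL LZ')) !g_phi !gE in E3.
rewrite (eL LZ) (eL LZ') !mul0r !subr0 in E3.
apply: mul2C; apply: CinfE => p; at_point E3 p; rewrite ?evE; lra.
Qed.

(** With Z = Z' = V the condition makes B(., V) a multiple of g (., V); inserted in
    the condition with Z' = V, this makes B itself a multiple of g. The
    relation is kept free of denominators, as g V V may vanish at some points. *)
Lemma tau_umbilic V W Z : sections L V -> sections L W -> sections L Z ->
  g V V * (g V V * g (tau W) (phi Z) - g (tau V) (phi V) * g W Z) = 0.
Proof.
move=> LV LW LZ.
have key U : sections L U -> g V V * g (tau U) (phi V) = g U V * g (tau V) (phi V).
  move=> LU; have E := tau_quadratic LV LU LV LV.
  apply/eqP; rewrite -subr_eq0; apply/eqP; apply: mul2C.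
  by apply: CinfE => p; at_point E p; rewrite ?evE; lra.
have E := tau_quadratic LV LW LZ LV.
have -> : g V V * g (tau W) (phi Z) - g (tau V) (phi V) * g W Z =
    g W V * g (tau Z) (phi V) - g Z V * g (tau W) (phi V).
  rewrite [g (tau V) (phi Z)]tau_Phi in E.
  by apply: CinfE => p; at_point E p; rewrite ?evE; lra.
transitivity (g W V * (g V V * g (tau Z) (phi V)) - g Z V * (g V V * g (tau W) (phi V))).
  by ring.
by rewrite !key//; ring.
Qed.

Lemma exists_section p : (0 < n)%N -> exists V, sections L V /\ g V V p != 0.
Proof.
move=> n0; have [E [LE HE]] := subbundle_frame sL p.
have [iE _] := nbhs_singleton HE.
pose i0 := Ordinal n0; exists (E i0); split=> //.
apply/eqP => /metric_def E0.
have H f : \sum_(i < n) (i == i0)%:R * tangent (E i) p f = 0 :> R.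
  rewrite (bigD1 i0)//= ?eqxx E0 mulr0 add0r.
  by rewrite big1// => i /negPf ->; rewrite mul0r.
by have /eqP := iE (fun i => (i == i0)%:R) H i0; rewrite eqxx oner_eq0.
Qed.

(** The coefficient is B(V, V) / g (V, V) near a point where V does not vanish; these
    local quotients agree and glue. *)
Lemma tau_multiple : (0 < n)%N -> exists b : C, forall V, sections L V -> tau V = b *: phi V.
Proof.
move=> n0.
have loc p : exists b : C, \forall q \near p, forall W Z, sections L W -> sections L Z ->
    g (tau W) (phi Z) q = b q * g W Z q.
  have [V [LV V0]] := exists_section p n0.
  have [e He] := local_inverse V0; exists (e * g (tau V) (phi V)).
  apply: filterS He => q eq1 W Z LW LZ.
  have N0 : g V V q != 0.
    by apply/eqP => N0; move: eq1; rewrite N0 mulr0 => /eqP; rewrite eq_sym oner_eq0.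
  have E := tau_umbilic LV LW LZ; have := @Cinf_at _ _ _ _ _ q E.
  rewrite ?evE => /eqP; rewrite mulf_eq0 (negPf N0) /= subr_eq0 => /eqP H.
  by rewrite -mulrA -H mulrA eq1 mul1r.
have [b Hb] := choice loc.
have bq p : \forall q \near (p : M), b q q = b p q.
  apply: filterS (Hb p) => q Hq; have [V [LV V0]] := exists_section q n0.
  have := Hq V V LV LV; rewrite (nbhs_singleton (Hb q) V V LV LV).
  by apply: mulIf.
have [b' Hb'] := glue_Cinf bq; exists b' => V LV.
have Qb : sections Q (b' *: phi V) by apply: (sectionsZ sQ); exact: phi_LQ.
have Qt := tau_L LV.
apply: (@metric_nondeg _ _ _ g) => Z.
have [A [B [LA QB ->]]] := dec_LQ Z.
have BE : B = phi (- phi B) by rewrite phiN (phi2_D (eQ QB)) opprK.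
have LB : sections L (- phi B) by apply: (sectionsN sL); exact: phi_QL.
have ->  : g (tau V) (A + B + eta Z *: xi) = g (tau V) B.
  by rewrite !gE g_xi (eQ Qt) [g _ A]gC (oLQ LA Qt); ring.
have ->  : g (b' *: phi V) (A + B + eta Z *: xi) = g (b' *: phi V) B.
  rewrite metricDr metricDr metricZr g_xi (eQ Qb) (gC S _ A) (oLQ LA Qb); ring.
rewrite BE metricZl g_phi (eL LV) mul0r subr0; apply: CinfE => p.
by rewrite CinfM (nbhs_singleton (Hb p) V _ LV LB) Hb'.
Qed.

End adapted_structure.

(** * Constancy of the torsion coefficients *)

Section constants.
Variables (R : realType) (n : nat) (M : manifold R (2 * n).+1).
Variable S : almost_contact_metric M.
Local Notation C := (Cinf M).
Local Notation X := (vfield M).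
Local Notation phi := (acm_phi S).
Local Notation xi := (acm_xi S).
Local Notation eta := (acm_eta S).
Local Notation g := (acm_g S).
Local Notation h := (h_op S).
Implicit Types (U V W Z : X) (f : C) (p q : M).
Local Notation gE := (gE S).

Section one_side.
Variables L Q : tangent_distribution M.
Variable D : connection M.
Hypothesis AD : adapted S n L Q D.
Local Notation tau := (tau S D).
Let eL V : sections L V -> eta V = 0.
Proof. by have [[[_ H _] _ _ _] _ _ _] := AD; exact: H. Qed.
Let eQ V : sections Q V -> eta V = 0.
Proof. by have [[_ [_ H _] _ _] _ _ _] := AD; exact: H. Qed.
Let oLQ : orthogonal_dist g L Q. Proof. by have [[_ _ _ H] _ _ _] := AD. Qed.
Let DL : preserves D L. Proof. by have [_ [H _] _ _] := AD. Qed.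
Let DQ : preserves D Q. Proof. by have [_ [_ H] _ _] := AD. Qed.
Let Dg : parallel2 D g. Proof. by have [_ _ [_ _ H _] _] := AD. Qed.
Let sL : is_subbundle n L. Proof. by have [[[H _ _] _ _ _] _ _ _] := AD. Qed.

Variables b c : C.
Hypothesis tb : forall V, sections L V -> tau V = b *: phi V.
Hypothesis tc : forall V, sections Q V -> tau V = c *: phi V.

Lemma h_on_L V : sections L V -> h V + h V = (b - c) *: V.
Proof.
move=> LV; rewrite (adapted_two_h AD) (tc (phi_LQ AD LV)) (tb LV) phiZ (phi2_D (eL LV)).
by apply: (@metric_nondeg _ _ _ g) => Z; rewrite !gE; ring.
Qed.

(** The first Bianchi identity on W = - phi V, V and xi, paired with V: of the
    three curvature terms one is 0, one is tangent to L and one is skew, and on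
    the side of the torsion only V b survives. *)
Lemma Q_tau_multiple V : sections Q V -> V b = 0.
Proof.
move=> QV; pose W := - phi V.
have LW : sections L W by apply: (sectionsN sL); exact: (phi_QL AD).
have phiW : phi W = V by rewrite phiN (phi2_D (eQ QV)) opprK.
have zL U : sections L U -> g U V = 0 by move=> LU; exact: oLQ.
have zxi : g xi V = 0 by rewrite g_xil eQ.
have E : g (curvature D W V xi + curvature D V xi W + curvature D xi W V) V = 0.
  have z1 := zL _ (curvature_L AD V xi LW).
  have z0 : curvature D W V xi = 0.
    by rewrite /curvature !(D_xi AD) !cov0r !subr0.
  by rewrite z0 add0r metricDl z1 add0r (curvature_diag Dg).
have ex U : eta U = 0 -> eta (bracket xi U) = 0.
  by move=> U0; rewrite (adapted_xi_eta AD) U0 vfield0.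
have ex' U : eta U = 0 -> eta (bracket U xi) = 0.
  by move=> U0; rewrite bracketC etaN ex// oppr0.
rewrite (bianchi g) in E.
have T1 : torsion D V xi = c *: phi V by rewrite (torsion_xi AD) tc.
have T2 : torsion D xi W = - (b *: V).
  by rewrite (torsionC g) (torsion_xi AD) tb// phiW.
have T3 U Y : eta U = 0 -> eta Y = 0 -> torsion D U Y = (2 * g U (phi Y)) *: xi.
  by move=> U0 Y0; rewrite (torsion_full AD) U0 Y0 !scale0r subr0 addr0.
have V0 := eQ QV; have W0 := eL LW.
have T4 : torsion D xi (bracket W V) = b *: D V V - c *: phi (D W V).
  have -> : bracket W V = D W V - D V W - (2 * g W (phi V)) *: xi.
    rewrite -(T3 W V W0 V0) /torsion.
    by apply: (@metric_nondeg _ _ _ g) => Z; rewrite !gE; ring.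
  rewrite (torsionC g) (torsion_xi AD) !(tauD, tauN, tauZ) (tau_xi AD).
  rewrite (tc (DQ _ QV)) (tb (DL _ LW)) -(adapted_D_phi AD V W) phiW.
  by apply: (@metric_nondeg _ _ _ g) => Z; rewrite !gE; ring.
rewrite T1 T2 T4 (T3 W V)// (T3 W (bracket V xi))// ?ex'// (T3 V (bracket xi W))// ?ex// in E.
rewrite !metricDl (zL (D W (c *: phi V))) in E; last first.
  by apply: DL; apply: (sectionsZ sL); exact: (phi_QL AD).
rewrite !(covNr, covZr, D_xi AD) !gE zxi (zL (phi (D W V))) in E; last first.
  exact: (phi_QL AD (DQ _ QV)).
have VbV : V b * g V V = 0.
  by apply: CinfE => p; at_point E p; rewrite ?evE; lra.
apply: CinfE => p; have := @Cinf_at _ _ _ _ _ p VbV; rewrite CinfM Cinf0 => /eqP.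
rewrite mulf_eq0 => /orP[/eqP//|/eqP/metric_def V0'].
by rewrite -[LHS]/(tangent V p b) V0'.
Qed.

End one_side.

Section both_sides.
Variables L Q : tangent_distribution M.
Variable D : connection M.
Hypothesis AD : adapted S n L Q D.
Hypothesis M_connected : connected [set: M].
Hypothesis xi_nonkilling : ~ killing g xi.
Local Notation tau := (tau S D).
Let AD' := adapted_swap AD.
Let eL V : sections L V -> eta V = 0.
Proof. by have [[[_ H _] _ _ _] _ _ _] := AD; exact: H. Qed.
Let eQ V : sections Q V -> eta V = 0.
Proof. by have [[_ [_ H _] _ _] _ _ _] := AD; exact: H. Qed.
Let DL : preserves D L. Proof. by have [_ [H _] _ _] := AD. Qed.
Let Dh : parallel_endo D h. Proof. by rewrite -h_opE; have [_ _ [_ _ _ H] _] := AD. Qed.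
Let K : contact_metric S := adapted_contact AD.
Let sQ : is_subbundle n Q. Proof. by have [[_ [H _ _] _ _] _ _ _] := AD. Qed.
Let sL : is_subbundle n L. Proof. by have [[[H _ _] _ _ _] _ _ _] := AD. Qed.

(** If n = 0 then xi spans the tangent spaces; as h xi = 0, xi would be Killing. *)
Lemma n_gt0 : (0 < n)%N.
Proof.
rewrite lt0n; apply/eqP => n0; apply: xi_nonkilling; apply: (killing_h0 K) => V.
have zero (T : tangent_distribution M) : is_subbundle n T -> forall U, sections T U -> U = 0.
  move=> sT U TU; apply: vfield_ext => p.
  have [E /nbhs_singleton [_ TE]] := sT p.
  have := TU p; rewrite TE => -[a ->]; apply/funext => f.
  by rewrite big1 // => i _; have := ltn_ord i; rewrite {2}n0.
have [A [B [LA QB ->]]] := dec_LQ AD V.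
by rewrite (zero _ sL _ LA) (zero _ sQ _ QB) !add0r hZ (h_xi S) scaler0.
Qed.

(** V b = 0 along Q and V c = 0 along L by [Q_tau_multiple]; b - c is constant
    because it is twice an eigenvalue of the parallel operator h. So b and c are
    constant along L and Q, and then along xi, which is a bracket of sections of
    L and Q modulo L + Q. *)
Lemma tau_constants : exists b c : R,
  (forall V, sections L V -> tau V = (b *: (1 : C)) *: phi V) /\
  (forall V, sections Q V -> tau V = (c *: (1 : C)) *: phi V).
Proof.
have [b tb] := tau_multiple AD n_gt0; have [c tc] := tau_multiple AD' n_gt0.
have bQ V : sections Q V -> V b = 0 by exact: (Q_tau_multiple AD tb tc).
have cL V : sections L V -> V c = 0 by exact: (Q_tau_multiple AD' tc tb).
have bc U : U b = U c.
  apply: CinfE => p; have [V [LV V0]] := exists_section AD p n_gt0.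
  have hV := h_on_L AD tb tc LV; have hDV := h_on_L AD tb tc (DL U LV).
  have E := Dh U V; have E2 : D U (h V + h V) = h (D U V) + h (D U V).
    by rewrite covDr; move/eqP: E; rewrite subr_eq0 => /eqP ->.
  rewrite hV hDV covZr in E2.
  have E3 : (U b - U c) * g V V = 0.
    have F := congr1 (fun W => g W V) E2.
    move: F; rewrite /= vfieldB metricDl !metricZl => F.
    by apply: CinfE => q; at_point F q; rewrite ?evE; lra.
  have := @Cinf_at _ _ _ _ _ p E3; rewrite CinfM Cinf0 CinfB => /eqP.
  by rewrite mulf_eq0 (negPf V0) orbF subr_eq0 => /eqP.
have bL V : sections L V -> V b = 0 by move=> LV; rewrite bc cL.
have bxi : xi b = 0.
  apply: CinfE => p; have [V [LV V0]] := exists_section AD p n_gt0.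
  have QV := phi_LQ AD LV.
  have E : bracket V (phi V) b = 0 by rewrite bracketE (bL _ LV) (bQ _ QV) !vfield0 subrr.
  have [A [B [LA QB VE]]] := dec_LQ AD (bracket V (phi V)).
  rewrite VE !vfD vfZ (bL _ LA) (bQ _ QB) !add0r in E.
  rewrite (eta_bracket AD (eL LV) (eQ QV)) (phi2_D (eL LV)) metricNr in E.
  have := @Cinf_at _ _ _ _ _ p E; rewrite ?evE => H.
  have : g V V p * xi b p = 0 by lra.
  by move/eqP; rewrite mulf_eq0 (negPf V0) => /eqP.
have bV U : U b = 0.
  have [A [B [LA QB ->]]] := dec_LQ AD U.
  by rewrite !vfD vfZ (bL _ LA) (bQ _ QB) bxi mulr0 !addr0.
have cV U : U c = 0 by rewrite -bc.
have const f : (forall U, U f = 0) -> exists a : R, f = a *: (1 : C).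
  move=> Uf; have [[p]|nM] := pselect (inhabited M).
    exists (f p); apply: CinfE => q; rewrite CinfZ Cinf1 mulr1.
    exact: constant_of_vfield.
  by exists 0; apply: CinfE => q; case: nM; exists.
have [b0 bE] := const b bV; have [c0 cE] := const c cV.
by exists b0, c0; rewrite -bE -cE.
Qed.

End both_sides.
End constants.

(** * From an adapted connection to the Levi-Civita connection *)

Section normal_form.
Variables (R : realType) (n : nat) (M : manifold R (2 * n).+1).
Variable S : almost_contact_metric M.
Local Notation C := (Cinf M).
Local Notation X := (vfield M).
Local Notation phi := (acm_phi S).
Local Notation xi := (acm_xi S).
Local Notation eta := (acm_eta S).
Local Notation g := (acm_g S).
Local Notation h := (h_op S).
Implicit Types (U V W Z : X) (f : C) (p q : M).
Local Notation gE := (gE S).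

(** The torsion of an adapted connection depends on two numbers: the eigenvalue l
    of h on L, and s. In terms of the coefficients of tau with respect to phi, b on L
    and c on Q, they are (b - c) / 2 and (b + c) / 2. *)
Record normal_form (L Q : tangent_distribution M) (D : connection M) (l s : R) : Prop := {
  nf_l0 : l != 0;
  nf_L : forall V, sections L V -> h V = (l *: (1 : C)) *: V;
  nf_Q : forall V, sections Q V -> h V = - ((l *: (1 : C)) *: V);
  nf_tau : forall V, tau S D V = phi (h V) + (s *: (1 : C)) *: phi V }.

Section existence.
Variables L Q : tangent_distribution M.
Variable D : connection M.
Hypothesis AD : adapted S n L Q D.
Hypothesis M_connected : connected [set: M].
Hypothesis xi_nonkilling : ~ killing g xi.

(** The eigenvalue l is not zero, as h = 0 would make xi a Killing field. *)
Lemma adapted_normal_form : exists l s : R, normal_form L Q D l s.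
Proof.
have K := adapted_contact AD; have AD' := adapted_swap AD.
have [b [c [tb tc]]] := tau_constants AD M_connected xi_nonkilling.
pose l := (b - c) / 2; pose s := (b + c) / 2.
have hL V : sections L V -> h V = (l *: (1 : C)) *: V.
  move=> LV; apply: mul2X; rewrite (h_on_L AD tb tc LV) -scalerDl.
  apply: (@metric_nondeg _ _ _ g) => Z; rewrite !gE.
  by apply: CinfE => p; rewrite ?evE /l; field.
have hQ V : sections Q V -> h V = - ((l *: (1 : C)) *: V).
  move=> QV; apply: mul2X; rewrite (h_on_L AD' tc tb QV) -scaleNr -scalerDl.
  apply: (@metric_nondeg _ _ _ g) => Z; rewrite !gE.
  by apply: CinfE => p; rewrite ?evE /l; field.
exists l, s; split=> //.
  apply/eqP => l0; apply: xi_nonkilling; apply: (killing_h0 K) => V.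
  have [A [B [LA QB ->]]] := dec_LQ AD V.
  by rewrite !hD hZ (h_xi S) (hL _ LA) (hQ _ QB) l0 !scale0r scaler0 oppr0 !addr0.
move=> V; have [A [B [LA QB ->]]] := dec_LQ AD V.
rewrite !hD hZ (h_xi S) scaler0 addr0 !tauD tauZ (tau_xi AD) scaler0 addr0.
rewrite (tb _ LA) (tc _ QB) (hL _ LA) (hQ _ QB) !(phiD, phiN, phiZ) phi_xi scaler0 addr0.
apply: (@metric_nondeg _ _ _ g) => Z; rewrite !gE; apply: CinfE => p; rewrite ?evE /l /s.
by field.
Qed.

End existence.

Section consequences.
Variables L Q : tangent_distribution M.
Variable D : connection M.
Hypothesis AD : adapted S n L Q D.
Variables l s : R.
Hypothesis NF : normal_form L Q D l s.
Local Notation lC := (l *: (1 : C)).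
Local Notation sC := (s *: (1 : C)).
Local Notation tau := (tau S D).
Let K : contact_metric S := adapted_contact AD.
Let Dg : parallel2 D g. Proof. by have [_ _ [_ _ H _] _] := AD. Qed.
Let Dh : parallel_endo D h. Proof. by rewrite -h_opE; have [_ _ [_ _ _ H] _] := AD. Qed.
Let eL V : sections L V -> eta V = 0.
Proof. by have [[[_ H _] _ _ _] _ _ _] := AD; exact: H. Qed.
Let eQ V : sections Q V -> eta V = 0.
Proof. by have [[_ [_ H _] _ _] _ _ _] := AD; exact: H. Qed.
Let sL : is_subbundle n L. Proof. by have [[[H _ _] _ _ _] _ _ _] := AD. Qed.

Lemma nf_h2 V : h (h V) = (l ^+ 2 *: (1 : C)) *: (V - eta V *: xi).
Proof.
have [A [B [LA QB VE]]] := dec_LQ AD V.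
have -> : V - eta V *: xi = A + B by rewrite [X in X - _]VE addrK.
have hV : h V = lC *: A - lC *: B.
  by rewrite {1}VE !hD hZ (h_xi S) scaler0 addr0 (nf_L NF LA) (nf_Q NF QB).
rewrite hV hD hN !hZ.
rewrite (nf_L NF LA) (nf_Q NF QB).
apply: (@metric_nondeg _ _ _ g) => Z; rewrite !gE; apply: CinfE => p; rewrite ?evE; ring.
Qed.

(** The covariant derivative of xi in a contact metric manifold, see [cov_xi]. *)
Definition xi_der V : X := - phi V - phi (h V).

(** The metric connection without torsion, recovered from D and its torsion. *)
Definition lc_cov V W : X :=
  D V W + eta W *: xi_der V - g (xi_der V) W *: xi + ((sC - 1) * eta V) *: phi W.

Lemma xi_der_lin f V W : xi_der (f *: V + W) = f *: xi_der V + xi_der W.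
Proof.
rewrite /xi_der h_lin !(phiD, phiZ).
by apply: (@metric_nondeg _ _ _ g) => Z; rewrite !gE; ring.
Qed.

Fact lc_cov_lin f U V W : lc_cov (f *: U + V) W = f *: lc_cov U W + lc_cov V W.
Proof.
rewrite /lc_cov xi_der_lin cov_lin etaD etaZ.
by apply: (@metric_nondeg _ _ _ g) => Z; rewrite !gE; ring.
Qed.

Fact lc_cov_add U V W : lc_cov U (V + W) = lc_cov U V + lc_cov U W.
Proof.
rewrite /lc_cov covDr etaD phiD.
by apply: (@metric_nondeg _ _ _ g) => Z; rewrite !gE; ring.
Qed.

Fact lc_cov_leibniz f V W : lc_cov V (f *: W) = V f *: W + f *: lc_cov V W.
Proof.
rewrite /lc_cov covZr etaZ phiZ.
by apply: (@metric_nondeg _ _ _ g) => Z; rewrite !gE; ring.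
Qed.

Definition lc_conn : connection M := Connection lc_cov_lin lc_cov_add lc_cov_leibniz.

Lemma lc_connE V W : lc_conn V W =
  D V W + eta W *: xi_der V - g (xi_der V) W *: xi + ((sC - 1) * eta V) *: phi W.
Proof. by []. Qed.

Lemma lc_conn_levi_civita : levi_civita g lc_conn.
Proof.
split=> [V W|V W Z]; last first.
  rewrite !lc_connE (parallel_metric Dg) !gE !g_xi !g_xil.
  rewrite (gC S W (phi V)) (gC S W (phi (h V))) -(opprK (g W (phi Z))) -phi_skew.
  by ring.
have T := torsion_full AD V W.
have -> : torsion lc_conn V W = torsion D V W + eta W *: xi_der V - g (xi_der V) W *: xi
    + ((sC - 1) * eta V) *: phi W - (eta V *: xi_der W - g (xi_der W) V *: xi
    + ((sC - 1) * eta W) *: phi V).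
  rewrite /torsion !lc_connE.
  by apply: (@metric_nondeg _ _ _ g) => Z; rewrite !gE; ring.
rewrite T !(nf_tau NF) /xi_der.
have E : g (phi (h V)) W = g (phi (h W)) V.
  by rewrite phi_skew (h_sym K) (h_phi K) metricNr opprK gC.
by apply: (@metric_nondeg _ _ _ g) => Z; rewrite !gE E (phi_skew S V W) (gC S (phi W) V); ring.
Qed.

Lemma lc_conn_xi V : lc_conn V xi = xi_der V.
Proof.
have e0 : eta (xi_der V) = 0 by rewrite /xi_der etaD !etaN !eta_phi oppr0 addr0.
rewrite lc_connE (D_xi AD) eta_xi phi_xi scaler0 scale1r g_xi e0 scale0r.
by rewrite oppr0 !addr0 add0r.
Qed.

(** D commutes with the endomorphism [xi_der] and kills xi, so the curvature of xi
    is made of [xi_der] applied to the torsion of D and of algebraic terms. *)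
Lemma lc_conn_curvature V W : curvature lc_conn V W xi =
  ((1 - l ^+ 2) *: (1 : C)) *: (eta W *: V - eta V *: W) +
  ((2 * (1 - s)) *: (1 : C)) *: (eta W *: h V - eta V *: h W).
Proof.
have e0 U : eta (xi_der U) = 0.
  by rewrite /xi_der etaD !etaN !eta_phi oppr0 addr0.
have Dx U Y : D U (xi_der Y) = xi_der (D U Y).
  have E : D U (h Y) = h (D U Y).
    by have /eqP := Dh U Y; rewrite subr_eq0 => /eqP.
  by rewrite /xi_der covDr !covNr !(adapted_D_phi AD) E.
have xD A B : xi_der (A + B) = xi_der A + xi_der B.
  by rewrite -[A]scale1r xi_der_lin !scale1r.
have x0 : xi_der 0 = 0 by apply: (addrI (xi_der 0)); rewrite -xD !addr0.
have xZ f A : xi_der (f *: A) = f *: xi_der A.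
  by rewrite -[f *: A]addr0 xi_der_lin x0 addr0.
have xN A : xi_der (- A) = - xi_der A by rewrite -scaleN1r xZ scaleN1r.
have xxi : xi_der xi = 0 by rewrite /xi_der (h_xi S) phi_xi (linear0 phi) subr0 oppr0.
have T : bracket V W = D V W - D W V - torsion D V W.
  rewrite /torsion; apply: (@metric_nondeg _ _ _ g) => Z; rewrite !gE; ring.
have phx U : phi (xi_der U) = U - eta U *: xi + h U.
  rewrite /xi_der phiD !phiN (phi2_D (eta_h K U)) opprK acm_phi2.
  by apply: (@metric_nondeg _ _ _ g) => Z; rewrite !gE; ring.
have xtau U : xi_der (tau U) = (1 - sC) *: h U + sC *: (U - eta U *: xi)
    - (l ^+ 2 *: (1 : C)) *: (U - eta U *: xi).
  rewrite (nf_tau NF) xD xZ /xi_der !(h_phi K) !phiN (nf_h2 U).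
  rewrite phiZ !phiD !phiN !phiZ phi_xi scaler0 subr0 (phi2_D (eta_h K U)) acm_phi2.
  by apply: (@metric_nondeg _ _ _ g) => Z; rewrite !gE; ring.
rewrite /curvature !lc_conn_xi !lc_connE !e0 !scale0r !addr0 !Dx !phx.
rewrite T (torsion_full AD) !(xD, xN, xZ) xxi !xtau (gC S (xi_der W)).
apply: (@metric_nondeg _ _ _ g) => Z; rewrite !gE; apply: CinfE => p; rewrite ?evE; ring.
Qed.

Lemma nf_contact_metric_space : contact_metric_space S (1 - l ^+ 2) (2 * (1 - s)).
Proof.
split; first exact: K.
exists lc_conn; first exact: lc_conn_levi_civita.
by move=> V W; rewrite h_opE; exact: lc_conn_curvature.
Qed.

(** A field with h V = l V at p has no component along Q, where h is - l, nor along
    xi, where h is 0. *)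
Lemma nf_eigendist : L = eigendist (acm_h S) l.
Proof.
rewrite h_opE; apply/funext => p; apply/seteqP; split=> v.
  move=> /(subbundle_extend sL)[V [LV <-]]; exists V => //=.
  by rewrite (nf_L NF LV); apply/funext => f; rewrite /tangent vfZ CinfM CinfZ Cinf1 mulr1.
move=> [V /= hV <-]; have [A [B [LA QB VE]]] := dec_LQ AD V.
have E f : 2 * B f p + eta V p * xi f p = 0.
  have := congr1 (fun t : C -> R => t f) hV; rewrite /tangent /= {1 2}VE.
  rewrite !hD hZ (h_xi S) scaler0 addr0 (nf_L NF LA) (nf_Q NF QB).
  rewrite !(vfD, vfN, vfZ) ?evE !mulr1 => H.
  by apply: (mulfI (nf_l0 NF)); rewrite mulr0; move: H; lra.
have T2 : tangent ((2 *: (1 : C)) *: B + eta V *: xi) p = tangent 0 p.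
  by apply/funext => f; rewrite /tangent vfD !vfZ CinfD !CinfM CinfZ Cinf1 mulr1 E.
have B0 : tangent B p = fun=> 0.
  apply: (@metric_def _ _ _ g).
  have := metric_tangentl g B T2; rewrite metric0l metricDl !metricZl g_xil (eQ QB).
  rewrite mulr0 addr0 CinfM CinfZ Cinf1 mulr1 Cinf0 => /eqP.
  by rewrite mulf_eq0 pnatr_eq0 => /eqP.
have eV : eta V p = 0.
  have := eta_tensor S T2; rewrite etaD !etaZ (eQ QB) eta_xi mulr0 add0r mulr1.
  by rewrite (linear0 eta).
have -> : tangent V p = tangent A p; last exact: LA.
apply/funext => f; rewrite /tangent {1}VE !vfD vfZ !CinfD CinfM eV mul0r addr0.
by rewrite -[B f p]/(tangent B p f) B0 addr0.
Qed.

Lemma nf_kappa : (0 < n)%N -> forall p kappa mu, contact_metric_space S kappa mu ->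
  l ^+ 2 = 1 - kappa.
Proof.
move=> n0 p kappa mu [_ [N LC]]; rewrite h_opE => curv.
have [V [LV V0]] := exists_section AD p n0.
have E := h_square K LC curv (eL LV).
rewrite nf_h2 (eL LV) scale0r subr0 in E.
have := congr1 (fun U => g U V) E; rewrite /= !gE => F.
have := @Cinf_at _ _ _ _ _ p F; rewrite ?evE => H.
by apply: (mulIf V0); move: H; lra.
Qed.

End consequences.

Lemma nf_swap L Q D l s : adapted S n L Q D -> normal_form L Q D l s ->
  normal_form Q L D (- l) s.
Proof.
move=> AD [l0 hL hQ ht]; split=> //; first by rewrite oppr_eq0.
  by move=> V /hQ ->; rewrite scaleNr scaleNr.
by move=> V /hL ->; rewrite scaleNr scaleNr opprK.
Qed.

(** On L the two derivatives D_xi V and D'_xi V are eigenvectors of h for l, whereas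
    their difference (s - s') phi V is one for - l: hence s = s'. The torsions are
    then equal, and a metric connection is determined by its torsion. *)
Lemma adapted_unique L Q D l s L' Q' D' l' s' : (0 < n)%N ->
  adapted S n L Q D -> normal_form L Q D l s ->
  adapted S n L' Q' D' -> normal_form L' Q' D' l' s' ->
  forall V W, D' V W = D V W.
Proof.
move=> n0 AD NF AD' NF' V W.
have K := adapted_contact AD.
have Dh : parallel_endo D h by rewrite -h_opE; have [_ _ [_ _ _ H] _] := AD.
have Dh' : parallel_endo D' h by rewrite -h_opE; have [_ _ [_ _ _ H] _] := AD'.
have Dg : parallel2 D g by have [_ _ [_ _ H _] _] := AD.
have Dg' : parallel2 D' g by have [_ _ [_ _ H _] _] := AD'.
have eL U : sections L U -> eta U = 0.
  by have [[[_ H _] _ _ _] _ _ _] := AD; exact: H.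
have ss p : s = s'.
  have [U [LU U0]] := exists_section AD p n0.
  have E : D' xi U - D xi U = ((s - s') *: (1 : C)) *: phi U.
    have E1 := nf_tau NF U; have E2 := nf_tau NF' U; rewrite tauE in E1; rewrite tauE in E2.
    apply: (@metric_nondeg _ _ _ g) => Z; have F1 := congr1 (fun U => g U Z) E1.
    have F2 := congr1 (fun U => g U Z) E2; move: F1 F2; rewrite /= !gE => F1 F2.
    by apply: CinfE => q; at_point F1 q; at_point F2 q; rewrite ?evE; lra.
  have H1 : h (D xi U) = (l *: (1 : C)) *: D xi U.
    have /eqP := Dh xi U; rewrite subr_eq0 => /eqP <-.
    by rewrite (nf_L NF LU) covZcr.
  have H2 : h (D' xi U) = (l *: (1 : C)) *: D' xi U.
    have /eqP := Dh' xi U; rewrite subr_eq0 => /eqP <-.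
    by rewrite (nf_L NF LU) covZcr.
  have H3 := congr1 h E; rewrite hD hN H1 H2 hZ (h_phi K) (nf_L NF LU) phiZ in H3.
  have F := congr1 (fun Y => g Y (phi U)) H3; have F2 := congr1 (fun Y => g Y (phi U)) E.
  move: F F2; rewrite /= !gE !g_phi (eL _ LU) mul0r subr0 => F F2.
  have := @Cinf_at _ _ _ _ _ p F; have := @Cinf_at _ _ _ _ _ p F2; rewrite ?evE => G1 G2.
  have : l * ((s - s') * g U U p) = 0.
    have : l * (g (D' xi U) (phi U) p - g (D xi U) (phi U) p) =
           l * ((s - s') * g U U p) by rewrite G1; ring.
    move: G2; lra.
  move/eqP; rewrite !mulf_eq0 (negPf (nf_l0 NF)) (negPf U0) orbF subr_eq0.
  by move/eqP.
apply: vfield_ext => p; have {}ss := ss p; subst s'.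
congr (tangent _ p); move: V W.
have TT V W : torsion D' V W = torsion D V W.
  by rewrite (torsion_full AD) (torsion_full AD') !(nf_tau NF) !(nf_tau NF').
have sym V W : D' V W - D V W = D' W V - D W V.
  have := TT V W; rewrite /torsion => E.
  apply: (@metric_nondeg _ _ _ g) => Z; have F := congr1 (fun U => g U Z) E.
  move: F; rewrite /= !gE => F; apply: CinfE => q; at_point F q; lra.
have skew V W Z : g (D' V W - D V W) Z = - g (D' V Z - D V Z) W.
  have E1 := parallel_metric Dg V W Z; rewrite (parallel_metric Dg' V W Z) in E1.
  rewrite !gE [g (D' V Z) _]gC [g (D V Z) _]gC.
  by apply: CinfE => q; at_point E1 q; rewrite ?evE; lra.
move=> V W; apply/eqP; rewrite -subr_eq0; apply/eqP.
apply: (@metric_nondeg _ _ _ g) => Z; rewrite metric0l; apply: mul2C.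
rewrite mulr_natl mulr2n {1}sym skew sym skew opprK sym skew sym addNr.
by [].
Qed.

End normal_form.

Theorem theorem4p2 (R : realType) (n : nat) (M : manifold R (2 * n).+1)
    (M_connected : connected [set: M])
    (S : almost_contact_metric M)
    (xi_nonkilling : ~ killing (acm_g S) (acm_xi S)) :
  ((exists kappa mu : R, contact_metric_space S kappa mu) <->
   (exists (L Q : tangent_distribution M) (D : connection M), adapted S n L Q D)) /\
  (forall (L Q : tangent_distribution M) (D : connection M), adapted S n L Q D ->
    [/\ forall (L' Q' : tangent_distribution M) (D' : connection M),
          adapted S n L' Q' D' -> forall V W : vfield M, D' V W = D V W,
        integrable_dist L,
        integrable_dist Q &
        forall kappa mu : R, contact_metric_space S kappa mu ->
          (L = eigendist (acm_h S) (Num.sqrt (1 - kappa)) /\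
           Q = eigendist (acm_h S) (- Num.sqrt (1 - kappa))) \/
          (L = eigendist (acm_h S) (- Num.sqrt (1 - kappa)) /\
           Q = eigendist (acm_h S) (Num.sqrt (1 - kappa)))]).
Proof.
split.
  split=> [[kappa [mu [K [N LC]]]]|[L [Q [D AD]]]].
    rewrite h_opE => curv.
    have k1 := kappa_lt1 K LC curv xi_nonkilling.
    pose l := Num.sqrt (1 - kappa).
    have l0 : l != 0 by rewrite gt_eqF// sqrtr_gt0 subr_gt0.
    have l2 : l ^+ 2 = 1 - kappa by rewrite sqr_sqrtr// subr_ge0 ltW.
    have h2 V : acm_eta S V = 0 -> h_op S (h_op S V) = (l ^+ 2 *: (1 : Cinf M)) *: V.
      move=> V0; rewrite (h_square K LC curv V0) l2 scalerBl scalerBl.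
      by rewrite !scale1r.
    exists (eigendist (acm_h S) l), (eigendist (acm_h S) (- l)), (adapted_conn K N l0 h2).
    exact: (adapted_eigen K LC curv l0 h2).
  have [l [s NF]] := adapted_normal_form AD M_connected xi_nonkilling.
  by exists (1 - l ^+ 2), (2 * (1 - s)); exact: (nf_contact_metric_space AD NF).
move=> L Q D AD.
have n0 := n_gt0 AD xi_nonkilling.
have [l [s NF]] := adapted_normal_form AD M_connected xi_nonkilling.
have ADs := adapted_swap AD; have NFs := nf_swap AD NF.
split.
- move=> L' Q' D' AD' V W.
  have [l' [s' NF']] := adapted_normal_form AD' M_connected xi_nonkilling.
  exact: (adapted_unique n0 AD NF AD' NF').
- exact: (adapted_integrable AD).
- exact: (adapted_integrable ADs).
move=> kappa mu KM.
have EL := nf_eigendist AD NF; have EQ := nf_eigendist ADs NFs.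
have [p] : inhabited M.
  apply: contra_notP xi_nonkilling => nM V W; apply: CinfE => p.
  by case: nM; exists.
have E := nf_kappa AD NF n0 p KM.
rewrite -E sqrtr_sqr; have [l0|l0] := ltP 0 l.
  by left; rewrite gtr0_norm.
by right; rewrite ler0_norm// opprK.
Qed.
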